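(* Let $\{Q_i\}_{i\in\bar\Lambda}$ be a complete set of key polynomials for $\nu$, let $i\in\bar\Lambda$ and $h\in K[x]\setminus\{0\}$. Let $b_i$ be the smallest positive integer $b$ maximizing $\frac{\beta_i-\nu(\partial_bQ_i)}{b}$. (1) For all $b\in\mathbb N_0$ we have $$\nu_i(h)-\nu_i(\partial_bh)\le\frac b{b_i}\left(\beta_i-\nu(\partial_{b_i}Q_i)\right).\qquad( * )$$ (2) Let $h=\sum_{j=0}^sd_{j,i}Q_i^j$ be an $i$-standard expansion of $h$ and assume that $\{j\in\{0,\dots,s\}:\nu(d_{j,i}Q_i^j)=\nu_i(h)\}\ne\{0\}$. Let $d_{j,i}Q_i^j$ be the term of this expansion which minimizes the triple $\left(\nu_i(d_{j,i}Q_i^j),\nu^{(p)}(j),j\right)$ in the lexicographical ordering. Let $e=\nu^{(p)}(j)$ and $b(i,h)=b_ip^e$. Then equality holds in $( * )$ for $b=b(i,h)$.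
   Context: Setting. $K\subset K(x)$ is a simple transcendental extension, $\nu$ a valuation of $K(x)$ with value group $\Gamma$ and residue field $k_\nu$, $\nu_K=\nu|_K$ with value group $\Gamma_0$; $\operatorname{rank}\nu_K=1$, $\nu(x)>0$. $p=\operatorname{char}k_\nu$ if this is positive, $p=1$ otherwise. If $p>1$, $\nu^{(p)}$ is the $p$-adic valuation of integers; if $p=1$, $\nu^{(p)}(a)=1$ for $a\ne0$ and $\nu^{(p)}(0)=\infty$. $\partial_b$ is the $b$-th Hasse derivative: $f(x+y)=\sum_b\partial_bf(x)y^b$. Convention $\nu(0)=\infty$. $\tilde\Gamma_0=\Gamma_0\otimes_{\mathbb Z}\mathbb Q$, with a fixed ordered embedding into $\mathbb R$; values are compared in $\Gamma\otimes\mathbb Q$. $\mathbb N$ = positive integers, $\mathbb N_0=\mathbb N\cup\{0\}$. $G_\nu=\bigoplus_{\beta\in\Gamma}\mathbf P_\beta/\mathbf P_{\beta+}$ with $\mathbf P_\beta=\{y\in K(x):\nu(y)\ge\beta\}$, $\mathbf P_{\beta+}=\{y:\nu(y)>\beta\}$; $\mathrm{in}_\nu y$ is the class of $y$ in degree $\nu(y)$; $G_{\nu_K}$ is the analogous algebra for $(K,\nu_K)$. For a graded domain $G$, $G^*=\{g/h: g,h\in G,\ h\ne0 \text{ homogeneous}\}$. Index sets. $\Lambda$ is a countable well ordered set with least element $0$; $i+1$ is the successor of $i$, etc. $(\alpha_i)_{i\in\Lambda}$ are positive integers, $\alpha_0=1$. $i$ is inessential if $i+\omega\in\Lambda$ and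 $\alpha_{i+t}=1$ for all $t\in\mathbb N_0$. For non-maximal $i$, $i+$ denotes $i+\omega$ if $i$ is inessential, and $i+1$ otherwise. Pre-key polynomials: monic $Q_i\in K[x]$ $(i\in\Lambda)$, $Q_0=x$, with $\deg Q_i=\alpha_i\deg Q_{i_0}$ for all non-maximal $i\ge1$ and $i_0<i$ with $i_0+=i$. Put $\beta_i=\nu(Q_i)$, $\bar\alpha_i=\deg_xQ_i$, $\mathbf Q_i=\{Q_q\}_{q<i}$. Standard expansions. An $\ell$-standard monomial is $c\prod_{i\le\ell}Q_i^{\gamma_i}$, $c\in K$, $\gamma_i\in\mathbb N_0$ almost all $0$, with $\gamma_i<\alpha_{i+}$ for $i<\ell$ and, for each inessential $i$, at most one $j$ with $j+=i+$ and $\gamma_j\neq0$ (here $i+$ is computed in $\{q\in\Lambda:q\le\ell\}$). It is $Q_\ell$-free if $\gamma_\ell=0$. A $Q_\ell$-free $\ell$-standard expansion is a finite sum of $Q_\ell$-free $\ell$-standard monomials whose $\nu$-value is the minimum of the values of the monomials. An $\ell$-standard expansion of $g\in K[x]$ is $g=\sum_jc_jQ_\ell^j$ with each $c_j$ a $Q_\ell$-free $\ell$-standard expansion. Set of key polynomials for $\nu$: a set of pre-key polynomials such that (a) $\beta_i\in\tilde\Gamma_0$ for $i\ne\max\Lambda$; (b) if $i\ge1$ has an immediate predecessor, $Q_i$ has an $(i-1)$-standard expansion $Q_i=Q_{i-1}^{\alpha_i}+\sum_{j<\alpha_i}\big(\sum_\gamma c_{j,\gamma}M_\gamma\big)Q_{i-1}^j$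 where the $c_{j,\gamma}M_\gamma$ are $Q_{i-1}$-free $(i-1)$-standard monomials ($c_{j,\gamma}\in K$, $M_\gamma$ a product of powers of elements of $\mathbf Q_{i-1}$; elements of $K$ if $i=1$), all the monomials appearing have the same $\nu$-value, and $(\mathrm{in}_\nu Q_{i-1})^{\alpha_i}+\sum_{j}\big(\sum_\gamma \mathrm{in}_{\nu_K}c_{j,\gamma}\,\mathrm{in}_\nu M_\gamma\big)(\mathrm{in}_\nu Q_{i-1})^j=0$ is the minimal algebraic relation of $\mathrm{in}_\nu Q_{i-1}$ over $G_{\nu_K}[\mathrm{in}_\nu\mathbf Q_{i-1}]^*$; (c) if $i\geq 1$ has no immediate predecessor, there is $i_0$ with $i_0+=i$, and for every such $i_0$ there is an $i_0$-standard expansion $Q_i=\sum_{j=0}^{\alpha_i}c_{j,i_0}Q_{i_0}^j$; every such expansion satisfies $\nu(Q_i)>\min_j\nu(c_{j,i_0}Q_{i_0}^j)$, and $Q_i$ has the smallest degree among polynomials with this property for all $i_0$ with $i_0+=i$; if $\{\beta_{i'}:i'<i\}$ is bounded in $\tilde\Gamma_0$ (in particular if $i\ne\max\Lambda$) then $c_{\alpha_i,i_0}=1$ and $\min_j\nu(c_{j,i_0}Q_{i_0}^j)=\alpha_i\beta_{i_0}=\nu(c_{0,i_0})$; (d) if for some $n$ the set $\{i:\deg Q_i=n\}$ is infinite, then $\{\nu(Q_i):\deg Q_i=n\}$ is cofinal in $\{\nu(f): f\in K[x]\text{ monic},\deg f=n\}$. Truncations. Each $f\in K[x]$ has a unique $Q_i$-expansion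 $f=\sum_jd_{j,i}Q_i^j$ with $\deg d_{j,i}<\deg Q_i$; put $\nu_i(f)=\min_j\{\nu(d_{j,i})+j\beta_i\}$. A set of key polynomials is complete if for every nonzero $f\in K[x]$ there is $i\in\Lambda$ with $\nu_i(f)=\nu(f)$. *)

(* Defs.v *)
From HB Require Import structures.
From mathcomp Require Import all_boot all_order all_algebra.
From mathcomp Require Import finmap.
From mathcomp Require Import boolp classical_sets cardinality constructive_ereal.

Set Implicit Arguments.
Unset Strict Implicit.
Unset Printing Implicit Defensive.

Import Order.TTheory GRing.Theory.
Local Open Scope ring_scope.
Local Open Scope quotient_scope.

Notation "x %:F" := (tofrac x) : ring_scope.

(* Totally ordered vector spaces over rat: the ordered groups Gamma (x) Q. *)
HB.mixin Record POrderedZmodule_isTotallyOrdered V of Num.POrderedZmodule V := {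
  ler_translate : forall x y z : V, y <= z -> x + y <= x + z;
  ler_totality : total (<=%R : rel V)
}.

#[short(type="orderedQModType")]
HB.structure Definition OrderedQMod :=
  { V of GRing.Lmodule rat V & Num.POrderedZmodule V
       & POrderedZmodule_isTotallyOrdered V }.

HB.instance Definition _ (V : orderedQModType) :=
  Order.POrder_isTotal.Build ring_display V (@ler_totality V).

(* \bar T is ordered in the library only when T is a numDomainType. *)
Definition ext_le {d} {T : porderType d} (x y : \bar T) : bool :=
  match x, y with
  | -oo%E, _ | _, +oo%E => true
  | a%:E, b%:E => (a <= b)%O
  | _, _ => false
  end.

Definition ext_lt {d} {T : porderType d} (x y : \bar T) : bool :=
  (x != y) && ext_le x y.

Notation "x <=oo y" := (ext_le x y) (at level 70, y at next level) : ring_scope.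
Notation "x <oo y" := (ext_lt x y) (at level 70, y at next level) : ring_scope.

Definition ext_min {d} {T : porderType d} (x y : \bar T) : \bar T :=
  if x <=oo y then x else y.

Record valuation (F : fieldType) (V : orderedQModType) := Valuation {
  val_fun :> F -> \bar V;
  val0 : val_fun 0 = +oo%E;
  val_fin : forall x, x != 0 -> exists g : V, val_fun x = g%:E;
  valM : forall x y, val_fun (x * y) = (val_fun x + val_fun y)%E;
  valD : forall x y, ext_min (val_fun x) (val_fun y) <=oo val_fun (x + y)
}.

Section ValuationTheory.
Context (F : fieldType) (V : orderedQModType) (v : valuation F V).
Implicit Types (x y : F) (g : V).

Definition value_group : set V := [set g | exists x, v x = g%:E].

Lemma ext_le_trans (a b c : \bar V) : a <=oo b -> b <=oo c -> a <=oo c.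
Proof. by case: a b c => [a||] [b||] [c||] //=; exact: le_trans. Qed.

Lemma ext_lexx (a : \bar V) : a <=oo a.
Proof. by case: a => //= a. Qed.

Lemma ltr_translate (g x y : V) : x < y -> g + x < g + y.
Proof.
move=> lxy; rewrite lt_neqAle ler_translate ?ltW // andbT.
by apply/eqP => /addrI exy; rewrite exy ltxx in lxy.
Qed.

Lemma ext_ltE g (a : \bar V) :
  (g%:E <oo a) = (if a is h%:E then g < h else a == +oo%E).
Proof.
case: a => [h||] //=; rewrite /ext_lt /= lt_neqAle.
by congr (~~ _ && _).
Qed.

Lemma ext_ltW g (a : \bar V) : g%:E <oo a -> g%:E <=oo a.
Proof. by case/andP. Qed.

Lemma ext_lt_trans g (a b : \bar V) : g%:E <oo a -> a <=oo b -> g%:E <oo b.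
Proof. by rewrite !ext_ltE; case: a b => [a||] [b||] //=; exact: lt_le_trans. Qed.

Lemma val1 : v 1 = 0%:E.
Proof.
have [g vg] := val_fin v (oner_neq0 F).
have := valM v 1 1; rewrite mulr1 vg => -[] /eqP.
by rewrite -[X in X == _]addr0 (inj_eq (addrI _)) eq_sym => /eqP->.
Qed.

Lemma valN x : v (- x) = v x.
Proof.
suff -> : v (- x) = (v (-1)%R + v x)%E.
  have [g vg] : exists g, v (-1)%R = g%:E by apply: val_fin; rewrite oppr_eq0 oner_neq0.
  have := valM v (-1)%R (-1); rewrite mulrNN mulr1 val1 vg => -[] /esym g2.
  have g0 : g = 0.
    case: (ltgtP g 0) => // lg; have := ltr_translate g lg; rewrite g2 addr0 => lg2.
      by have := lt_trans lg lg2; rewrite ltxx.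
    by have := lt_trans lg lg2; rewrite ltxx.
  by rewrite g0; case: (v x) => [h||] //; rewrite /adde /= ?add0r.
by rewrite -valM mulN1r.
Qed.

Lemma val_leD g x y : g%:E <=oo v x -> g%:E <=oo v y -> g%:E <=oo v (x + y).
Proof.
move=> gx gy; apply: ext_le_trans (valD v x y).
by rewrite /ext_min; case: ifP.
Qed.

Lemma val_ltD g x y : g%:E <oo v x -> g%:E <oo v y -> g%:E <oo v (x + y).
Proof.
move=> gx gy; apply: ext_lt_trans (valD v x y).
by rewrite /ext_min; case: ifP.
Qed.

Lemma val_sum_le (I : Type) (r : seq I) (P : pred I) (f : I -> F) g :
  (forall i, P i -> g%:E <=oo v (f i)) ->
  g%:E <=oo v (\sum_(i <- r | P i) f i).
Proof.
move=> le_f; elim/big_ind: _ => //; first by rewrite val0.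
by move=> x y; exact: val_leD.
Qed.

Lemma val_sum_lt (I : eqType) (r : seq I) (P : pred I) (f : I -> F) g :
  (forall i, i \in r -> P i -> g%:E <oo v (f i)) ->
  g%:E <oo v (\sum_(i <- r | P i) f i).
Proof.
move=> lt_f; rewrite big_seq_cond; elim/big_ind: _ => //; first by rewrite val0.
  by move=> x y; exact: val_ltD.
by move=> i /andP[]; exact: lt_f.
Qed.

Lemma val_leM g h x y :
  g%:E <=oo v x -> h%:E <=oo v y -> (g + h)%:E <=oo v (x * y).
Proof.
rewrite valM; case: (v x) (v y) => [a||] [b||] //= ga hb.
apply: le_trans (ler_translate _ _ _ hb) _.
by rewrite ![_ + b]addrC; exact: ler_translate.
Qed.

Lemma val_ltM g h x y :
  g%:E <=oo v x -> h%:E <oo v y -> (g + h)%:E <oo v (x * y).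
Proof.
rewrite valM !ext_ltE; case: (v x) (v y) => [a||] [b||] //= ga hb.
apply: lt_le_trans (ltr_translate _ hb) _.
by rewrite ![_ + b]addrC; exact: ler_translate.
Qed.

End ValuationTheory.

Section Restriction.
Context (E F : fieldType) (V : orderedQModType) (f : {rmorphism E -> F}).
Context (v : valuation F V).

Fact val_restr0 : v (f 0) = +oo%E.
Proof. by rewrite rmorph0 val0. Qed.

Fact val_restr_fin x : x != 0 -> exists g : V, v (f x) = g%:E.
Proof. by move=> x0; apply: val_fin; rewrite fmorph_eq0. Qed.

Fact val_restrM x y : v (f (x * y)) = (v (f x) + v (f y))%E.
Proof. by rewrite rmorphM valM. Qed.

Fact val_restrD x y : ext_min (v (f x)) (v (f y)) <=oo v (f (x + y)).
Proof. by rewrite rmorphD valD. Qed.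

Definition val_restr : valuation E V :=
  @Valuation E V (v \o f) val_restr0 val_restr_fin val_restrM val_restrD.

End Restriction.

(* The graded algebra G_v is the direct sum of the P_b / P_b+.  It is presented
   as the quotient of the finite formal sums of pairs (b, y) with b <= v y,
   where (b, y) stands for the class of y in degree b. Degrees outside the value
   group may occur, but they only carry the zero module. *)
Section GradedAlgebra.
Context (F : fieldType) (V : orderedQModType) (v : valuation F V).

Definition gr_wf (s : seq (V * F)) := all (fun u => u.1%:E <=oo v u.2) s.

Record gr_pre := GrPre { gr_seq :> seq (V * F); _ : gr_wf gr_seq }.

HB.instance Definition _ := [isSub for gr_seq].
HB.instance Definition _ := [Choice of gr_pre by <:].

Definition gr_comp (b : V) (s : seq (V * F)) : F := \sum_(u <- s | u.1 == b) u.2.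

Definition gr_equiv (s t : gr_pre) : bool :=
  `[< forall b : V, b%:E <oo v (gr_comp b s - gr_comp b t) >].

Fact gr_equiv_refl : reflexive gr_equiv.
Proof. by move=> s; apply/asboolP => b; rewrite subrr val0. Qed.

Fact gr_equiv_symi s t : gr_equiv s t -> gr_equiv t s.
Proof. by move/asboolP => st; apply/asboolP => b; rewrite -opprB valN. Qed.

Fact gr_equiv_sym : symmetric gr_equiv.
Proof. by move=> s t; apply/idP/idP; exact: gr_equiv_symi. Qed.

Fact gr_equiv_trans : transitive gr_equiv.
Proof.
move=> t s r /asboolP st /asboolP tr; apply/asboolP => b.
by rewrite -(subrKA (gr_comp b t)) val_ltD.
Qed.

Canonical gr_equiv_rel :=
  EquivRel gr_equiv gr_equiv_refl gr_equiv_sym gr_equiv_trans.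

Definition gr := {eq_quot gr_equiv}.
HB.instance Definition _ : EqQuotient _ gr_equiv gr := EqQuotient.on gr.
HB.instance Definition _ := Choice.on gr.

Definition seq_mul (s t : seq (V * F)) : seq (V * F) :=
  [seq (u.1 + w.1, u.2 * w.2) | u <- s, w <- t].

Definition seq_opp (s : seq (V * F)) : seq (V * F) := [seq (u.1, - u.2) | u <- s].

Lemma wf0 : gr_wf [::]. Proof. by []. Qed.

Lemma wf1 (b : V) (y : F) : b%:E <=oo v y -> gr_wf [:: (b, y)].
Proof. by rewrite /gr_wf /= andbT. Qed.

Lemma wf_one : gr_wf [:: (0, 1)].
Proof. by apply: wf1; rewrite val1 ext_lexx. Qed.

Lemma wf_add (s t : gr_pre) : gr_wf (s ++ t).
Proof. by rewrite /gr_wf all_cat; apply/andP; split; [exact: (valP s)|exact: (valP t)]. Qed.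

Lemma wf_opp (s : gr_pre) : gr_wf (seq_opp s).
Proof.
rewrite /gr_wf all_map; apply: sub_all (valP s) => u /=.
by rewrite valN.
Qed.

Lemma wf_mul (s t : gr_pre) : gr_wf (seq_mul s t).
Proof.
apply/allP => _ /allpairsP[[u w] /= [us wt ->]] /=.
apply: val_leM; first exact: (allP (valP s)).
exact: (allP (valP t)).
Qed.

Definition pre0 := GrPre wf0.
Definition pre1 := GrPre wf_one.
Definition pre_add s t := GrPre (wf_add s t).
Definition pre_opp s := GrPre (wf_opp s).
Definition pre_mul s t := GrPre (wf_mul s t).

Lemma comp0 b : gr_comp b pre0 = 0. Proof. by rewrite /gr_comp big_nil. Qed.

Lemma comp_add b (s t : gr_pre) :
  gr_comp b (pre_add s t) = gr_comp b s + gr_comp b t.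
Proof. by rewrite /gr_comp big_cat. Qed.

Lemma comp_opp b (s : gr_pre) : gr_comp b (pre_opp s) = - gr_comp b s.
Proof. by rewrite /gr_comp big_map sumrN. Qed.

Lemma comp_mul b (s t : gr_pre) :
  gr_comp b (pre_mul s t) = \sum_(w <- t) w.2 * gr_comp (b - w.1) s.
Proof.
rewrite /gr_comp big_mkcond big_allpairs_dep /= exchange_big /=; apply: eq_bigr => w _.
rewrite -big_mkcond mulr_sumr /=; apply: eq_big => [u|u _]; last exact: mulrC.
by rewrite eq_sym -subr_eq eq_sym.
Qed.

Lemma comp_mulC b (s t : gr_pre) :
  gr_comp b (pre_mul s t) = gr_comp b (pre_mul t s).
Proof.
rewrite /gr_comp !(big_mkcond (fun u => u.1 == b)) !big_allpairs_dep exchange_big /=.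
apply: eq_bigr => w _; apply: eq_bigr => u _.
by rewrite addrC mulrC.
Qed.

Lemma comp_val b (s : gr_pre) : b%:E <=oo v (gr_comp b s).
Proof.
rewrite /gr_comp big_seq_cond; apply: val_sum_le => u /andP[us /eqP<-].
exact: (allP (valP s)).
Qed.

Lemma gr_eqP (s t : gr_pre) :
  reflect (forall b : V, b%:E <oo v (gr_comp b s - gr_comp b t))
          (\pi_(gr) s == \pi_(gr) t).
Proof. by rewrite eqmodE; apply: asboolP. Qed.

Lemma gr_eqW (s t : gr_pre) :
  (forall b, gr_comp b s = gr_comp b t) -> \pi_(gr) s = \pi_(gr) t.
Proof. by move=> st; apply/eqP/gr_eqP => b; rewrite st subrr val0. Qed.

Definition gr_add : gr -> gr -> gr := lift_op2 gr pre_add.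
Definition gr_opp : gr -> gr := lift_op1 gr pre_opp.
Definition gr_mul : gr -> gr -> gr := lift_op2 gr pre_mul.
Definition gr_zero : gr := lift_cst gr pre0.
Definition gr_one : gr := lift_cst gr pre1.
Canonical pi_gr_zero := PiConst gr_zero.
Canonical pi_gr_one := PiConst gr_one.

Lemma gr_repr_lt b (s : gr_pre) :
  b%:E <oo v (gr_comp b s - gr_comp b (repr (\pi_(gr) s))).
Proof. by move: b; apply/gr_eqP; rewrite reprK. Qed.

Lemma pi_gr_add : {morph \pi_(gr) : s t / pre_add s t >-> gr_add s t}.
Proof.
move=> s t; unlock gr_add; apply/eqP/gr_eqP => b.
by rewrite !comp_add opprD addrACA val_ltD // gr_repr_lt.
Qed.

Lemma pi_gr_opp : {morph \pi_(gr) : s / pre_opp s >-> gr_opp s}.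
Proof.
move=> s; unlock gr_opp; apply/eqP/gr_eqP => b.
by rewrite !comp_opp -opprD valN gr_repr_lt.
Qed.

Lemma comp_mul_lt (s s' t : gr_pre) :
  (forall b, b%:E <oo v (gr_comp b s - gr_comp b s')) ->
  forall b, b%:E <oo v (gr_comp b (pre_mul s t) - gr_comp b (pre_mul s' t)).
Proof.
move=> ss' b; rewrite !comp_mul -sumrB; apply: val_sum_lt => w wt _.
rewrite -mulrBr -[X in X%:E <oo _](subrKC w.1) val_ltM //.
exact: (allP (valP t)).
Qed.

Lemma pi_gr_mul : {morph \pi_(gr) : s t / pre_mul s t >-> gr_mul s t}.
Proof.
move=> s t; unlock gr_mul; apply/eqP/gr_eqP => b.
set s' := repr _; set t' := repr _.
rewrite -(subrKA (gr_comp b (pre_mul s' t))) val_ltD //.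
  by apply: comp_mul_lt => c; exact: gr_repr_lt.
rewrite ![gr_comp b (pre_mul s' _)]comp_mulC.
by apply: comp_mul_lt => c; exact: gr_repr_lt.
Qed.

Lemma comp1 b : gr_comp b pre1 = (b == 0)%:R.
Proof. by rewrite /gr_comp big_mkcond big_seq1 /= eq_sym; case: eqP. Qed.

Fact gr_addA : associative gr_add.
Proof.
elim/quotW=> s; elim/quotW=> t; elim/quotW=> r; rewrite -!pi_gr_add.
by apply: gr_eqW => b; rewrite !comp_add addrA.
Qed.

Fact gr_addC : commutative gr_add.
Proof.
elim/quotW=> s; elim/quotW=> t; rewrite -!pi_gr_add.
by apply: gr_eqW => b; rewrite !comp_add addrC.
Qed.

Fact gr_zeroE : gr_zero = \pi_(gr) pre0. Proof. by unlock gr_zero. Qed.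
Fact gr_oneE : gr_one = \pi_(gr) pre1. Proof. by unlock gr_one. Qed.

Fact gr_add0 : left_id gr_zero gr_add.
Proof.
elim/quotW=> s; rewrite gr_zeroE -pi_gr_add.
by apply: gr_eqW => b; rewrite comp_add comp0 add0r.
Qed.

Fact gr_addN : left_inverse gr_zero gr_opp gr_add.
Proof.
elim/quotW=> s; rewrite gr_zeroE -pi_gr_opp -pi_gr_add.
by apply: gr_eqW => b; rewrite comp_add comp_opp comp0 addNr.
Qed.

HB.instance Definition _ := GRing.isZmodule.Build gr
  gr_addA gr_addC gr_add0 gr_addN.

Fact gr_mulA : associative gr_mul.
Proof.
elim/quotW=> s; elim/quotW=> t; elim/quotW=> r; rewrite -!pi_gr_mul.
apply: gr_eqW => b; rewrite [RHS]comp_mul.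
under [RHS]eq_bigr do rewrite comp_mul mulr_sumr.
rewrite comp_mul big_allpairs_dep exchange_big /=.
apply: eq_bigr => x _; apply: eq_bigr => y _.
by rewrite -mulrA mulrCA -[b - x.1 - _]addrA -opprD [x.1 + _]addrC.
Qed.

Fact gr_mulC : commutative gr_mul.
Proof.
elim/quotW=> s; elim/quotW=> t; rewrite -!pi_gr_mul.
by apply: gr_eqW => b; exact: comp_mulC.
Qed.

Fact gr_mul1 : left_id gr_one gr_mul.
Proof.
elim/quotW=> s; rewrite gr_oneE -pi_gr_mul; apply: gr_eqW => b.
rewrite comp_mulC comp_mul big_seq1 /= subr0 mul1r //.
Qed.

Fact gr_mulDl : left_distributive gr_mul gr_add.
Proof.
elim/quotW=> s; elim/quotW=> t; elim/quotW=> r.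
rewrite -!(pi_gr_mul, pi_gr_add); apply: gr_eqW => b.
rewrite comp_add !comp_mul -big_split /=; apply: eq_bigr => w _.
by rewrite comp_add mulrDr.
Qed.

Fact gr_oner_neq0 : gr_one != gr_zero.
Proof.
rewrite gr_oneE gr_zeroE; apply/gr_eqP => /(_ 0).
by rewrite comp1 comp0 eqxx subr0 val1 ext_ltE ltxx.
Qed.

HB.instance Definition _ := GRing.Zmodule_isComNzRing.Build gr
  gr_mulA gr_mulC gr_mul1 gr_mulDl gr_oner_neq0.

Lemma comp_mul_deg b (s t : gr_pre) :
  gr_comp b (pre_mul s t) =
  \sum_(c <- undup [seq w.1 | w <- t]) gr_comp c t * gr_comp (b - c) s.
Proof.
rewrite comp_mul.
transitivity (\sum_(w <- t) \sum_(c <- undup [seq w.1 | w <- t] | c == w.1)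
   w.2 * gr_comp (b - w.1) s).
  rewrite [LHS]big_seq [RHS]big_seq; apply: eq_bigr => w wt.
  have wd : w.1 \in undup [seq w.1 | w <- t].
    by rewrite mem_undup; apply/mapP; exists w.
  rewrite (big_rem _ wd) /= eqxx big_seq_cond big_pred0 ?addr0 // => c.
  by rewrite mem_rem_uniq ?undup_uniq // !inE; case: eqP; rewrite ?andbF.
rewrite (exchange_big_dep predT) //=; apply: eq_bigr => c _.
rewrite mulr_suml; apply: eq_big => [w|w /eqP <-] //.
Qed.

Lemma comp_notin b (s : gr_pre) : b \notin [seq u.1 | u <- s] -> gr_comp b s = 0.
Proof.
move=> bs; rewrite /gr_comp big_seq_cond big_pred0 // => u; apply/negP => /andP[us].
by move/eqP => eb; case/negP: bs; rewrite -eb; apply/mapP; exists u.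
Qed.

Lemma seq_has_min (P : pred V) (r : seq V) : has P r ->
  exists2 b, P b & forall c, c \in r -> P c -> b <= c.
Proof.
elim: r => //= a r IH; have [/IH[b Pb bmin] _|nr] := boolP (has P r).
  have [Pa|nPa] := boolP (P a).
    have [ab|ba] := leP a b.
      exists a => // c; rewrite inE => /predU1P[->//|cr Pc].
      exact: le_trans ab (bmin c cr Pc).
    exists b => // c; rewrite inE => /predU1P[->|cr Pc]; first by rewrite ltW.
    exact: bmin.
  exists b => // c; rewrite inE => /predU1P[->|cr Pc]; first by rewrite (negPf nPa).
  exact: bmin.
rewrite orbF => Pa; exists a => // c; rewrite inE => /predU1P[->//|cr Pc].
by case/hasP: nr; exists c.
Qed.

Lemma comp_min (s : gr_pre) : \pi_(gr) s != 0 ->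
  exists2 b, v (gr_comp b s) = b%:E & forall c, c < b -> c%:E <oo v (gr_comp c s).
Proof.
move=> s0; pose P c := ~~ (c%:E <oo v (gr_comp c s)).
have PE c : P c -> c \in [seq u.1 | u <- s].
  by apply: contraR => /comp_notin cs; rewrite cs val0.
have [|b Pb bmin] := @seq_has_min P [seq u.1 | u <- s].
  apply: contraR s0 => /hasPn nP.
  have -> : 0 = \pi_(gr) pre0 by rewrite -gr_zeroE.
  apply/gr_eqP => b; rewrite comp0 subr0.
  have [bs|bs] := boolP (b \in [seq u.1 | u <- s]).
    by have := nP b bs; rewrite /P negbK.
  by rewrite comp_notin // val0.
exists b => [|c cb].
  have := comp_val b s; move: Pb; rewrite /P ext_ltE.
  case: (v _) => [h||] //=; rewrite -leNgt => hb bh.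
  by congr (_%:E); apply/le_anti; rewrite hb bh.
have [Pc|] := boolP (P c); last by rewrite /P negbK.
by have := bmin c (PE c Pc) Pc; rewrite leNgt cb.
Qed.

Lemma gr_mulf_eq0 (x y : gr) : x * y = 0 -> (x == 0) || (y == 0).
Proof.
elim/quotW: x => s; elim/quotW: y => t xy.
rewrite -[_ || _]negbK negb_or; apply/negP => /andP[/comp_min[b vb bmin]].
move=> /comp_min[a va amin].
move/eqP: xy; have -> : 0 = \pi_(gr) pre0 by rewrite -gr_zeroE.
rewrite -[_ * _]pi_gr_mul => /gr_eqP/(_ (b + a)).
rewrite comp0 subr0 comp_mul_deg.
have ain : a \in undup [seq w.1 | w <- t].
  rewrite mem_undup; apply: contraT => /comp_notin a0.
  by move: va; rewrite a0 val0.
rewrite (big_rem a) //= addrK => lt_ab.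
set z := \sum_(c <- _) _ in lt_ab.
have vz : (b + a)%:E <oo v z.
  apply: val_sum_lt => c; rewrite mem_rem_uniq ?undup_uniq // !inE => /andP[ca _] _.
  have eqs : b + a = c + (b + a - c) by rewrite subrKC.
  have [lca|lac|/eqP] := ltgtP c a; last by rewrite (negPf ca).
    rewrite [X in X%:E <oo _]eqs [X in X%:E <oo _]addrC mulrC val_ltM ?comp_val //; exact: amin.
  rewrite [X in X%:E <oo _]eqs val_ltM ?comp_val //.
  apply: bmin; rewrite -[X in _ < X]addr0 -[b + a - c]addrA.
  by apply: ltr_translate; rewrite -(subrr c) addrC [c - c]addrC; exact: ltr_translate.
have := val_ltD lt_ab (_ : (b + a)%:E <oo v (- z)); rewrite valN addrK => /(_ vz).
by rewrite valM va vb ext_ltE /= addrC ltxx.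
Qed.

Fact gr_mulVr :
  {in [pred x : gr | `[< exists y, y * x = 1 >]], left_inverse 1
    (fun x : gr => if pselect (exists y, y * x = 1) is left e
                   then projT1 (cid e) else x) *%R}.
Proof.
move=> x /asboolP xu; case: pselect => // e.
by case: (cid e).
Qed.

Fact gr_unitP (x y : gr) : y * x = 1 -> [pred x : gr | `[< exists y, y * x = 1 >]] x.
Proof. by move=> yx; apply/asboolP; exists y. Qed.

Fact gr_invr_out : {in [predC [pred x : gr | `[< exists y, y * x = 1 >]]],
  (fun x : gr => if pselect (exists y, y * x = 1) is left e
                   then projT1 (cid e) else x) =1 id}.
Proof.
move=> x; rewrite inE /= => /asboolPn nx; case: pselect => //.
Qed.

HB.instance Definition _ := GRing.ComNzRing_hasMulInverse.Build gr
  gr_mulVr gr_unitP gr_invr_out.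

HB.instance Definition _ := GRing.ComUnitRing_isIntegral.Build gr gr_mulf_eq0.

End GradedAlgebra.

Section InitialForms.
Context (F : fieldType) (V : orderedQModType) (v : valuation F V).

(* The class of y in P_b / P_b+. *)
Definition gr_class (b : V) (y : F) (le_b_y : b%:E <=oo v y) : gr v :=
  \pi_(gr v) (GrPre (wf1 le_b_y)).

Definition homogeneous : set (gr v) :=
  [set z | exists b y (le_b_y : b%:E <=oo v y), z = gr_class le_b_y].

Fact val_fine_le (y : F) : (fine (v y))%:E <=oo v y.
Proof.
have [->|/(val_fin v)[g ->]] := eqVneq y 0; first by rewrite val0.
exact: ext_lexx.
Qed.

Definition initial (y : F) : gr v := gr_class (val_fine_le y).

Lemma initial0 : initial 0 = 0.
Proof.
have -> : 0 = \pi_(gr v) (pre0 v) by rewrite -gr_zeroE.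
by apply: gr_eqW => b; rewrite comp0 /gr_comp big_mkcond big_seq1 /= if_same.
Qed.

Lemma initial_eq0 y : (initial y == 0) = (y == 0).
Proof.
apply/idP/eqP => [|->]; last by rewrite initial0.
have -> : 0 = \pi_(gr v) (pre0 v) by rewrite -gr_zeroE.
move/gr_eqP/(_ (fine (v y))); rewrite comp0 subr0 /gr_comp big_mkcond big_seq1 /= eqxx.
have [//|/(val_fin v)[g ->]] := eqVneq y 0.
by rewrite ext_ltE ltxx.
Qed.

Lemma initialM x y : initial (x * y) = initial x * initial y.
Proof.
have [->|x0] := eqVneq x 0; first by rewrite mul0r initial0 mul0r.
have [->|y0] := eqVneq y 0; first by rewrite mulr0 initial0 mulr0.
rewrite -[RHS]pi_gr_mul; apply: gr_eqW => b.
have [g vx] := val_fin v x0; have [h vy] := val_fin v y0.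
by rewrite /gr_comp /= /seq_mul /= valM vx vy.
Qed.

End InitialForms.

Section GradedRestriction.
Context (E F : fieldType) (V : orderedQModType) (f : {rmorphism E -> F}).
Context (v : valuation F V).

Fact gr_restr_wf (s : gr_pre (val_restr f v)) : gr_wf v [seq (u.1, f u.2) | u <- s].
Proof. by rewrite /gr_wf all_map; exact: (valP s). Qed.

Definition gr_incl (z : gr (val_restr f v)) : gr v :=
  \pi_(gr v) (GrPre (gr_restr_wf (repr z))).

Lemma gr_incl_initial c :
  gr_incl (initial (val_restr f v) c) = initial v (f c).
Proof.
apply/eqP/gr_eqP => b; set s := GrPre (wf1 (val_fine_le (val_restr f v) c)).
have fE (t : gr_pre (val_restr f v)) :
    gr_comp b (GrPre (gr_restr_wf t)) = f (gr_comp b t).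
  by rewrite /gr_comp big_map rmorph_sum.
have -> : gr_comp b (GrPre (wf1 (val_fine_le v (f c)))) = f (gr_comp b s).
  by rewrite -fE.
by rewrite fE -rmorphB -opprB rmorphN valN; exact: (gr_repr_lt b s).
Qed.

End GradedRestriction.

Section Fractions.
Context (F : fieldType) (V : orderedQModType) (v : valuation F V).

Inductive generated (S : set (gr v)) : set (gr v) :=
  | gen_in z of S z : generated S z
  | gen_one : generated S 1
  | gen_sub z w of generated S z & generated S w : generated S (z - w)
  | gen_mul z w of generated S z & generated S w : generated S (z * w).

(* G^* for a graded subring G, inside the field of fractions of gr v. *)
Definition gr_star (G : set (gr v)) : set {fraction gr v} :=
  [set z | exists g h, [/\ G g, G h, h != 0, homogeneous h & z = g%:F / h%:F]].

Definition minimal_relation (A : set {fraction gr v}) (y : {fraction gr v})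
    (P : {poly {fraction gr v}}) : Prop :=
  [/\ P \is monic, forall k, A P`_k, P.[y] = 0 &
      forall R : {poly {fraction gr v}},
        R != 0 -> (forall k, A R`_k) -> R.[y] = 0 -> (size P <= size R)%N].

End Fractions.

Section Rank.
Context (V : orderedQModType).

Definition subgroup (H : set V) := H 0 /\ forall g h, H g -> H h -> H (g - h).

Definition convex_subgroup (G H : set V) :=
  [/\ (H `<=` G)%classic, subgroup H
    & forall g h, G g -> H h -> 0 <= g -> g <= h -> H g].

Definition rank_one (G : set V) :=
  G <> [set 0]%classic /\
  forall H, convex_subgroup G H -> H = [set 0]%classic \/ H = G.

(* G (x) Q as a subset of V. *)
Definition divisible_hull (G : set V) : set V :=
  [set g | exists n, (0 < n)%N /\ G (g *+ n)].

End Rank.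

(* With k_v = P_0 / P_0+, a prime is zero in k_v when its valuation is positive. *)
Definition residue_char_exponent (F : fieldType) (V : orderedQModType)
    (v : valuation F V) (p : nat) : Prop :=
  (prime p /\ 0%:E <oo v p%:R) \/
  (p = 1%N /\ forall q, prime q -> ~ (0%:E <oo v q%:R)).

Definition nu_p (p a : nat) : \bar nat :=
  if a == 0%N then +oo%E else if (1 < p)%N then (logn p a)%:E else 1%N%:E.

Section WellOrder.
Context {d : Order.disp_t} (L : bOrderType d).
Implicit Types (S : set L) (i j k : L).

Definition is_max i := forall k, (k <= i)%O.

Definition is_succ i j := (i < j)%O /\ forall k, (i < k)%O -> (j <= k)%O.

(* is_plus i t k : k = i + t *)
Inductive is_plus i : nat -> L -> Prop :=
  | is_plus0 : is_plus i 0 i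
  | is_plusS t k k' of is_plus i t k & is_succ k k' : is_plus i t.+1 k'.

Definition is_plus_omega i j :=
  (forall t k, is_plus i t k -> (k < j)%O) /\
  (forall j', (forall t k, is_plus i t k -> (k < j')%O) -> (j <= j')%O).

Context (alpha : L -> nat).

Definition inessential S i :=
  (exists2 j, S j & is_plus_omega i j) /\
  forall t k, is_plus i t k -> alpha k = 1%N.

(* is_next S i j : j = i+, computed in the initial segment S of L *)
Definition is_next S i j :=
  S j /\ (inessential S i /\ is_plus_omega i j \/ ~ inessential S i /\ is_succ i j).

End WellOrder.

Definition const_frac (K : fieldType) : {rmorphism K -> {fraction {poly K}}} :=
  @tofrac {poly K} \o polyC.

Definition restr_const (K : fieldType) (V : orderedQModType)
    (nu : valuation {fraction {poly K}} V) : valuation K V :=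
  val_restr (const_frac K) nu.

Section KeyPolynomials.
Context (K : fieldType) (V : orderedQModType).
Context (nu : valuation {fraction {poly K}} V).
Context {d : Order.disp_t} (L : bOrderType d).
Context (alpha : L -> nat) (Q : L -> {poly K}).
Implicit Types (f : {poly K}) (i l : L).

Local Notation nuK := (restr_const nu).
Local Notation upto l := [set q : L | (q <= l)%O]%classic.
Local Notation "\minoo_ ( i 'in' A ) F" :=
  (\big[ext_min/+oo%E]_(i <- A) F) (at level 36, F at level 36).

Definition beta i : \bar V := nu (Q i)%:F.

Definition pre_key : Prop :=
  [/\ forall i, (0 < alpha i)%N, alpha \bot%O = 1%N, Q \bot%O = 'X,
      forall i, Q i \is monic &
      forall i i0, ~ is_max i -> i != \bot%O -> (i0 < i)%O ->
        is_next alpha setT i0 i -> (size (Q i)).-1 = (alpha i * (size (Q i0)).-1)%N].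

Definition exponent := {fsfun L -> nat with 0%N}.

Definition monomial (m : exponent) : {poly K} := \prod_(q <- finsupp m) Q q ^+ m q.

Definition standard l (m : exponent) : Prop :=
  [/\ forall q, m q != 0%N -> (q <= l)%O,
      forall q r, (q < l)%O -> is_next alpha (upto l) q r -> (m q < alpha r)%N &
      forall i r, inessential alpha (upto l) i -> is_next alpha (upto l) i r ->
        forall j j', is_next alpha (upto l) j r -> is_next alpha (upto l) j' r ->
          m j != 0%N -> m j' != 0%N -> j = j'].

(* A finite sum of monomials c_m Q^m with distinct exponents m; the terms that
   appear are those with c_m != 0. *)
Definition expansion := {fsfun exponent -> K with 0}.

Definition expand (e : expansion) : {poly K} :=
  \sum_(m <- finsupp e) e m *: monomial m.

Definition free_standard l (e : expansion) : Prop :=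
  (forall m, m \in finsupp e -> standard l m /\ m l = 0%N) /\
  nu (expand e)%:F = \minoo_(m in finsupp e) nu (e m *: monomial m)%:F.

Definition standard_expansion l (s : nat) (c : nat -> {poly K}) f : Prop :=
  (forall j, (j <= s)%N -> exists2 e, free_standard l e & c j = expand e) /\
  f = \sum_(j < s.+1) c j * Q l ^+ j.

Definition min_value l (s : nat) (c : nat -> {poly K}) : \bar V :=
  \minoo_(j in iota 0 s.+1) nu (c j * Q l ^+ j)%:F.

Definition key_a : Prop :=
  forall i, ~ is_max i ->
    exists2 g, divisible_hull (value_group nuK) g & beta i = g%:E.

(* G_nuK[in Q_q, q < k], inside G_nu *)
Definition gr_below (k : L) : set (gr nu) :=
  generated (range (@gr_incl _ _ _ (const_frac K) nu) `|`
             [set initial nu (Q q)%:F | q in [set q | (q < k)%O]])%classic.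

Definition key_b : Prop :=
  forall k i, is_succ k i -> exists e : nat -> expansion,
  [/\ forall j, (j < alpha i)%N -> free_standard k (e j),
      Q i = Q k ^+ alpha i + \sum_(j < alpha i) expand (e j) * Q k ^+ j,
      forall j m, (j < alpha i)%N -> m \in finsupp (e j) ->
        nu (e j m *: monomial m * Q k ^+ j)%:F = nu (Q k ^+ alpha i)%:F &
      minimal_relation (gr_star (gr_below k)) (initial nu (Q k)%:F)%:F
        ('X^(alpha i) + \sum_(j < alpha i)
           (\sum_(m <- finsupp (e j))
              gr_incl (initial nuK (e j m)) * initial nu (monomial m)%:F)%:F
           *: 'X^j)].

Definition limit_increasing i f : Prop :=
  forall i0, is_next alpha setT i0 i ->
    (exists s c, standard_expansion i0 s c f) /\
    forall s c, standard_expansion i0 s c f -> min_value i0 s c <oo nu f%:F.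

Definition key_c : Prop :=
  forall i, i != \bot%O -> (forall k, ~ is_succ k i) ->
  [/\ exists i0, is_next alpha setT i0 i,
      forall i0, is_next alpha setT i0 i ->
        (exists c, standard_expansion i0 (alpha i) c (Q i)) /\
        forall c, standard_expansion i0 (alpha i) c (Q i) ->
          min_value i0 (alpha i) c <oo beta i,
      forall f, limit_increasing i f -> (size (Q i) <= size f)%N &
      (exists2 g, divisible_hull (value_group nuK) g &
         forall i', (i' < i)%O -> beta i' <=oo g%:E) \/ ~ is_max i ->
      forall i0 c, is_next alpha setT i0 i ->
        standard_expansion i0 (alpha i) c (Q i) ->
        [/\ c (alpha i) = 1, min_value i0 (alpha i) c = beta i0 *+ alpha i
          & nu (c 0%N)%:F = beta i0 *+ alpha i]].

Definition key_d : Prop :=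
  forall n, infinite_set [set i | (size (Q i)).-1 = n]%classic ->
  forall f, f \is monic -> (size f).-1 = n ->
    exists2 i, (size (Q i)).-1 = n & nu f%:F <=oo beta i.

Definition key_polynomials : Prop := [/\ pre_key, key_a, key_b, key_c & key_d].

Definition digit i f (j : nat) : {poly K} := (f %/ Q i ^+ j) %% Q i.

Lemma digit_expansion i f : Q i \is monic -> (1 < size (Q i))%N ->
  f = \sum_(j < size f) digit i f j * Q i ^+ j /\
  forall j, (size (digit i f j) < size (Q i))%N.
Proof.
move=> Qm Qs; split=> [|j]; last by rewrite ltn_modp monic_neq0.
have expand_n n :
    f = \sum_(j < n) digit i f j * Q i ^+ j + f %/ Q i ^+ n * Q i ^+ n.
  elim: n => [|n IH]; first by rewrite big_ord0 add0r expr0 divp1 mulr1.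
  rewrite {1}IH big_ord_recr /= -addrA; congr (_ + _).
  rewrite {1}(divp_eq (f %/ Q i ^+ n) (Q i)) mulrDl addrC; congr (_ + _).
  by rewrite divp_divl -exprSr -mulrA -exprS.
rewrite {1}(expand_n (size f)) divp_small ?mul0r ?addr0 //.
rewrite -[X in (_ < X)%N]prednK; last by rewrite size_poly_gt0 expf_neq0 ?monic_neq0.
rewrite size_exp ltnS leq_pmull //.
by case: (size (Q i)) Qs => // -[].
Qed.

Definition nu_trunc i f : \bar V :=
  \minoo_(j in iota 0 (size f)) (nu (digit i f j)%:F + beta i *+ j).

Definition is_complete : Prop :=
  forall f, f != 0 -> exists i, nu_trunc i f = nu f%:F.

(* -oo when the b-th Hasse derivative of Q i is zero. *)
Definition slope i (b : nat) : \bar V :=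
  er_map (fun g : V => (b%:R^-1 : rat) *: g) (beta i - nu (Q i)^`N(b)%:F)%E.

Definition is_b i (b : nat) : Prop :=
  [/\ (0 < b)%N, forall b', (0 < b')%N -> slope i b' <=oo slope i b &
      forall b', (0 < b')%N -> slope i b' = slope i b -> (b <= b')%N].

End KeyPolynomials.

Definition lex_le {d d'} {T : porderType d} {T' : porderType d'}
    (x y : \bar T * \bar T' * nat) : Prop :=
  x.1.1 <oo y.1.1 \/
  x.1.1 = y.1.1 /\ (x.1.2 <oo y.1.2 \/ x.1.2 = y.1.2 /\ (x.2 <= y.2)%N).

(* Main.v *)
(* For a monic Q such that nu ((f g) %/ Q * Q) > nu (f g) whenever deg f, deg g <
   deg Q, the truncation nu_Q is a valuation. A transfinite induction shows that
   every Q_l has this property and that, for k < l, nu_k <= nu_l, nu_k(Q_l) <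
   nu(Q_l) and each f of degree < deg Q_l satisfies nu_q(f) = nu(f) for some
   q < l: at a successor this is the minimality of the algebraic relation (b), at
   a limit the minimality of the degree in (c).

   Let eps_l be the maximal slope of Q_l. The Taylor expansion f(X + Y) is
   multiplicative in f, so giving Y the weight - eps_l turns (1) into a statement
   on generators: powers of Q_l, and f with deg f < deg Q_l, whose slopes are even
   strictly smaller than eps_l. For the latter choose q < l with nu_q(f) = nu(f);
   then eps_q < eps_l, because (2) for Q_q applied to Q_l gives a slope eps_q
   computed with nu_q(Q_l) < nu(Q_l). For (2), write k = p^e m with p prime to m;
   up to terms of higher value Q(X + Y)^(p^e) = Q^(p^e) + Y^(b p^e) S^(p^e) with
   S(0) = d_b Q, so the coefficient of Y^(b p^e) in Q(X + Y)^k is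
   m Q^(k - p^e) (d_b Q)^(p^e), and those for smaller powers of Y vanish. *)
From HB Require Import structures.
Require Import Defs.
From mathcomp Require Import all_boot all_order all_algebra.
From mathcomp Require Import finmap.
From mathcomp Require Import boolp classical_sets cardinality constructive_ereal.
From mathcomp Require Import zify ring.

Set Implicit Arguments.
Unset Strict Implicit.
Unset Printing Implicit Defensive.

Import Order.TTheory GRing.Theory.
Local Open Scope ring_scope.

(** * Ordered modules and extended values *)

(** Conditions (b) and (c) speak of standard expansions, the truncations of expansions in powers of
    Q_l with digits of degree < deg Q_l. Linking the two shapes the induction: for non-maximal l it
    also proves that every f with deg f < deg Q_l is a Q_l-free standard expansion. This puts the
    initial forms of digits into the ring over which the relation in (b) is minimal, and it supplies
    the expansions that [limit_increasing] asks for. At a maximal limit index nothing ties deg Q_l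
    to alpha l, so coefficients of a standard expansion may have degree deg Q_l or more. What
    survives is that each Q_q with q < l agrees, up to terms of larger nu_l, with a polynomial of
    degree < deg Q_l, and that this passes to products. A standard expansion can therefore be traded
    for a sum with small digits of the same values, which suffices for nu_l(h) to be the minimum of
    the terms and for (2). *)

Section OrderedModule.
Context (V : orderedQModType).
Implicit Types (g h x y z : V) (a b c : \bar V).

Lemma ler_translate2 g h x y : g <= x -> h <= y -> g + h <= x + y.
Proof.
move=> gx hy; apply: le_trans (ler_translate g h y hy) _.
by rewrite addrC [x + y]addrC ler_translate.
Qed.

Lemma ltr_le_translate g h x y : g < x -> h <= y -> g + h < x + y.
Proof.
move=> gx hy; apply: le_lt_trans (ler_translate g h y hy) _.
by rewrite addrC [x + y]addrC ltr_translate.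
Qed.

Lemma ler_translateE z x y : (z + x <= z + y) = (x <= y).
Proof.
apply/idP/idP => [le_xy|]; last exact: ler_translate.
by have := ler_translate (- z) _ _ le_xy; rewrite !addKr.
Qed.

Lemma ltr_translateE z x y : (z + x < z + y) = (x < y).
Proof. by rewrite !lt_neqAle ler_translateE (inj_eq (addrI z)). Qed.

Lemma ler_subl_translate x y z : (x - y <= z) = (x <= z + y).
Proof. by rewrite -(ler_translateE y (x - y)) subrKC addrC. Qed.

Lemma ltr_subl_translate x y z : (x - y < z) = (x < z + y).
Proof. by rewrite -(ltr_translateE y (x - y)) subrKC addrC. Qed.

Lemma ler_oppE x y : (- x <= - y) = (y <= x).
Proof. by rewrite -(ler_translateE (x + y) (- x)) addrK addrAC subrr add0r. Qed.

Lemma ltr_oppE x y : (- x < - y) = (y < x).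
Proof. by rewrite -(ltr_translateE (x + y) (- x)) addrK addrAC subrr add0r. Qed.

Lemma ler_mulrn x y n : x <= y -> x *+ n <= y *+ n.
Proof.
by move=> xy; elim: n => [|n IH]; rewrite ?mulr0n // !mulrS ler_translate2.
Qed.

Lemma ltr_mulrn x y n : (0 < n)%N -> x < y -> x *+ n < y *+ n.
Proof.
by case: n => // n _ xy; rewrite !mulrS ltr_le_translate // ler_mulrn // ltW.
Qed.

Lemma ltr_mulrnE x y n : (0 < n)%N -> (x *+ n < y *+ n) = (x < y).
Proof.
move=> n0; apply/idP/idP; last exact: ltr_mulrn.
by apply: contraTT; rewrite -!leNgt; exact: ler_mulrn.
Qed.

Lemma ext_le_total a b : (a <=oo b) || (b <=oo a).
Proof. by case: a b => [x||] [y||] //=; exact: le_total. Qed.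

Lemma ext_ltNge a b : (a <oo b) = ~~ (b <=oo a).
Proof.
case: a b => [x||] [y||] //=; rewrite /ext_lt /= ?eqxx //.
rewrite -ltNge lt_neqAle; congr (~~ _ && _).
Qed.

Lemma ext_leNgt a b : (a <=oo b) = ~~ (b <oo a).
Proof. by rewrite ext_ltNge negbK. Qed.

Lemma ext_le_anti a b : a <=oo b -> b <=oo a -> a = b.
Proof.
case: a b => [x||] [y||] //= xy yx.
by congr (_%:E); apply/le_anti; rewrite xy yx.
Qed.

Lemma ext_lt_le a b : a <oo b -> a <=oo b.
Proof. by case/andP. Qed.

Lemma ext_le_lt_trans a b c : a <=oo b -> b <oo c -> a <oo c.
Proof.
rewrite !ext_ltNge => ab; apply: contra => ca; exact: ext_le_trans ca ab.
Qed.

Lemma ext_lt_le_trans a b c : a <oo b -> b <=oo c -> a <oo c.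
Proof.
rewrite !ext_ltNge => ab bc; apply: contra ab => ca; exact: ext_le_trans bc ca.
Qed.

Lemma ext_ltxx a : ~~ (a <oo a).
Proof. by rewrite /ext_lt eqxx. Qed.

Lemma ext_le_minE a b c : (a <=oo ext_min b c) = (a <=oo b) && (a <=oo c).
Proof.
rewrite /ext_min; case: ifPn => [bc|nbc].
  by apply/idP/andP => [ab|[]//]; split=> //; exact: ext_le_trans ab bc.
have cb : c <=oo b by case/orP: (ext_le_total b c) nbc => [->|].
by apply/idP/andP => [ac|[]//]; split=> //; exact: ext_le_trans ac cb.
Qed.

Lemma ext_lt_minE a b c : (a <oo ext_min b c) = (a <oo b) && (a <oo c).
Proof.
rewrite /ext_min; case: ifPn => [bc|nbc].
  by apply/idP/andP => [ab|[]//]; split=> //; exact: ext_lt_le_trans ab bc.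
have cb : c <=oo b by case/orP: (ext_le_total b c) nbc => [->|].
by apply/idP/andP => [ac|[]//]; split=> //; exact: ext_lt_le_trans ac cb.
Qed.

Lemma ext_le_bigmin (I : eqType) (r : seq I) (F : I -> \bar V) a :
  (a <=oo \big[ext_min/+oo%E]_(i <- r) F i) <-> (forall i, i \in r -> a <=oo F i).
Proof.
elim: r => [|j r IH]; first by rewrite big_nil; split=> // _; case: a.
rewrite big_cons ext_le_minE; split=> [/andP[aj /IH ar] i|ar].
  by rewrite inE => /predU1P[->|/ar].
by rewrite ar ?mem_head //=; apply/IH => i ir; rewrite ar // inE ir orbT.
Qed.

Lemma ext_lt_bigmin (I : eqType) (r : seq I) (F : I -> \bar V) g :
  (g%:E <oo \big[ext_min/+oo%E]_(i <- r) F i) <->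
  (forall i, i \in r -> g%:E <oo F i).
Proof.
elim: r => [|j r IH]; first by rewrite big_nil; split.
rewrite big_cons ext_lt_minE; split=> [/andP[aj /IH ar] i|ar].
  by rewrite inE => /predU1P[->|/ar].
by rewrite ar ?mem_head //=; apply/IH => i ir; rewrite ar // inE ir orbT.
Qed.

Lemma ext_bigmin_mem (I : eqType) (r : seq I) (F : I -> \bar V) :
  \big[ext_min/+oo%E]_(i <- r) F i = +oo%E \/
  exists2 i, i \in r & \big[ext_min/+oo%E]_(i <- r) F i = F i.
Proof.
elim: r => [|j r IH]; first by rewrite big_nil; left.
rewrite big_cons; set m := bigop.body _ _ _ in IH *.
have [->|->] : ext_min (F j) m = F j \/ ext_min (F j) m = m.
    by rewrite /ext_min; case: ifP; [left|right].
  by right; exists j; rewrite ?mem_head.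
by case: IH => [->|[i ir ->]]; [left|right; exists i => //; rewrite inE ir orbT].
Qed.

End OrderedModule.

(** * Valuations on domains *)

Section RingValuation.
Context (R : idomainType) (V : orderedQModType).

(* The truncations of nu are valuations on K[x] only. *)
Record rval := RVal {
  rval_fun :> R -> \bar V;
  rval0 : rval_fun 0 = +oo%E;
  rval_fin : forall x, x != 0 -> exists g : V, rval_fun x = g%:E;
  rvalM : forall x y, rval_fun (x * y) = (rval_fun x + rval_fun y)%E;
  rvalD : forall x y, ext_min (rval_fun x) (rval_fun y) <=oo rval_fun (x + y)
}.

Variable v : rval.
Implicit Types (x y : R) (g h : V).

Lemma rval_eqy x : v x = +oo%E -> x = 0.
Proof.
by move=> vx; apply/eqP; apply: contraT => /(rval_fin v)[g]; rewrite vx.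
Qed.

Lemma rvalM_fin g h x y : v x = g%:E -> v y = h%:E -> v (x * y) = (g + h)%:E.
Proof. by move=> vx vy; rewrite rvalM vx vy. Qed.

Lemma rval1 : v 1 = 0%:E.
Proof.
have [g vg] := rval_fin v (oner_neq0 R).
have := rvalM v 1 1; rewrite mulr1 vg => -[] /eqP.
by rewrite -[X in X == _]addr0 (inj_eq (addrI _)) eq_sym => /eqP->.
Qed.

Lemma rvalN x : v (- x) = v x.
Proof.
suff v1 : v (-1)%R = 0%:E.
  by rewrite -mulN1r rvalM v1; case: (v x) => [h||] //; rewrite /adde /= add0r.
have [g vg] : exists g, v (-1)%R = g%:E by apply: rval_fin; rewrite oppr_eq0 oner_neq0.
have := rvalM v (-1)%R (-1); rewrite mulrNN mulr1 rval1 vg => -[] g2.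
congr (_%:E); apply/eqP; case: ltgtP => // g0.
  by have := ltr_le_translate g0 (ltW g0); rewrite -g2 addr0 ltxx.
by have := ltr_le_translate g0 (ltW g0); rewrite -g2 addr0 ltxx.
Qed.

Lemma rval_leD g x y : g%:E <=oo v x -> g%:E <=oo v y -> g%:E <=oo v (x + y).
Proof.
by move=> gx gy; apply: ext_le_trans (rvalD v x y); rewrite ext_le_minE gx.
Qed.

Lemma rval_ltD g x y : g%:E <oo v x -> g%:E <oo v y -> g%:E <oo v (x + y).
Proof.
by move=> gx gy; apply: ext_lt_le_trans (rvalD v x y); rewrite ext_lt_minE gx.
Qed.

Lemma rval_leB g x y : g%:E <=oo v x -> g%:E <=oo v y -> g%:E <=oo v (x - y).
Proof. by move=> gx gy; rewrite rval_leD // rvalN. Qed.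

Lemma rval_ltB g x y : g%:E <oo v x -> g%:E <oo v y -> g%:E <oo v (x - y).
Proof. by move=> gx gy; rewrite rval_ltD // rvalN. Qed.

Lemma rval_le_sum (I : Type) (r : seq I) (P : pred I) (F : I -> R) g :
  (forall i, P i -> g%:E <=oo v (F i)) -> g%:E <=oo v (\sum_(i <- r | P i) F i).
Proof.
move=> le_F; elim/big_ind: _ => //; first by rewrite rval0.
by move=> x y; exact: rval_leD.
Qed.

Lemma rval_lt_sum (I : Type) (r : seq I) (P : pred I) (F : I -> R) g :
  (forall i, P i -> g%:E <oo v (F i)) -> g%:E <oo v (\sum_(i <- r | P i) F i).
Proof.
move=> le_F; elim/big_ind: _ => //; first by rewrite rval0.
by move=> x y; exact: rval_ltD.
Qed.

Lemma rval_leM g h x y :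
  g%:E <=oo v x -> h%:E <=oo v y -> (g + h)%:E <=oo v (x * y).
Proof.
by rewrite rvalM; case: (v x) (v y) => [a||] [b||] //=; exact: ler_translate2.
Qed.

Lemma rval_ltM g h x y :
  g%:E <oo v x -> h%:E <=oo v y -> (g + h)%:E <oo v (x * y).
Proof.
rewrite rvalM !ext_ltE.
by case: (v x) (v y) => [a||] [b||] //=; exact: ltr_le_translate.
Qed.

Lemma rval_leX g x n : g%:E <=oo v x -> (g *+ n)%:E <=oo v (x ^+ n).
Proof.
move=> gx; elim: n => [|n IH]; first by rewrite expr0 rval1 mulr0n ext_lexx.
by rewrite exprS mulrS rval_leM.
Qed.

Lemma rvalX g x n : v x = g%:E -> v (x ^+ n) = (g *+ n)%:E.
Proof.
move=> gx; elim: n => [|n IH]; first by rewrite expr0 rval1.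
by rewrite exprS mulrS (rvalM_fin gx IH).
Qed.

Lemma rval_natr n : 0%:E <=oo v n%:R.
Proof.
elim: n => [|n IH]; first by rewrite rval0.
by rewrite -natr1 rval_leD // rval1 ext_lexx.
Qed.

Lemma rval_bigmin_le (I : Type) (r : seq I) (F : I -> R) :
  \big[ext_min/+oo%E]_(i <- r) v (F i) <=oo v (\sum_(i <- r) F i).
Proof.
elim: r => [|i r IH]; first by rewrite !big_nil rval0.
rewrite !big_cons; apply: ext_le_trans (rvalD v _ _); rewrite ext_le_minE.
have := ext_lexx (ext_min (v (F i)) (\big[ext_min/+oo%E]_(j <- r) v (F j))).
by rewrite ext_le_minE => /andP[-> /ext_le_trans]; apply.
Qed.

Lemma rval_ltDr g x y : v x = g%:E -> g%:E <oo v y -> v (x + y) = g%:E.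
Proof.
move=> vx gy; have le_g : g%:E <=oo v (x + y).
  by rewrite rval_leD ?vx ?ext_lexx // ext_lt_le.
apply: ext_le_anti => //; rewrite ext_leNgt; apply: contra (ext_ltxx g%:E) => lt_g.
by rewrite -{2}vx -(addrK y x) rval_ltB.
Qed.

End RingValuation.

(** * Truncations *)

Section Truncation.
Context (K : fieldType) (V : orderedQModType) (v : rval {poly K} V).
Variable q : {poly K}.
Implicit Types (f g d e : {poly K}) (x y : V) (i j k n : nat).

(** Convertible to [digit], as [trunc] below is to [nu_trunc]; the index set is left out because
    only q matters here. *)
Definition dig f j : {poly K} := (f %/ q ^+ j) %% q.

Definition trunc f : \bar V :=
  \big[ext_min/+oo%E]_(j <- iota 0 (size f)) (v (dig f j) + v q *+ j).

(* For polynomials f, g of degree less than deg q and f * g = a q + r, the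
   term r carries the value of f * g. This is what makes trunc multiplicative. *)
Definition is_key : Prop :=
  forall f g, (size f < size q)%N -> (size g < size q)%N -> f != 0 -> g != 0 ->
    v (f * g) <oo v ((f * g) %/ q * q).

Hypotheses (q_monic : q \is monic) (q_gt1 : (1 < size q)%N).

Let q_neq0 : q != 0. Proof. exact: monic_neq0. Qed.

Lemma modp_subE f : f %% q = f - f %/ q * q.
Proof. by rewrite {2}(divp_eq f q) addrC addKr. Qed.

Lemma size_dig f j : (size (dig f j) < size q)%N.
Proof. by rewrite /dig ltn_modp. Qed.

Lemma dig_0 f : dig f 0 = f %% q.
Proof. by rewrite /dig divp1. Qed.

Lemma digS f j : dig f j.+1 = dig (f %/ q) j.
Proof. by rewrite /dig exprS divp_divl. Qed.

Lemma dig0 j : dig 0 j = 0.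
Proof. by rewrite /dig div0p mod0p. Qed.

Lemma digD f g j : dig (f + g) j = dig f j + dig g j.
Proof. by rewrite /dig divpD modpD. Qed.

Lemma digN f j : dig (- f) j = - dig f j.
Proof. by rewrite /dig divpN modpN. Qed.

Lemma dig_sum (I : Type) (r : seq I) (P : pred I) (F : I -> {poly K}) j :
  dig (\sum_(i <- r | P i) F i) j = \sum_(i <- r | P i) dig (F i) j.
Proof. by elim/big_rec2: _ => [|i x y _ <-]; rewrite ?dig0 ?digD. Qed.

Lemma digMX f n j : dig (f * q ^+ n) j = if (j < n)%N then 0 else dig f (j - n).
Proof.
elim: n j => [|n IH] j; first by rewrite mulr1 subn0.
case: j => [|j]; rewrite exprSr mulrA; first by rewrite /dig divp1 modp_mull.
by rewrite digS mulpK // IH.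
Qed.

Lemma dig_small d j : (size d < size q)%N -> dig d j = if j == 0 then d else 0.
Proof.
case: j => [|j] sd; first by rewrite /dig divp1 modp_small.
by rewrite digS divp_small // dig0.
Qed.

Lemma dig_term d n j : (size d < size q)%N ->
  dig (d * q ^+ n) j = if j == n then d else 0.
Proof.
move=> sd; rewrite digMX dig_small // subn_eq0.
by case: ltngtP.
Qed.

Lemma size_dig_ge f j : (size f <= j)%N -> dig f j = 0.
Proof.
move=> fj; rewrite /dig divp_small ?mod0p //.
apply: leq_ltn_trans fj _; rewrite -[X in (_ < X)%N]prednK ?ltnS; last first.
  by rewrite size_poly_gt0 expf_neq0.
by rewrite size_exp leq_pmull //; case: (size q) q_gt1 => // -[].
Qed.

Lemma dig_expansion f : f = \sum_(j < size f) dig f j * q ^+ j.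
Proof. by have [] := digit_expansion (Q := fun _ : nat => q) (i := 0%N) f q_monic q_gt1. Qed.

Lemma dig_expansion_lt f n : (size f < size (q ^+ n))%N ->
  f = \sum_(j < n) dig f j * q ^+ j.
Proof.
move=> fn; suff {1}-> : f = \sum_(j < n) dig f j * q ^+ j + f %/ q ^+ n * q ^+ n.
  by rewrite divp_small // mul0r addr0.
elim: n {fn} => [|n IH]; first by rewrite big_ord0 add0r divp1 mulr1.
rewrite {1}IH big_ord_recr /= -addrA; congr (_ + _).
by rewrite {1}(divp_eq (f %/ q ^+ n) q) mulrDl addrC divp_divl -exprSr -mulrA -exprS.
Qed.

Context (b : V).
Hypothesis vq : v q = b%:E.

Let addbn (a : \bar V) n : (a + v q *+ n = a + (b *+ n)%:E)%R.
Proof.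
congr (_ + _); rewrite vq; elim: n => [|n IH] //; rewrite !mulrS IH //.
Qed.

Let le_shift x (a : \bar V) n :
  (x%:E <=oo (a + v q *+ n)%R) = ((x - b *+ n)%:E <=oo a).
Proof.
by rewrite addbn; case: a => [y||] //=; rewrite ler_subl_translate.
Qed.

Let lt_shift x (a : \bar V) n :
  (x%:E <oo (a + v q *+ n)%R) = ((x - b *+ n)%:E <oo a).
Proof.
by rewrite addbn !ext_ltE; case: a => [y||] //=; rewrite ltr_subl_translate.
Qed.

(** Digits beyond the size of f vanish and have infinite value, so j need not be bounded. Comparing
    with finite x only avoids a case analysis on infinite minima. *)
Lemma trunc_ge x f :
  x%:E <=oo trunc f <-> forall j, (x - b *+ j)%:E <=oo v (dig f j).
Proof.
rewrite ext_le_bigmin; split=> H j; last by rewrite le_shift.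
have [fj|jf] := leqP (size f) j; first by rewrite size_dig_ge // rval0.
by rewrite -le_shift; apply: H; rewrite mem_iota.
Qed.

Lemma trunc_gt x f :
  x%:E <oo trunc f <-> forall j, (x - b *+ j)%:E <oo v (dig f j).
Proof.
rewrite ext_lt_bigmin; split=> H j; last by rewrite lt_shift.
have [fj|jf] := leqP (size f) j; first by rewrite size_dig_ge // rval0.
by rewrite -lt_shift; apply: H; rewrite mem_iota.
Qed.

Lemma trunc0 : trunc 0 = +oo%E.
Proof. by rewrite /trunc size_poly0 big_nil. Qed.

Lemma trunc_fin f : f != 0 -> exists x, trunc f = x%:E.
Proof.
move=> f0; case: (ext_bigmin_mem (iota 0 (size f)) (fun j => v (dig f j) + v q *+ j)).
  move=> fy; case/eqP: f0; rewrite (dig_expansion f) big1 // => j _.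
  have : +oo%E <=oo trunc f by rewrite /trunc fy.
  move/ext_le_bigmin/(_ (val j)); rewrite mem_iota /= ltn_ord addbn => /(_ isT).
  have [->|/(rval_fin v)[y ->]//] := eqVneq (dig f j) 0; by rewrite mul0r.
case=> j _; rewrite -/(trunc f) addbn => tf.
have [d0|/(rval_fin v)[y vd]] := eqVneq (dig f j) 0.
  move: tf; rewrite d0 rval0 => fy; case/eqP: f0.
  rewrite (dig_expansion f) big1 // => i _.
  have : +oo%E <=oo trunc f by rewrite fy.
  move/ext_le_bigmin/(_ (val i)); rewrite mem_iota /= ltn_ord addbn => /(_ isT).
  have [->|/(rval_fin v)[y ->]//] := eqVneq (dig f i) 0; by rewrite mul0r.
by rewrite tf vd; eexists.
Qed.

Lemma trunc_geD x f g : x%:E <=oo trunc f -> x%:E <=oo trunc g -> x%:E <=oo trunc (f + g).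
Proof.
by move=> /trunc_ge xf /trunc_ge xg; apply/trunc_ge => j; rewrite digD rval_leD.
Qed.

Lemma trunc_gtD x f g : x%:E <oo trunc f -> x%:E <oo trunc g -> x%:E <oo trunc (f + g).
Proof.
by move=> /trunc_gt xf /trunc_gt xg; apply/trunc_gt => j; rewrite digD rval_ltD.
Qed.

Lemma truncN f : trunc (- f) = trunc f.
Proof. by rewrite /trunc size_polyN; apply: eq_bigr => j _; rewrite digN rvalN. Qed.

Lemma trunc_le f : trunc f <=oo v f.
Proof.
have [->|/trunc_fin[x fx]] := eqVneq f 0; first by rewrite rval0; case: (trunc 0).
have /trunc_ge xf : x%:E <=oo trunc f by rewrite fx ext_lexx.
rewrite fx (dig_expansion f); apply: rval_le_sum => j _.
rewrite -[x](subrK (b *+ j)) rval_leM ?rval_leX ?vq ?ext_lexx //; exact: xf.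
Qed.

Lemma trunc_term x d n : (size d < size q)%N ->
  (x%:E <=oo trunc (d * q ^+ n)) = (x%:E <=oo v (d * q ^+ n)).
Proof.
move=> sd; rewrite rvalM (rvalX n vq).
apply/idP/idP => [/trunc_ge/(_ n)|xd].
  rewrite dig_term // eqxx; case: (v d) => [y||] //=; by rewrite ler_subl_translate.
apply/trunc_ge => j; rewrite dig_term //; case: eqP => [->|_]; last by rewrite rval0.
by move: xd; case: (v d) => [y||] //=; rewrite ler_subl_translate.
Qed.

Lemma trunc_termE d n : (size d < size q)%N -> trunc (d * q ^+ n) = v (d * q ^+ n).
Proof.
move=> sd; apply: ext_le_anti; first exact: trunc_le.
have [->|d0] := eqVneq d 0; first by rewrite mul0r trunc0; case: (v 0).
have /(rval_fin v)[x dx] : d * q ^+ n != 0 by rewrite mulf_neq0 ?expf_neq0.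
by rewrite dx trunc_term // dx ext_lexx.
Qed.

Lemma trunc_small d : (size d < size q)%N -> trunc d = v d.
Proof. by move=> sd; have := trunc_termE 0 sd; rewrite mulr1. Qed.

Lemma trunc_q : trunc q = v q.
Proof. by have := @trunc_termE 1 1; rewrite size_poly1 mul1r expr1; exact. Qed.

Lemma trunc_ge_sum (I : Type) (r : seq I) (P : pred I) (F : I -> {poly K}) x :
  (forall i : I, P i -> x%:E <=oo trunc (F i)) ->
  x%:E <=oo trunc (\sum_(i <- r | P i) F i).
Proof.
move=> le_F; elim/big_ind: _ => //; first by rewrite trunc0.
by move=> f g; exact: trunc_geD.
Qed.

Hypothesis q_key : is_key.

(** Write d e = a q + r. By [is_key] both a q and r have value at least that of d e, and deg a < deg
    q, so the product splits into two terms of its expansion, at the powers m + n + 1 and m + n. *)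
Let trunc_ge_termM x y d e m n : (size d < size q)%N -> (size e < size q)%N ->
  x%:E <=oo v (d * q ^+ m) -> y%:E <=oo v (e * q ^+ n) ->
  (x + y)%:E <=oo trunc ((d * q ^+ m) * (e * q ^+ n)).
Proof.
move=> sd se dx ey; rewrite mulrACA -exprD.
have [->|d0] := eqVneq d 0; first by rewrite !mul0r trunc0.
have [->|e0] := eqVneq e 0; first by rewrite mulr0 !mul0r trunc0.
have lt_de := q_key sd se d0 e0.
have /(rval_fin v)[z vz] : d * e != 0 by rewrite mulf_neq0.
rewrite vz in lt_de.
have xyz : x + y <= z + b *+ (m + n).
  have := rval_leM dx ey; rewrite mulrACA -exprD.
  by rewrite (rvalM_fin vz (rvalX (m + n) vq)).
have vmod : z%:E <=oo v ((d * e) %% q).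
  by rewrite modp_subE rval_leB ?vz ?ext_lexx // ext_lt_le.
have size_quo : (size ((d * e) %/ q)%R < size q)%N.
  rewrite size_divp // size_mul //.
  by move: (size d) (size e) (size q) sd se q_gt1 => sd se sq *; lia.
have zx : x + y - b *+ (m + n) <= z by rewrite ler_subl_translate.
rewrite {1}(divp_eq (d * e) q) mulrDl -mulrA -exprS; apply: trunc_geD.
  rewrite trunc_term // exprS mulrA -[x + y](subrK (b *+ (m + n))).
  rewrite rval_leM ?rval_leX ?vq ?ext_lexx //.
  by apply: ext_le_trans (ext_lt_le lt_de); exact: zx.
rewrite trunc_term ?ltn_modp // -[x + y](subrK (b *+ (m + n))).
by rewrite rval_leM ?rval_leX ?vq ?ext_lexx // (ext_le_trans _ vmod).
Qed.

Lemma trunc_geM x y f g :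
  x%:E <=oo trunc f -> y%:E <=oo trunc g -> (x + y)%:E <=oo trunc (f * g).
Proof.
have termP z h j : z%:E <=oo trunc h -> z%:E <=oo v (dig h j * q ^+ j).
  move=> /trunc_ge zh; rewrite -[z](subrK (b *+ j)) rval_leM ?rval_leX ?vq ?ext_lexx //.
move=> xf yg; rewrite {1}(dig_expansion f) {1}(dig_expansion g) mulr_suml.
apply: trunc_ge_sum => i _; rewrite mulr_sumr; apply: trunc_ge_sum => j _.
by apply: trunc_ge_termM; rewrite ?size_dig ?termP.
Qed.

Lemma trunc_gtM x y f g :
  x%:E <oo trunc f -> y%:E <=oo trunc g -> (x + y)%:E <oo trunc (f * g).
Proof.
have [->|/trunc_fin[z fz]] := eqVneq f 0; first by rewrite mul0r trunc0.
rewrite fz => xz yg; have zyfg : (z + y)%:E <=oo trunc (f * g).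
  by rewrite trunc_geM ?fz ?ext_lexx.
apply: ext_lt_le_trans zyfg; rewrite ext_ltE; rewrite ext_ltE in xz.
exact: ltr_le_translate.
Qed.

(* Splitting off the digits below the first one that computes trunc f. *)
Lemma trunc_leading x f : trunc f = x%:E ->
  exists n F, [/\ v (dig F 0) = (x - b *+ n)%:E, x%:E <oo trunc (f - F * q ^+ n)
                & x%:E <=oo trunc (F * q ^+ n)].
Proof.
move=> fx; pose P n := ~~ ((x - b *+ n)%:E <oo v (dig f n)).
have /trunc_ge xf : x%:E <=oo trunc f by rewrite fx ext_lexx.
have exP : exists n, P n.
  apply: contrapT => nP; have : x%:E <oo trunc f.
    by apply/trunc_gt => j; apply: contrapT => /negP nj; apply: nP; exists j.
  by rewrite fx; apply/negP; exact: ext_ltxx.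
case: (ex_minnP exP) => n Pn n_min; exists n, (f %/ q ^+ n).
have dig_lt : x%:E <oo trunc (f - f %/ q ^+ n * q ^+ n).
  apply/trunc_gt => j; rewrite digD digN digMX.
  case: ltnP => [jn|nj].
    by rewrite subr0; apply: contraTT jn => Pj; rewrite -leqNgt n_min.
  by rewrite {2}/dig divp_divl -exprD subnKC // subrr rval0.
split=> //; first last.
  rewrite -[X in _ <=oo trunc X](subKr f); apply: trunc_geD; first by rewrite fx ext_lexx.
  by rewrite truncN ext_lt_le.
have -> : dig (f %/ q ^+ n) 0 = dig f n by rewrite /dig divp1.
by apply: ext_le_anti; rewrite // ext_leNgt.
Qed.

Lemma truncM f g : trunc (f * g) = (trunc f + trunc g)%E.
Proof.
have [->|f0] := eqVneq f 0.
  rewrite mul0r trunc0; have [->|/trunc_fin[y ->]//] := eqVneq g 0; by rewrite trunc0.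
have [->|g0] := eqVneq g 0.
  by rewrite mulr0 trunc0; have [x ->] := trunc_fin f0.
have [x fx] := trunc_fin f0; have [y gy] := trunc_fin g0.
have xyfg : (x + y)%:E <=oo trunc (f * g) by rewrite trunc_geM ?fx ?gy ?ext_lexx.
rewrite fx gy; apply: ext_le_anti => //; rewrite ext_leNgt; apply/negP => lt_fg.
have [m [F [F0 fF xF]]] := trunc_leading fx.
have [n [G [G0 gG yG]]] := trunc_leading gy.
(* If [f * g] had too large a truncation, so would [F * G * q ^+ (m + n)], which differs from it by
   terms above x + y. But its digit of index m + n is the remainder of the product of the two
   leading digits, and [q_key] gives this remainder the value of that product. *)
have : (x + y)%:E <oo trunc (F * G * q ^+ (m + n)).
  have -> : F * G * q ^+ (m + n) =
      f * g - (f - F * q ^+ m) * g - (g - G * q ^+ n) * (F * q ^+ m).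
    rewrite exprD; ring.
  apply: trunc_gtD; first apply: trunc_gtD => //.
    by rewrite truncN trunc_gtM // gy ext_lexx.
  by rewrite truncN [x + y]addrC trunc_gtM.
move/trunc_gt/(_ (m + n)%N); rewrite digMX ltnn subnn.
have F00 : dig F 0 != 0 by apply/eqP => F00; rewrite F00 rval0 in F0.
have G00 : dig G 0 != 0 by apply/eqP => G00; rewrite G00 rval0 in G0.
have lt_FG := q_key (size_dig F 0) (size_dig G 0) F00 G00.
have vFG := rvalM_fin F0 G0; rewrite vFG in lt_FG.
have -> : dig (F * G) 0 = dig F 0 * dig G 0 - (dig F 0 * dig G 0) %/ q * q.
  by rewrite -modp_subE !dig_0 modp_mul [X in _ = X %% _]mulrC modp_mul [G * F]mulrC.
rewrite (rval_ltDr vFG) ?rvalN //.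
have -> : x + y - b *+ (m + n) = x - b *+ m + (y - b *+ n).
  by rewrite mulrnDr opprD addrACA.
by apply/negP; exact: ext_ltxx.
Qed.

Lemma truncD f g : ext_min (trunc f) (trunc g) <=oo trunc (f + g).
Proof.
have [->|/trunc_fin[x fx]] := eqVneq f 0.
  by rewrite add0r trunc0 /ext_min; case: ifP; rewrite ?ext_lexx // => H; case: (trunc g) H.
have [->|/trunc_fin[y gy]] := eqVneq g 0.
  rewrite addr0 trunc0 /ext_min; case: ifP; rewrite ?ext_lexx //.
  by move/negbT; rewrite fx.
rewrite fx gy /ext_min; case: ifPn => [xy|yx].
  by apply: trunc_geD; rewrite ?fx ?gy ?ext_lexx.
have {}yx : y <= x by move: yx; rewrite -ltNge => /ltW.
by apply: trunc_geD; rewrite ?fx ?gy ?ext_lexx.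
Qed.

Definition trunc_val : rval {poly K} V :=
  RVal trunc0 trunc_fin truncM truncD.

End Truncation.

(** * Passing from a valuation w <= v with w q < v q to the truncation at q *)

Section Comparison.
Context (K : fieldType) (V : orderedQModType) (v w : rval {poly K} V).
Variable q : {poly K}.
Hypotheses (q_monic : q \is monic) (q_gt1 : (1 < size q)%N).
Hypotheses (w_le : forall f, w f <=oo v f) (wq_lt : w q <oo v q).
Implicit Types (f g : {poly K}) (x y : V).

(** If v (a q) <= v (f g) for the quotient a, then w (a q) < v (a q) <= w (f g). So w of the
    remainder equals w (a q), while v of the remainder is at least v (a q): the two cannot agree. *)
Lemma key_step f g : f != 0 -> g != 0 -> w f = v f -> w g = v g ->
  w ((f * g) %/ q) = v ((f * g) %/ q) -> w ((f * g) %% q) = v ((f * g) %% q) ->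
  v (f * g) <oo v ((f * g) %/ q * q).
Proof.
move=> f0 g0 wf wg; set a := _ %/ q => wa wr.
have wfg : w (f * g) = v (f * g) by rewrite !rvalM wf wg.
have [x vfg] : exists x, v (f * g) = x%:E by apply: rval_fin; rewrite mulf_neq0.
have [b vq] : exists b, v q = b%:E by apply: rval_fin; exact: monic_neq0.
have [c wq] : exists c, w q = c%:E by apply: rval_fin; exact: monic_neq0.
have [->|a0] := eqVneq a 0; first by rewrite mul0r rval0 vfg.
have [y va] := rval_fin v a0.
have cb : c < b by move: wq_lt; rewrite wq vq ext_ltE.
have ycb : y + c < y + b by rewrite ltr_translateE.
rewrite ext_ltNge (rvalM_fin va vq) vfg /=; apply/negP => le_x.
have w_mod : w ((f * g) %% q) = (y + c)%:E.
  rewrite modp_subE addrC; apply: rval_ltDr.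
    by rewrite rvalN (rvalM_fin (etrans wa va) wq).
  by rewrite wfg vfg ext_ltE; exact: lt_le_trans ycb le_x.
have : (y + c)%:E <oo v ((f * g) %% q).
  rewrite modp_subE rval_ltB // ?vfg ?(rvalM_fin va vq) ext_ltE //.
  exact: lt_le_trans ycb le_x.
by rewrite -wr w_mod; apply/negP; exact: ext_ltxx.
Qed.

(** Taking a remainder does not lower w. Otherwise the remainder of some g and the multiple of q
    share a w-value z0 < w g; since w q < v q, the multiple of q has v-value above z0, as has g,
    hence the remainder too, against w = v on digits. Thus each division costs w at most w q < v q,
    and the bound passes from quotient to quotient. *)
Lemma mono_step f : (forall j, w (dig q f j) = v (dig q f j)) ->
  w f <=oo trunc v q f.
Proof.
have [b vq] : exists b, v q = b%:E by apply: rval_fin; exact: monic_neq0.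
have [c wq] : exists c, w q = c%:E by apply: rval_fin; exact: monic_neq0.
have [->|/(rval_fin w)[x wf]] := eqVneq f 0; first by rewrite trunc0; case: (w 0).
have cb : c < b by move: wq_lt; rewrite wq vq ext_ltE.
have mod_ge g y : w (g %% q) = v (g %% q) -> y%:E <=oo w g -> y%:E <=oo w (g %% q).
  move=> w_mod yg; rewrite ext_leNgt; apply/negP => lt_y.
  have [z0 wz0] : exists z0, w (g %% q) = z0%:E.
    apply: rval_fin; apply: contraTneq lt_y => ->; rewrite rval0 ext_ltNge.
    by case: (y%:E).
  have vz0 : v (g %% q) = z0%:E by rewrite -w_mod.
  have zy : z0 < y by move: lt_y; rewrite wz0 ext_ltE.
  have wfq : w (g %/ q * q) = z0%:E.
    have -> : g %/ q * q = - (g %% q) + g by rewrite modp_subE opprB subrK.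
    by apply: rval_ltDr; [rewrite rvalN|apply: ext_lt_le_trans yg; rewrite ext_ltE].
  have y_lt : z0%:E <oo v (g %/ q * q).
    rewrite -wfq !rvalM; have [q0|/(rval_fin v)[z vz]] := eqVneq (g %/ q) 0.
      by move: wfq; rewrite q0 mul0r rval0.
    have [z' wz'] : exists z', w (g %/ q) = z'%:E.
      by apply: rval_fin; apply: contra_eq_neq vz => ->; rewrite rval0.
    have z'z : z' <= z by have := w_le (g %/ q); rewrite wz' vz.
    rewrite vz vq wq wz' ext_ltE /=.
    by rewrite addrC [z + b]addrC ltr_le_translate.
  have : z0%:E <oo v (g %% q).
    rewrite modp_subE rval_ltB //; apply: ext_lt_le_trans (w_le g).
    by apply: ext_lt_le_trans yg; rewrite ext_ltE.
  by rewrite vz0; apply/negP; exact: ext_ltxx.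
rewrite wf => w_dig; apply/(trunc_ge q_monic q_gt1 vq) => j.
have {wf} : x%:E <=oo w f by rewrite wf ext_lexx.
elim: j f x w_dig => [|j IH] f x w_dig xf.
  by rewrite mulr0n subr0 -w_dig dig_0 // mod_ge // -dig_0.
rewrite digS // mulrS opprD addrA; apply: IH => [i|]; first by rewrite -digS.
have : x%:E <=oo w (f %/ q * q).
  have -> : f %/ q * q = - (f %% q) + f by rewrite modp_subE opprB subrK.
  by rewrite rval_leD // rvalN mod_ge // -dig_0.
rewrite rvalM wq; case: (w _) => [y||] //=; rewrite ler_subl_translate => xyc.
apply: le_trans xyc _; rewrite ler_translateE; exact: ltW.
Qed.

End Comparison.

(** * Polynomials congruent to one of small degree modulo larger values *)

Section Dominated.
Context (K : fieldType) (V : orderedQModType) (v : rval {poly K} V).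
Context (q : {poly K}) (b : V).
Hypotheses (q_monic : q \is monic) (q_gt1 : (1 < size q)%N).
Hypotheses (vq : v q = b%:E) (q_key : is_key v q).
Implicit Types (f g : {poly K}) (x y : V).

Let w := trunc_val q_monic q_gt1 vq q_key.

(* The component of degree x of f in the graded ring of trunc q has degree 0 in
   the initial form of q. *)
Definition dominated x f : Prop :=
  exists2 r : {poly K}, (size r < size q)%N /\ x%:E <=oo v r & x%:E <oo trunc v q (f - r).

Lemma dominated_small x f : (size f < size q)%N -> x%:E <=oo v f -> dominated x f.
Proof. by move=> sf xf; exists f => //; rewrite subrr trunc0. Qed.

Lemma dominatedD x f g : dominated x f -> dominated x g -> dominated x (f + g).
Proof.
move=> [r [sr xr] fr] [s [ss xs] gs]; exists (r + s).
  by split; [rewrite (leq_ltn_trans (size_polyD _ _)) // gtn_max sr|exact: rval_leD].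
by rewrite opprD addrACA (rval_ltD (v := w)).
Qed.

Lemma dominated_sum (I : eqType) (r : seq I) (F : I -> {poly K}) x :
  (forall i, i \in r -> dominated x (F i)) -> dominated x (\sum_(i <- r) F i).
Proof.
elim: r => [|i r IH] Fx; last first.
  rewrite big_cons; apply: dominatedD; first exact/Fx/mem_head.
  by apply: IH => j jr; apply: Fx; rewrite inE jr orbT.
by rewrite big_nil; apply: dominated_small; rewrite ?size_poly0 ?rval0 // ltnW.
Qed.

Lemma dominated_ge x f : dominated x f -> x%:E <=oo w f.
Proof.
move=> [r [sr xr] fr]; rewrite -[f](subrK r) rval_leD ?(ext_lt_le fr) //.
by rewrite /= (trunc_small q_monic q_gt1 vq).
Qed.

(** The representative of the product is [(r * s) %% q]: the discarded multiple of q has value above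
    that of [r * s] by [is_key], and its cofactor has degree < deg q, so [trunc] computes that
    value. *)
Lemma dominatedM x y f g : dominated x f -> dominated y g -> dominated (x + y) (f * g).
Proof.
move=> fx gy; have wfx := dominated_ge fx.
case: fx gy => [r [sr xr] fr] [s [ss ys] gs].
have : dominated (x + y) (r * s).
  have [->|r0] := eqVneq r 0.
    by rewrite mul0r; apply: dominated_small; rewrite ?size_poly0 ?rval0 // ltnW.
  have [->|s0] := eqVneq s 0.
    by rewrite mulr0; apply: dominated_small; rewrite ?size_poly0 ?rval0 // ltnW.
  have lt_rs := q_key sr ss r0 s0.
  have [z vz] : exists z, v (r * s) = z%:E by apply: rval_fin; rewrite mulf_neq0.
  have xyz : x + y <= z by have := rval_leM xr ys; rewrite vz.
  rewrite vz in lt_rs; exists ((r * s) %% q).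
    rewrite ltn_modp monic_neq0 //; split=> //.
    apply: (@ext_le_trans _ _ z%:E) => //.
    by rewrite modp_subE rval_leB ?vz ?ext_lexx // ext_lt_le.
  rewrite modp_subE opprB subrKC; apply: ext_le_lt_trans (_ : z%:E <oo _) => //.
  have size_quo : (size ((r * s) %/ q)%R < size q)%N.
    rewrite size_divp ?monic_neq0 // size_mul //.
    by move: (size r) (size s) (size q) sr ss q_gt1 => sr ss sq *; lia.
  by rewrite -[q in _ * q]expr1 (trunc_termE q_monic q_gt1 vq).
case=> t [st xyt] rst; exists t => //.
have -> : f * g - t = f * (g - s) + (f - r) * s + (r * s - t) by ring.
apply: (rval_ltD (v := w)) => //; apply: (rval_ltD (v := w)).
  by rewrite mulrC addrC (rval_ltM (v := w)).
by rewrite (rval_ltM (v := w)) //= (trunc_small q_monic q_gt1 vq).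
Qed.

(** The leading terms cancel in [f - q], and q itself has value b > x, so it is negligible in degree
    x. *)
Lemma dominated_same_size f x : f \is monic -> size f = size q -> v f = x%:E ->
  x < b -> dominated x f.
Proof.
move=> fm sf vf xb; exists (f - q); last first.
  by rewrite subKr (trunc_q q_monic q_gt1 vq) vq ext_ltE.
split; last by rewrite rval_leB ?vf ?vq ?ext_lexx //= ltW.
have := size_polyD f (- q); rewrite size_polyN sf maxnn leq_eqVlt => /predU1P[] // s_fq.
have : lead_coef (f - q) = 0.
  by rewrite lead_coefE s_fq coefB -{1}sf -!lead_coefE (eqP fm) (eqP q_monic) subrr.
move/eqP; rewrite lead_coef_eq0 => /eqP ->; rewrite size_poly0; exact: ltnW.
Qed.

(* The coefficients of standard expansions need not have degree less than deg q
   (alpha can be too large at the last index); this is what is left of it. *)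
Definition nearly_small f : Prop := forall x, v f = x%:E -> dominated x f.

Lemma nearly_small_rem f : nearly_small f -> exists r : {poly K},
  [/\ (size r < size q)%N, v r = v f &
      forall x, x%:E <=oo v f -> f != 0 -> x%:E <oo trunc v q (f - r)].
Proof.
have [->|f0] := eqVneq f 0.
  by move=> _; exists 0; rewrite size_poly0 ltnW.
have [x vf] := rval_fin v f0 => /(_ x vf)[r [sr xr] fr]; exists r; split=> //.
  have -> : r = f - (f - r) by rewrite subKr.
  rewrite vf; apply: rval_ltDr => //; rewrite rvalN.
  exact: ext_lt_le_trans fr (trunc_le q_monic q_gt1 vq _).
by move=> y; rewrite vf => yx _; exact: ext_le_lt_trans yx fr.
Qed.

(** The truncation sees only digits of small degree. Each coefficient is exchanged for its
    representative, and the error stays above every common lower bound of the values of the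
    terms. *)
Lemma nearly_small_expansion (s : nat) (c : nat -> {poly K}) f :
    f = \sum_(j < s) c j * q ^+ j -> (forall j, (j < s)%N -> nearly_small (c j)) ->
  exists r : nat -> {poly K}, [/\ forall j, (size (r j) < size q)%N,
     forall j, (j < s)%N -> v (r j) = v (c j) &
     forall x, (forall j, (j < s)%N -> x%:E <=oo v (c j * q ^+ j)) ->
       x%:E <oo trunc v q (f - \sum_(j < s) r j * q ^+ j)].
Proof.
move=> fE cP; have /choice[r rP] : forall j, exists r : {poly K}, (size r < size q)%N /\
   ((j < s)%N -> v r = v (c j) /\
    forall x, x%:E <=oo v (c j) -> c j != 0 -> x%:E <oo trunc v q (c j - r)).
  move=> j; have [js|sj] := ltnP j s; last by exists 0; rewrite size_poly0 ltnW.
  by have [r [sr vr rP]] := nearly_small_rem (cP j js); exists r.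
exists r; split=> [j|j js|x xc]; first by case: (rP j).
  by case: (rP j) => _ /(_ js)[].
rewrite {1}fE -sumrB; apply: (rval_lt_sum (v := w)) => j _.
rewrite -mulrBl; have [_ /(_ (ltn_ord j))[vr cr]] := rP j.
have [c0|c0] := eqVneq (c j) 0.
  suff -> : r j = 0 by rewrite c0 subr0 mul0r (rval0 w).
  by apply: (@rval_eqy _ _ v); rewrite vr c0 rval0.
rewrite -[x](subrK (b *+ j)); apply: (rval_ltM (v := w)) => //.
  apply: cr => //; have := xc j (ltn_ord j); rewrite rvalM (rvalX _ vq).
  by case: (v _) => [y||] //=; rewrite ler_subl_translate.
by apply: rval_leX; rewrite /= (trunc_q q_monic q_gt1 vq) vq /=.
Qed.

Lemma trunc_expansion (s : nat) (r : nat -> {poly K}) :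
  (forall j, (size (r j) < size q)%N) -> forall x,
  x%:E <oo trunc v q (\sum_(j < s) r j * q ^+ j) ->
  forall j, (j < s)%N -> x%:E <oo v (r j * q ^+ j).
Proof.
move=> sr x /(trunc_gt q_monic q_gt1 vq)/[swap] j /(_ j).
rewrite dig_sum // => /[swap] js; rewrite (bigD1 (Ordinal js)) //= big1 => [|i ij].
  rewrite addr0 dig_term // eqxx rvalM (rvalX _ vq) !ext_ltE.
  by case: (v _) => [y||] //=; rewrite ltr_subl_translate.
rewrite dig_term //; case: eqP => // ji; case/eqP: ij; exact: val_inj.
Qed.

(** The [r j] are true digits of a polynomial that differs from f only above the minimum m, and
    their terms have the same values as those of the [c j]. *)
Lemma trunc_standard (s : nat) (c : nat -> {poly K}) f :
    f = \sum_(j < s) c j * q ^+ j -> (forall j, (j < s)%N -> nearly_small (c j)) ->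
  trunc v q f = \big[ext_min/+oo%E]_(j <- iota 0 s) v (c j * q ^+ j).
Proof.
move=> fE cP; have [r [sr vr rP]] := nearly_small_expansion fE cP.
set m := \big[_/_]_(_ <- _) _.
have vrq j : (j < s)%N -> v (r j * q ^+ j) = v (c j * q ^+ j).
  by move=> js; rewrite !rvalM vr.
have m_le x : x%:E <=oo m -> x%:E <=oo trunc v q f.
  move/ext_le_bigmin => xm; have {}xm j : (j < s)%N -> x%:E <=oo v (c j * q ^+ j).
    by move=> js; apply: xm; rewrite mem_iota.
  rewrite -[f](subrK (\sum_(j < s) r j * q ^+ j)); apply: (rval_leD (v := w)).
    by apply: ext_lt_le; exact: rP.
  apply: (rval_le_sum (v := w)) => j _.
  by rewrite [w _](trunc_termE q_monic q_gt1 vq) // vrq // xm.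
have m_y : m = +oo%E -> trunc v q f = m.
  move=> mE; suff -> : f = 0 by rewrite trunc0.
  rewrite fE big1 // => j _; apply: (@rval_eqy _ _ v).
  have : +oo%E <=oo m by rewrite mE.
  move/ext_le_bigmin/(_ (val j)); rewrite mem_iota /= => /(_ (ltn_ord j)).
  by case: (v _).
have [/m_y //|[j]] := ext_bigmin_mem (iota 0 s) (fun j => v (c j * q ^+ j)).
rewrite mem_iota -/m /= add0n => js mj; have [c0|c0] := eqVneq (c j * q ^+ j) 0.
  by apply: m_y; rewrite mj c0 rval0.
have [x vx] := rval_fin v c0; apply: ext_le_anti; last first.
  by rewrite mj vx m_le // mj vx ext_lexx.
rewrite ext_leNgt mj vx; apply/negP => lt_x.
have : x%:E <oo trunc v q (\sum_(j < s) r j * q ^+ j).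
  have -> : \sum_(j < s) r j * q ^+ j = f - (f - \sum_(j < s) r j * q ^+ j).
    by rewrite subKr.
  apply: (rval_ltB (v := w)) => //; apply: rP => i is_; rewrite -vx -mj.
  have : m <=oo m by exact: ext_lexx.
  by move/ext_le_bigmin; apply; rewrite mem_iota.
move/(trunc_expansion sr)/(_ j js); rewrite vrq // vx.
by apply/negP; exact: ext_ltxx.
Qed.

End Dominated.

(** * Taylor expansions and slopes *)

Section Taylor.
Context (K : fieldType).
Implicit Types (h : {poly K}).

(** This is h(X + Y): the inner variable ['X%:P] is X and the outer ['X] is Y. *)
Definition taylor h : {poly {poly K}} := map_poly polyC h \Po ('X%:P + 'X).

HB.instance Definition _ := GRing.RMorphism.copy taylor
  (comp_poly ('X%:P + 'X) \o map_poly polyC).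

Lemma coef_taylor h b : (taylor h)`_b = h^`N(b).
Proof.
rewrite /taylor /comp_poly; set g := map_poly _ (map_poly _ h).
have /nderiv_taylor -> : GRing.comm ('X%:P : {poly {poly K}}) 'X by exact: mulrC.
have gE i : g^`N(i).['X%:P] = (h^`N(i))%:P.
  by rewrite /g !nderivn_map horner_map; congr (_%:P); exact: comp_polyXr.
under eq_bigr do rewrite gE; rewrite coef_sum.
have [bh|hb] := ltnP b (size g).
  rewrite (bigD1 (Ordinal bh)) //= big1 ?addr0 => [|i ib].
    by rewrite coefCM coefXn eqxx mulr1.
  by rewrite coefCM coefXn -[b == _]/(Ordinal bh == i) eq_sym (negPf ib) mulr0.
rewrite big1 => [|i _]; last first.
  by rewrite coefCM coefXn gtn_eqF ?mulr0 // (leq_trans _ hb).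
by rewrite nderivn_poly0 //; move: hb; rewrite /g !size_map_polyC.
Qed.

Lemma size_nderivn h b : (size h^`N(b) <= size h - b)%N.
Proof. exact: size_poly. Qed.

End Taylor.

(** * The filtration of K[X][Y] by weights *)

Section WeightedFiltration.
Context (K : fieldType) (V : orderedQModType) (w : rval {poly K} V) (eps : V).
Implicit Types (P Q : {poly {poly K}}) (x y : V).

(* Y has weight - eps, so that Taylor expansion preserves the filtration. *)
Definition wge x P := forall b, (x - eps *+ b)%:E <=oo w P`_b.
Definition wgt x P := forall b, (x - eps *+ b)%:E <oo w P`_b.

Lemma wgtW x P : wgt x P -> wge x P.
Proof. by move=> xP b; exact: ext_lt_le. Qed.

Lemma wgeD x P Q : wge x P -> wge x Q -> wge x (P + Q).
Proof. by move=> xP xQ b; rewrite coefD rval_leD. Qed.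

Lemma wgtD x P Q : wgt x P -> wgt x Q -> wgt x (P + Q).
Proof. by move=> xP xQ b; rewrite coefD rval_ltD. Qed.

Lemma wgeB x P Q : wge x P -> wge x Q -> wge x (P - Q).
Proof. by move=> xP xQ b; rewrite coefB rval_leB. Qed.

Lemma wge0 x : wge x 0.
Proof. by move=> b; rewrite coef0 rval0. Qed.

Lemma wgt0 x : wgt x 0.
Proof. by move=> b; rewrite coef0 rval0. Qed.

Let shiftD x y b (j : 'I_b.+1) :
  x + y - eps *+ b = (x - eps *+ j) + (y - eps *+ (b - j)).
Proof. by rewrite addrACA -opprD -mulrnDr subnKC // -ltnS. Qed.

Lemma wgeM x y P Q : wge x P -> wge y Q -> wge (x + y) (P * Q).
Proof.
move=> xP yQ b; rewrite coefM; apply: rval_le_sum => j _.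
by rewrite (shiftD _ _ j) rval_leM.
Qed.

Lemma wgtM x y P Q : wgt x P -> wge y Q -> wgt (x + y) (P * Q).
Proof.
move=> xP yQ b; rewrite coefM; apply: rval_lt_sum => j _.
by rewrite (shiftD _ _ j) rval_ltM.
Qed.

Lemma wgeC x f : x%:E <=oo w f -> wge x f%:P.
Proof.
move=> xf b; rewrite coefC; case: eqP => [->|_]; last by rewrite rval0.
by rewrite mulr0n subr0.
Qed.

Lemma wgtC x f : x%:E <oo w f -> wgt x f%:P.
Proof.
move=> xf b; rewrite coefC; case: eqP => [->|_]; last by rewrite rval0.
by rewrite mulr0n subr0.
Qed.

Lemma wgeX x P n : wge x P -> wge (x *+ n) (P ^+ n).
Proof.
move=> xP; elim: n => [|n IH]; last by rewrite mulrS exprS; exact: wgeM.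
by apply: wgeC; rewrite rval1 ext_lexx.
Qed.

Lemma wgt_sum (I : Type) (r : seq I) (A : pred I) (F : I -> {poly {poly K}}) x :
  (forall i, A i -> wgt x (F i)) -> wgt x (\sum_(i <- r | A i) F i).
Proof.
move=> xF; elim/big_ind: _ => //; first exact: wgt0.
by move=> P Q; exact: wgtD.
Qed.

Lemma wge_sum (I : Type) (r : seq I) (A : pred I) (F : I -> {poly {poly K}}) x :
  (forall i, A i -> wge x (F i)) -> wge x (\sum_(i <- r | A i) F i).
Proof.
move=> xF; elim/big_ind: _ => //; first exact: wge0.
by move=> P Q; exact: wgeD.
Qed.

Lemma wgt_subX x P Q n : wge x P -> wge x Q -> wgt x (P - Q) ->
  wgt (x *+ n) (P ^+ n - Q ^+ n).
Proof.
move=> xP xQ PQ; elim: n => [|n IH]; first by rewrite subrr; exact: wgt0.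
have -> : P ^+ n.+1 - Q ^+ n.+1 = (P ^+ n - Q ^+ n) * P + (P - Q) * Q ^+ n.
  by rewrite !exprS; ring.
apply: wgtD; first by rewrite mulrSr; exact: wgtM.
by rewrite mulrS; apply: wgtM => //; exact: wgeX.
Qed.

(** The inner binomial coefficients are multiples of p, which has positive value. *)
Lemma wgt_frobenius p x P Q : prime p -> 0%:E <oo w p%:R ->
  wge x P -> wge x Q -> wgt (x *+ p) ((P + Q) ^+ p - (P ^+ p + Q ^+ p)).
Proof.
move=> p_pr p_gt0 xP xQ; rewrite exprDn; have p0 := prime_gt0 p_pr.
have pE : p = p.-1.+1 by rewrite prednK.
rewrite [X in wgt (x *+ X)]pE [in X in wgt _ (X - _)]pE big_ord_recl big_ord_recr /=.
rewrite -pE /bump /= add1n -pE !subn0 subnn !expr0 mulr1 mul1r bin0 binn !mulr1n.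
set S := \sum_(i < _) _.
have -> : P ^+ p + (S + Q ^+ p) - (P ^+ p + Q ^+ p) = S by ring.
apply: wgt_sum => -[i /= ip] _; rewrite add1n.
have lt_ip : (i.+1 < p)%N by rewrite [X in (_ < X)%N]pE ltnS.
have /dvdnP[m ->] : (p %| 'C(p, i.+1))%N by rewrite prime_dvd_bin.
have -> : P ^+ (p - i.+1) * Q ^+ i.+1 *+ (m * p) =
    p%:R%:P * (m%:R%:P * (P ^+ (p - i.+1) * Q ^+ i.+1)).
  by rewrite mulrnA !polyC_natr !mulr_natl.
rewrite -[x *+ p]add0r; apply: wgtM; first exact: wgtC.
rewrite -[x *+ p]add0r; apply: wgeM; first by apply: wgeC; exact: rval_natr.
by rewrite -[X in x *+ X](subnK (ltnW lt_ip)) mulrnDr; apply: wgeM; exact: wgeX.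
Qed.

Lemma wgt_frobeniusX p n x P Q : p = 1%N \/ prime p /\ 0%:E <oo w p%:R ->
  wge x P -> wge x Q ->
  wgt (x *+ p ^ n) ((P + Q) ^+ (p ^ n) - (P ^+ (p ^ n) + Q ^+ (p ^ n))).
Proof.
case=> [->|[p_pr p_gt0]] xP xQ; first by rewrite exp1n !expr1 subrr; exact: wgt0.
elim: n => [|n IH]; first by rewrite !expr1 subrr; exact: wgt0.
rewrite expnSr !exprM mulrnA; set R := P ^+ _ + Q ^+ _ in IH *.
have xR : wge (x *+ p ^ n) R by apply: wgeD; exact: wgeX.
have xPQ : wge (x *+ p ^ n) ((P + Q) ^+ (p ^ n)) by apply: wgeX; exact: wgeD.
rewrite -(subrKA (R ^+ p)); apply: wgtD; first exact: wgt_subX.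
by apply: wgt_frobenius => //; exact: wgeX.
Qed.

End WeightedFiltration.

(** Up to X^m the binomial expansion reads a^n + n a^(n-1) C(0) X^m; terms with two factors X^m C
    start later because m > 0. *)
Lemma coef_power_XnM (R : comNzRingType) (a : R) (C : {poly R}) (m n b : nat) :
  (0 < b <= m)%N ->
  ((a%:P + 'X^m * C) ^+ n)`_b = if b == m then a ^+ n.-1 * C`_0 *+ n else 0.
Proof.
case/andP=> b0 bm; have m0 := leq_trans b0 bm.
have [E [E0 ->]] : exists E : {poly R}, E`_0 = a ^+ n.-1 * C`_0 *+ n /\
    (a%:P + 'X^m * C) ^+ n = (a ^+ n)%:P + 'X^m * E.
  elim: n => [|n [E [E0 IH]]]; first by exists 0; rewrite coef0 mulr0n expr0 mulr0 addr0.
  exists (a%:P * E + (a ^+ n)%:P * C + 'X^m * (C * E)); split; last first.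
    by rewrite exprS IH exprS polyCM; ring.
  rewrite !coefD !coefCM E0 coefXnM m0 addr0 mulrS addrC mulrnAr mulrA.
  by case: n {IH E0} => [|n]; rewrite ?mulr0n // exprS.
rewrite coefD coefC coefXnM -[b == 0]negbK -lt0n b0 add0r.
by case: ltngtP bm => // -> _; rewrite subnn.
Qed.

(** * Derivatives and slopes relative to one key polynomial *)

Section Slopes.
Context (K : fieldType) (V : orderedQModType) (v : rval {poly K} V).
Context (q : {poly K}) (b : V).
Hypotheses (q_monic : q \is monic) (q_gt1 : (1 < size q)%N).
Hypotheses (vq : v q = b%:E) (q_key : is_key v q).
Implicit Types (h d : {poly K}) (x : V).

(** [eps] is the largest slope of q and [n0] the first order that attains it. The form without
    division also covers vanishing derivatives, whose value is infinite. *)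
Definition max_slope (q : {poly K}) (b eps : V) (n0 : nat) : Prop :=
  [/\ (0 < n0)%N, v q^`N(n0) = (b - eps *+ n0)%:E,
      forall n, (0 < n)%N -> (b - eps *+ n)%:E <=oo v q^`N(n)
    & forall n, (0 < n < n0)%N -> (b - eps *+ n)%:E <oo v q^`N(n)].

Definition small_slopes (q : {poly K}) (eps : V) : Prop :=
  forall d n x, (size d < size q)%N -> (0 < n)%N -> x%:E <=oo v d ->
    (x - eps *+ n)%:E <oo v d^`N(n).

Context (eps : V) (n0 : nat).
Hypotheses (q_slope : max_slope q b eps n0) (d_slope : small_slopes q eps).

Let w := trunc_val q_monic q_gt1 vq q_key.

Let w_small d : (size d < size q)%N -> w d = v d.
Proof. exact: (trunc_small q_monic q_gt1 vq). Qed.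

Let n0_gt0 : (0 < n0)%N. Proof. by case: q_slope. Qed.

Let size_nderiv h n : (0 < n)%N -> (size h <= size q)%N -> (size h^`N(n) < size q)%N.
Proof.
move=> n0' hq; apply: leq_ltn_trans (size_nderivn h n) _.
by move: q_gt1 hq n0'; move: (size q) (size h) => sq sh; lia.
Qed.

Let taylor_q : wge w eps b (taylor q).
Proof.
move=> [|n]; rewrite coef_taylor.
  rewrite nderivn0 mulr0n subr0; rewrite [w q](trunc_q q_monic q_gt1 vq) vq.
  exact: ext_lexx.
by rewrite w_small ?size_nderiv //; case: q_slope => _ _ H _; exact: H.
Qed.

Let taylor_small d x : (size d < size q)%N -> x%:E <=oo v d ->
  wgt w eps x (taylor d - d%:P).
Proof.
move=> sd xd [|n]; rewrite coefB coef_taylor coefC.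
  by rewrite nderivn0 subrr rval0.
by rewrite (subr0 d^`N(n.+1)) w_small ?size_nderiv ?(ltnW sd) //; exact: d_slope.
Qed.

Let taylor_small_ge d x : (size d < size q)%N -> x%:E <=oo v d -> wge w eps x (taylor d).
Proof.
move=> sd xd; rewrite -[taylor d](subrK d%:P); apply: wgeD.
  exact/wgtW/taylor_small.
by apply: wgeC; rewrite w_small.
Qed.

Let taylor_term d x k : (size d < size q)%N -> x%:E <=oo v (d * q ^+ k) ->
  wge w eps x (taylor (d * q ^+ k)).
Proof.
move=> sd xd; rewrite rmorphM rmorphXn -[x](subrK (b *+ k)).
apply: wgeM; last exact: wgeX.
apply: taylor_small_ge => //; move: xd; rewrite rvalM (rvalX _ vq).
by case: (v d) => [y||] //=; rewrite ler_subl_translate.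
Qed.

Lemma trunc_nderiv_ge h x n : x%:E <=oo trunc v q h ->
  (x - eps *+ n)%:E <=oo trunc v q h^`N(n).
Proof.
move=> xh; rewrite -coef_taylor; move: n.
suff : wge w eps x (taylor h) by [].
rewrite (dig_expansion q_monic q_gt1 h) rmorph_sum; apply: wge_sum => j _.
apply: taylor_term; first exact: size_dig.
have /(trunc_ge q_monic q_gt1 vq) := xh; move/(_ (val j)).
rewrite rvalM (rvalX _ vq).
by case: (v _) => [y||] //=; rewrite ler_subl_translate.
Qed.

Lemma trunc_nderiv_gt h x n : x%:E <oo trunc v q h ->
  (x - eps *+ n)%:E <oo trunc v q h^`N(n).
Proof.
have [->|/(trunc_fin q_monic q_gt1 vq)[y hy]] := eqVneq h 0.
  have -> : (0 : {poly K})^`N(n) = 0 by rewrite nderivn_poly0 // size_poly0.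
  by rewrite (trunc0 v q).
rewrite hy ext_ltE => xy; apply: ext_lt_le_trans (_ : (y - eps *+ n)%:E <=oo _).
  by rewrite ext_ltE addrC [y - _]addrC ltr_translate.
by apply: trunc_nderiv_ge; rewrite hy ext_lexx.
Qed.

Variable p : nat.
Hypothesis p_char : p = 1%N \/ prime p /\ 0%:E <oo v p%:R.
Hypothesis p_unit : forall k, (0 < k)%N -> v (k %/ p ^ logn p k)%:R = 0%:E.

Let ppart k := (p ^ logn p k)%N.

Let w_natr k : w k%:R = v k%:R.
Proof. by rewrite w_small // -polyC_natr (leq_ltn_trans (size_polyC_leq1 _)). Qed.

(** [A] below is [taylor q] without its coefficients at Y, ..., Y^(n0-1). These lie strictly above
    the weight b, because n0 is the first order of maximal slope. *)
Let S := drop_poly n0 (taylor q).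

Let A := q%:P + 'X^n0 * S.

Let taylor_A : wgt w eps b (taylor q - A).
Proof.
move=> n; rewrite !coefB coefD coefXnM coef_drop_poly !coef_taylor coefC opprD addrA.
case: ltnP => [n_lt|n0n]; last first.
  rewrite subnK // -[n == 0]negbK -lt0n (leq_trans n0_gt0 n0n) subr0 subrr.
  by rewrite rval0.
case: eqVneq n_lt => [->|n_gt0] n_lt; first by rewrite nderivn0 !subrr rval0.
rewrite -lt0n in n_gt0; rewrite !subr0 w_small ?size_nderiv //.
by case: q_slope => _ _ _; apply; rewrite n_gt0.
Qed.

Let wge_A : wge w eps b A.
Proof. by rewrite -[A](subKr (taylor q)); apply: wgeB => //; exact: wgtW. Qed.

Let wge_q : wge w eps b q%:P.
Proof.
by apply: wgeC; rewrite [w q](trunc_q q_monic q_gt1 vq) vq ext_lexx.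
Qed.

Let wge_XS : wge w eps b ('X^n0 * S).
Proof. by rewrite -[_ * S](addKr q%:P) addrC; exact: wgeB. Qed.

Let leading_term k (d : {poly K}) : {poly K} :=
  d *+ (k %/ ppart k) * q ^+ (k - ppart k) * (q^`N(n0)) ^+ ppart k.

Let p_gt0 : (0 < p)%N.
Proof. by case: p_char => [->|[/prime_gt0]]. Qed.

Let ppartP k : (k = ppart k * (k %/ ppart k))%N.
Proof. by rewrite mulnC divnK // pfactor_dvdnn. Qed.

(** All terms of a sum are differentiated at one order n0 * N, where N is the smallest p-part that
    occurs. Hence N ranges up to the p-part of k, and a term with larger p-part contributes
    nothing. *)
Let nderiv_term N k d x : (0 < k)%N -> (size d < size q)%N ->
    v (d * q ^+ k) = x%:E -> (0 < N <= ppart k)%N ->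
  (x - eps *+ (n0 * N))%:E <oo
  w ((d * q ^+ k)^`N(n0 * N) - (if N == ppart k then leading_term k d else 0)).
Proof.
move=> k0 sd vx /andP[N0 Nk].
set M := ppart k; set k' := (k %/ M)%N; have kE : k = (M * k')%N by exact: ppartP.
pose D := (q ^+ M)%:P + 'X^(n0 * M) * S ^+ M.
have AD : wgt w eps (b *+ M) (A ^+ M - D).
  have := @wgt_frobeniusX _ _ w eps p (logn p k) b q%:P ('X^n0 * S).
  rewrite -/A -/(ppart k) -/M exprMn_comm -?exprM; last exact: mulrC.
  rewrite -polyC_exp; apply=> //; case: p_char => [|[p_pr pv]]; [by left|right].
  by split=> //; rewrite w_natr.
have wA : wge w eps (b *+ M) (A ^+ M) by exact: wgeX.
have wD : wge w eps (b *+ M) D.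
  by rewrite -[D](subKr (A ^+ M)); apply: wgeB => //; exact: wgtW.
(* Two replacements: [taylor q] by [A] in the k-th power, then [A ^+ M] by [D], using k = M * k'. *)
have qD : wgt w eps (b *+ k) (taylor q ^+ k - D ^+ k').
  rewrite -(subrKA (A ^+ k)); apply: wgtD; first exact: wgt_subX.
  by rewrite kE exprM mulrnA; apply: wgt_subX.
have [y vd] : exists y, v d = y%:E.
  by apply: rval_fin; apply: contra_eq_neq vx => ->; rewrite mul0r rval0.
have xE : x = y + b *+ k.
  by move: vx; rewrite (rvalM_fin vd (rvalX k vq)) => -[].
have : wgt w eps x (taylor (d * q ^+ k) - d%:P * D ^+ k').
  have -> : taylor (d * q ^+ k) - d%:P * D ^+ k' =
      (taylor d - d%:P) * taylor q ^+ k + (taylor q ^+ k - D ^+ k') * d%:P.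
    by rewrite rmorphM rmorphXn /=; ring.
  rewrite xE; apply: wgtD.
    apply: wgtM; last exact: wgeX.
    by apply: taylor_small; rewrite ?vd ?ext_lexx.
  by rewrite addrC; apply: wgtM => //; apply: wgeC; rewrite w_small ?vd ?ext_lexx.
move/(_ (n0 * N)%N); rewrite coefB coef_taylor coefCM coef_power_XnM; last first.
  by rewrite muln_gt0 n0_gt0 N0 leq_mul2l Nk orbT.
rewrite eqn_pmul2l //; case: eqP => [NM|_]; last by rewrite mulr0.
congr (_ <oo w (_ - _)); rewrite /leading_term -/M -/k' -horner_coef0 horner_exp.
rewrite horner_coef0 coef_drop_poly coef_taylor add0n -exprM.
have -> : (M * k'.-1 = k - M)%N by rewrite [X in (X - M)%N]kE -subn1 mulnBr muln1.
by rewrite mulrnAr mulrA mulrnAl -mulrnAl.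
Qed.

Lemma trunc_nderiv_eq (s : nat) (r : nat -> {poly K}) x k0 :
    (forall k, (size (r k) < size q)%N) ->
    (forall k, (k < s)%N -> x%:E <=oo v (r k * q ^+ k)) ->
    (0 < k0 < s)%N -> v (r k0 * q ^+ k0) = x%:E ->
    (forall k, (0 < k < s)%N -> v (r k * q ^+ k) = x%:E -> (logn p k0 <= logn p k)%N) ->
  let n := (n0 * p ^ logn p k0)%N in
  trunc v q (\sum_(k < s) r k * q ^+ k)^`N(n) = (x - eps *+ n)%:E.
Proof.
move=> sr xr /andP[k0_gt0 k0s] vk0 k0_min n; set N := ppart k0.
have N_gt0 : (0 < N)%N by rewrite expn_gt0 p_gt0.
pose lead k := (0 < k)%N && (v (r k * q ^+ k) == x%:E) && (N == ppart k).
pose t k := if lead k then leading_term k (r k) else 0.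
have term_lt k : (k < s)%N -> (x - eps *+ n)%:E <oo w ((r k * q ^+ k)^`N(n) - t k).
  (* Three kinds of terms are negligible at order n: the one of index 0 by [d_slope], those of value
     above x, and those whose p-part exceeds N. The others are compared with their leading terms. *)
  move=> ks; rewrite /t /lead; case: posnP => [->|k_gt0].
    have n_gt0 : (0 < n)%N by rewrite muln_gt0 n0_gt0.
    rewrite !andFb; rewrite subr0; rewrite expr0; rewrite mulr1.
    rewrite (w_small (size_nderiv n_gt0 (ltnW (sr 0%N)))).
    apply: d_slope n_gt0 _; first exact: sr.
    have := xr 0%N (leq_ltn_trans (leq0n _) ks).
    by rewrite expr0 mulr1.
  case: eqP => [vk|vk]; last first.
    rewrite (subr0 (r k * q ^+ k)^`N(n)); apply: trunc_nderiv_gt.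
    rewrite (trunc_termE q_monic q_gt1 vq) //.
    by rewrite /ext_lt xr // andbT; apply/eqP => vk'; case: vk.
  apply: nderiv_term => //; rewrite N_gt0 leq_pexp2l //.
  by apply: k0_min; rewrite ?k_gt0.
pose G := \sum_(k < s | lead k) r k *+ (k %/ ppart k) * q ^+ (k - ppart k).
have tE : \sum_(k < s) t k = (q^`N(n0)) ^+ N * G.
  rewrite mulr_sumr [RHS]big_mkcond; apply: eq_bigr => k _; rewrite /t.
  by case: ifP => // /andP[_ /eqP NE]; rewrite /leading_term -NE mulrC.
have size_rn k m : (size (r k *+ m) < size q)%N.
  by rewrite -scaler_nat (leq_ltn_trans (size_scale_leq _ _)).
have wG : w G = (x - b *+ N)%:E.
  apply: ext_le_anti; last first.
    apply: rval_le_sum => k /andP[/andP[k_gt0 /eqP vk] /eqP NE].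
    rewrite [w _](trunc_termE q_monic q_gt1 vq) // -NE -mulr_natl -mulrA.
    rewrite -[x - _]add0r rval_leM ?rval_natr //.
    have Nk : (N <= k)%N by rewrite NE dvdn_leq // pfactor_dvdnn.
    move: vk; rewrite -[in q ^+ k](subnK Nk) exprD mulrA.
    rewrite [v (_ * q ^+ N)]rvalM (rvalX N vq).
    by case: (v _) => [y||] //= [<-]; rewrite addrK.
  rewrite ext_leNgt; apply/negP => /(trunc_gt q_monic q_gt1 vq)/(_ (k0 - N)%N).
  have Nk0 : (N <= k0)%N by rewrite dvdn_leq // pfactor_dvdnn.
  rewrite dig_sum // (bigD1 (Ordinal k0s)) /=; last by rewrite /lead k0_gt0 vk0 !eqxx.
  rewrite big1 ?addr0 => [|k /andP[/andP[/andP[k_gt0 _] /eqP NE] kk0]].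
    rewrite dig_term // eqxx -mulr_natl -addrA -opprD -mulrnDr subnKC //.
    rewrite (rvalM_fin (p_unit k0_gt0) (_ : _ = (x - b *+ k0)%:E)) ?add0r.
      by apply/negP; exact: ext_ltxx.
    move: vk0; rewrite rvalM (rvalX k0 vq).
    by case: (v _) => [y||] //= [<-]; rewrite addrK.
  rewrite dig_term // -NE; case: eqP => // kE; case/eqP: kk0; apply: val_inj => /=.
  have Nk : (N <= k)%N by rewrite NE dvdn_leq // pfactor_dvdnn.
  by rewrite -(subnK Nk) -kE subnK.
have wt : w (\sum_(k < s) t k) = (x - eps *+ n)%:E.
  have wq : w q^`N(n0) = (b - eps *+ n0)%:E.
    by rewrite w_small ?size_nderiv //; case: q_slope.
  rewrite tE (rvalM_fin (rvalX N wq) wG) mulrnBl addrC addrA subrK.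
  by rewrite mulrnA.
rewrite -[LHS]/(w _); have -> : (\sum_(k < s) r k * q ^+ k)^`N(n) =
    \sum_(k < s) t k + \sum_(k < s) ((r k * q ^+ k)^`N(n) - t k).
  rewrite -big_split /= -coef_taylor rmorph_sum coef_sum.
  by apply: eq_bigr => k _; rewrite subrKC -coef_taylor.
by apply: rval_ltDr => //; apply: rval_lt_sum => k _; exact: term_lt.
Qed.

End Slopes.

(** * Successors and limits in the index set *)

Section Successors.
Context {d : Order.disp_t} (L : bOrderType d) (alpha : L -> nat).
Hypothesis L_wf : well_founded (fun k l : L => (k < l)%O).
Implicit Types (i j k l q r : L) (S : set L).

Local Notation upto l := [set q : L | (q <= l)%O]%classic.

Lemma succ_le k l q : is_succ k l -> (q < l)%O -> (q <= k)%O.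
Proof.
by move=> [_ kl] ql; rewrite leNgt; apply/negP => /kl; rewrite leNgt ql.
Qed.

Lemma succ_unique k l l' : is_succ k l -> is_succ k l' -> l = l'.
Proof. by move=> [kl lk] [kl' lk']; apply: le_anti; rewrite lk ?lk'. Qed.

Lemma succ_exists k l : (k < l)%O -> exists r, is_succ k r.
Proof.
elim/(well_founded_ind L_wf): l => l IH kl.
have [[r /andP[kr rl]]|nr] := pselect (exists r, (k < r < l)%O); first exact: IH r rl kr.
exists l; split=> // r kr; rewrite leNgt; apply/negP => rl; apply: nr.
by exists r; rewrite kr.
Qed.

Lemma is_plus_trans i t q s k : is_plus i t q -> is_plus q s k -> is_plus i (t + s) k.
Proof.
move=> iq; elim=> [|{}s {}k k' qk IH kk']; first by rewrite addn0.
by rewrite addnS; exact: is_plusS IH kk'.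
Qed.

Lemma is_plus_le i t k : is_plus i t k -> (i <= k)%O.
Proof. by elim=> // {}t {}k k' _ ik [/ltW kk' _]; exact: le_trans ik kk'. Qed.

Lemma is_plus1 i k : is_succ i k -> is_plus i 1 k.
Proof. by move=> ik; apply: is_plusS ik; exact: is_plus0. Qed.

Lemma plus_omega_lt i j : is_plus_omega i j -> (i < j)%O.
Proof. by case=> ij _; apply: ij (is_plus0 i). Qed.

Lemma plus_omega_unique i j j' : is_plus_omega i j -> is_plus_omega i j' -> j = j'.
Proof. by move=> [ij ji] [ij' ji']; apply: le_anti; rewrite ji ?ji'. Qed.

Lemma plus_omega_not_succ i k l : is_plus_omega i l -> ~ is_succ k l.
Proof.
move=> [il li] kl; have: (l <= k)%O; last by rewrite leNgt (proj1 kl).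
apply: li => t r ir; rewrite lt_neqAle (succ_le kl (il _ _ ir)) andbT.
apply/eqP => rk; rewrite rk in ir.
by have := il _ _ (is_plusS ir kl); rewrite ltxx.
Qed.

Lemma plus_omega_between i j q : is_plus_omega i j -> (i <= q)%O -> (q < j)%O ->
  exists t, is_plus i t q.
Proof.
move=> [ij ji] iq qj; apply: contrapT => nq.
suff: (j <= q)%O by rewrite leNgt qj.
apply: ji => t k ik; suff: (k <= q)%O.
  by rewrite le_eqVlt => /predU1P[kq|//]; case: nq; exists t; rewrite -kq.
elim: ik => // {}t {}k k' ik kq kk'; apply: (proj2 kk').
rewrite lt_neqAle kq andbT; apply/eqP => kq'; case: nq; exists t.
by rewrite -kq'.
Qed.

Lemma plus_omega_shift i j t q : is_plus_omega i j -> is_plus i t q ->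
  is_plus_omega q j.
Proof.
move=> [ij ji] iq; split=> [s k qk|j' qj']; first exact: ij (is_plus_trans iq qk).
apply: ji => s k ik; have: (k <= q)%O \/ exists u, is_plus q u k.
  elim: ik => [|{}s {}k k' _ IH kk']; first by left; exact: is_plus_le iq.
  case: IH => [|[u qk]]; last by right; exists u.+1; exact: is_plusS qk kk'.
  rewrite le_eqVlt => /predU1P[kq|kq]; last by left; exact: (proj2 kk').
  by right; exists 1%N; apply: is_plus1; rewrite -kq.
case=> [kq|[u]]; last exact: qj'.
exact: le_lt_trans kq (qj' _ _ (is_plus0 q)).
Qed.

Lemma plus_omega_between_shift i j q : is_plus_omega i j -> (i <= q)%O -> (q < j)%O ->
  is_plus_omega q j.
Proof.
by move=> ij iq qj; have [t iqt] := plus_omega_between ij iq qj; exact: plus_omega_shift iqt.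
Qed.

Lemma inessential_shift S i t q : inessential alpha S i ->
  (exists2 j, S j & is_plus_omega q j) -> is_plus i t q -> inessential alpha S q.
Proof.
move=> [_ alpha1] ex_q iq; split=> // s k qk; exact: alpha1 (is_plus_trans iq qk).
Qed.

Lemma is_next_omega_between S i j q : inessential alpha S i -> is_plus_omega i j ->
  S j -> (i <= q)%O -> (q < j)%O -> inessential alpha S q /\ is_next alpha S q j.
Proof.
move=> ie ij Sj iq qj; have [t iqt] := plus_omega_between ij iq qj.
have qjo := plus_omega_shift ij iqt.
have qe : inessential alpha S q by apply: inessential_shift iqt => //; exists j.
by split=> //; split=> //; left.
Qed.

Lemma is_next_lt S i j : is_next alpha S i j -> (i < j)%O.
Proof. by case=> _ [[_ /plus_omega_lt]|[_ []]]. Qed.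

(** Shrinking the segment can only remove witnesses i + omega; since r stays inside, the status of q
    does not change. *)
Lemma is_next_upto k l q r : (k <= l)%O -> (r <= k)%O -> is_next alpha (upto l) q r ->
  is_next alpha (upto k) q r.
Proof.
move=> kl rk [_ nqr]; split=> //; case: nqr => [[[_ a1] qr]|[nq qr]]; [left|right].
  by split=> //; split=> //; exists r.
split=> // -[[j /= jk qj] a1]; apply: nq; split=> //.
by exists j => //=; exact: le_trans jk kl.
Qed.

Lemma is_next_exists k q : (q < k)%O -> exists r, is_next alpha (upto k) q r.
Proof.
move=> qk; have [qe|nqe] := pselect (inessential alpha (upto k) q).
  by have [[r rk qr] _] := qe; exists r; split=> //; left.
have [r qr] := succ_exists qk; exists r; split; last by right.
by apply: (proj2 qr).
Qed.

Lemma succ_not_inessential k l : is_succ k l -> ~ inessential alpha (upto l) k.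
Proof.
move=> kl [[j /= jl [kj _]] _]; have := kj _ _ (is_plus1 kl).
by rewrite ltNge jl.
Qed.

(* The standard l-monomials obtained from the Q_k-free standard k-monomials. *)
Lemma standard_raise k l (m : exponent L) (j : nat) :
    (forall i, 0 < alpha i)%N ->
    is_succ k l \/ is_plus_omega k l /\ inessential alpha setT k ->
    standard alpha k m -> m k = 0%N -> (j < alpha l)%N ->
  standard alpha l [fsfun m with k |-> j] /\ [fsfun m with k |-> j] l = 0%N.
Proof.
move=> alpha_gt0 kl_next [m_le m_lt m_uniq] mk jl.
have kl : (k < l)%O by case: kl_next => [[]//|[/plus_omega_lt]].
have m_gt q : (k < q)%O -> m q = 0%N.
  by move=> kq; apply/eqP; apply: contraTT kq => /m_le; rewrite -leNgt.
have m'E q : [fsfun m with k |-> j] q = if q == k then j else m q.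
  exact: fsfun_withE.
(* If the next index r of q jumps over k, then q is inessential with q + omega = r = l. In the
   segment up to k this omega-limit is missing, so there the next index is q + 1, where alpha is 1;
   standardness then forces m q = 0. *)
have below q r : (q < k)%O -> is_next alpha (upto l) q r ->
    (r <= k)%O \/ r = l /\ m q = 0%N.
  move=> qk qr; have [_ [[qe qro]|[_ qrs]]] := qr; last by left; exact: (proj2 qrs).
  have [rk|kr] := leP r k; [by left|right].
  have rl : r = l.
    have kro := plus_omega_between_shift qro (ltW qk) kr.
    case: kl_next => [kls|[klo _]]; last exact: plus_omega_unique kro klo.
    have rl : (r <= l)%O by case: qr.
    case: (plus_omega_not_succ kro (_ : is_succ k r)).
    suff -> : r = l by [].
    apply: le_anti; rewrite rl; exact: (proj2 kls).
  split=> //; have [s qs] := succ_exists qk.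
  have sk : (s <= k)%O by exact: (proj2 qs).
  have nqe : ~ inessential alpha (upto k) q.
    move=> [[j' /= j'k qj'] _]; have := plus_omega_unique qro qj' => rj'.
    by move: kr; rewrite rj' ltNge j'k.
  have := m_lt q s qk; rewrite ((proj2 qe) 1%N s (is_plus1 qs)).
  have qs' : is_next alpha (upto k) q s by split=> //; right.
  by move/(_ qs'); rewrite ltnS leqn0 => /eqP.
split; last by rewrite m'E gt_eqF // m_gt.
split=> [q|q r ql qr|i r ie ir u u' ur u'r].
- rewrite m'E; case: (q =P k) => [->|_ /m_le qk]; first by rewrite ltW.
  exact: le_trans qk (ltW kl).
- rewrite m'E; case: (q =P k) => [qk|/eqP qk].
    suff -> : r = l by [].
    rewrite qk in qr; have [/= _ [[ke kro]|[nke krs]]] := qr.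
      case: kl_next => [kls|[klo _]]; last exact: plus_omega_unique kro klo.
      by case: (succ_not_inessential kls ke).
    case: kl_next => [kls|[klo [_ a1]]]; first exact: succ_unique krs kls.
    by case: nke; split=> //; exists l => /=.
  have [kq|qk'] := ltP k q; first by rewrite m_gt.
  have {qk qk'}qk : (q < k)%O by rewrite lt_neqAle qk.
  have [rk|[_ ->]] := below q r qk qr; last exact: alpha_gt0.
  by apply: m_lt => //; exact: is_next_upto (ltW kl) rk qr.
have iro : is_plus_omega i r.
  by case: ir => _ [[]//|[nie]]; case: nie.
rewrite !m'E; have [rk|kr] := leP r k.
  have lt_k z : is_next alpha (upto l) z r -> (z == k) = false.
    by move/is_next_lt => zr; rewrite lt_eqF // (lt_le_trans zr rk).
  rewrite !lt_k //; apply: (m_uniq i r); rewrite ?(is_next_upto (ltW kl)) //.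
  - split; last by case: ie.
    by exists r.
  - exact: is_next_upto (ltW kl) rk ir.
  - exact: is_next_upto (ltW kl) rk ur.
  exact: is_next_upto (ltW kl) rk u'r.
suff eq_k z : is_next alpha (upto l) z r -> (if z == k then j else m z) != 0%N -> z = k.
  by move=> mu mu'; rewrite (eq_k u) // (eq_k u').
move=> zr; case: (z =P k) => // /eqP zk mz.
have zk' : (z < k)%O by rewrite lt_neqAle zk m_le.
have [rk|[_ mz0]] := below z r zk' zr; first by rewrite leNgt kr in rk.
by rewrite mz0 in mz.
Qed.

End Successors.

(** * Standard expansions *)

Section PolyValuation.
Context (K : fieldType) (V : orderedQModType) (nu : valuation {fraction {poly K}} V).

Fact poly_val0 : nu (0 : {poly K})%:F = +oo%E.
Proof. by rewrite tofrac0 val0. Qed.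

Fact poly_val_fin (f : {poly K}) : f != 0 -> exists g : V, nu f%:F = g%:E.
Proof. by move=> f0; apply: val_fin; rewrite tofrac_eq0. Qed.

Fact poly_valM (f g : {poly K}) : nu (f * g)%:F = (nu f%:F + nu g%:F)%E.
Proof. by rewrite tofracM Defs.valM. Qed.

Fact poly_valD (f g : {poly K}) : ext_min (nu f%:F) (nu g%:F) <=oo nu (f + g)%:F.
Proof. by rewrite tofracD valD. Qed.

Definition poly_val : rval {poly K} V :=
  RVal poly_val0 poly_val_fin poly_valM poly_valD.

End PolyValuation.

Section NearlySmall.
Context (K : fieldType) (V : orderedQModType) (v : rval {poly K} V).
Context (q : {poly K}) (b : V).
Hypotheses (q_monic : q \is monic) (q_gt1 : (1 < size q)%N).
Hypotheses (vq : v q = b%:E) (q_key : is_key v q).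
Implicit Types (f g : {poly K}).

Lemma dominated_le x y f : y <= x -> dominated v q x f -> dominated v q y f.
Proof.
move=> yx [r [sr xr] xf]; have {}yx : y%:E <=oo x%:E by [].
by exists r; [split=> //; exact: ext_le_trans yx xr|exact: ext_le_lt_trans yx xf].
Qed.

Lemma nearly_small_small f : (size f < size q)%N -> nearly_small v q f.
Proof. by move=> sf x vf; apply: dominated_small => //; rewrite vf ext_lexx. Qed.

Lemma nearly_smallM f g : nearly_small v q f -> nearly_small v q g ->
  nearly_small v q (f * g).
Proof.
move=> fP gP x vfg.
have [f0 g0] : f != 0 /\ g != 0.
  apply/andP; rewrite -negb_or -mulf_eq0.
  by apply: contra_eq_neq vfg => ->; rewrite rval0.
have [[y vf] [z vg]] := (rval_fin v f0, rval_fin v g0).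
move: vfg; rewrite (rvalM_fin vf vg) => -[<-].
apply: (dominatedM q_monic q_gt1 vq q_key); [exact: fP|exact: gP].
Qed.

Lemma nearly_small1 : nearly_small v q 1.
Proof. by apply: nearly_small_small; rewrite size_poly1. Qed.

Lemma nearly_smallX f n : nearly_small v q f -> nearly_small v q (f ^+ n).
Proof.
move=> fP; elim: n => [|n IH]; first exact: nearly_small1.
by rewrite exprS; exact: nearly_smallM.
Qed.

End NearlySmall.

Section StandardExpansions.
Context (K : fieldType) (V : orderedQModType).
Context (nu : valuation {fraction {poly K}} V).
Context {d : Order.disp_t} (L : bOrderType d) (alpha : L -> nat) (Q : L -> {poly K}).
Implicit Types (i j k l q r : L) (m : exponent L) (e : expansion K L) (x : V).

Local Notation v := (poly_val nu).
Local Notation upto l := [set q : L | (q <= l)%O]%classic.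

Lemma monomialE (A : {fset L}) m : (finsupp m `<=` A)%fset ->
  monomial Q m = \prod_(q <- A) Q q ^+ m q.
Proof.
by move=> mA; apply: big_fset_incl => // q _ /fsfun_dflt ->; rewrite expr0.
Qed.

Lemma expandE (A : {fset exponent L}) e : (finsupp e `<=` A)%fset ->
  Defs.expand Q e = \sum_(m <- A) e m *: monomial Q m.
Proof.
by move=> eA; apply: big_fset_incl => // m _ /fsfun_dflt ->; rewrite scale0r.
Qed.

Lemma nearly_small_monomial l m : is_key v (Q l) -> Q l \is monic ->
    (1 < size (Q l))%N -> (forall q, (q < l)%O -> nearly_small v (Q l) (Q q)) ->
  (forall q, m q != 0%N -> (q < l)%O) -> forall c, nearly_small v (Q l) (c *: monomial Q m).
Proof.
move=> l_key l_monic l_gt1 q_small m_lt c.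
have [b vl] : exists b, v (Q l) = b%:E by apply: rval_fin; exact: monic_neq0.
rewrite -mul_polyC; apply: (nearly_smallM l_monic l_gt1 vl l_key).
  by apply: nearly_small_small; rewrite (leq_ltn_trans (size_polyC_leq1 _)).
rewrite /monomial big_seq; elim/big_ind: _ => [|f g|q].
- exact: nearly_small1.
- exact: (nearly_smallM l_monic l_gt1 vl l_key).
by rewrite mem_finsupp => /m_lt/q_small; exact: (nearly_smallX l_monic l_gt1 vl l_key).
Qed.

Lemma free_standard_lt l e m q : free_standard nu alpha Q l e -> m \in finsupp e ->
  m q != 0%N -> (q < l)%O.
Proof.
move=> [e_std _] /e_std[[m_le _ _] ml] mq; rewrite lt_neqAle m_le // andbT.
by apply: contraNneq mq => ->; rewrite ml.
Qed.

Lemma nearly_small_free l e : is_key v (Q l) -> Q l \is monic ->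
    (1 < size (Q l))%N -> (forall q, (q < l)%O -> nearly_small v (Q l) (Q q)) ->
  free_standard nu alpha Q l e -> nearly_small v (Q l) (Defs.expand Q e).
Proof.
move=> l_key l_monic l_gt1 q_small e_free x vx.
have [b vl] : exists b, v (Q l) = b%:E by apply: rval_fin; exact: monic_neq0.
apply: (dominated_sum l_monic l_gt1 vl l_key) => m me.
have [_ ve] := e_free; have : x%:E <=oo v (e m *: monomial Q m).
  by move: m me; apply/ext_le_bigmin; rewrite -ve -vx; exact: ext_lexx.
have m_small : nearly_small v (Q l) (e m *: monomial Q m).
  by apply: nearly_small_monomial => // q; exact: free_standard_lt e_free me.
have [->|/(rval_fin v)[y vy]] := eqVneq (e m *: monomial Q m) 0.
  by move=> _; apply: dominated_small; rewrite ?size_poly0 ?rval0 // ltnW.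
by rewrite vy => /dominated_le; apply; exact: m_small.
Qed.

(* The monomials of a standard expansion of f have value at least v f; this form
   of the condition is stable under sums. *)
Definition has_standard l x f := exists e,
  [/\ forall m, m \in finsupp e -> standard alpha l m /\ m l = 0%N,
      forall m, x%:E <=oo v (e m *: monomial Q m) & f = Defs.expand Q e].

Lemma has_standard0 l x : has_standard l x 0.
Proof.
exists [fsfun of _ => 0]; split=> [m|m|]; first by rewrite in_finsupp0.
  by rewrite fsfun0E scale0r rval0.
by rewrite /Defs.expand finsupp0 big_seq_fset0.
Qed.

Lemma has_standardD l x f g :
  has_standard l x f -> has_standard l x g -> has_standard l x (f + g).
Proof.
move=> [e [e_std xe ->]] [e' [e'_std xe' ->]].
pose A := (finsupp e `|` finsupp e')%fset.
pose s : expansion K L := [fsfun m in A => e m + e' m].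
have sE m : s m = e m + e' m.
  rewrite fsfunE; case: ifPn => //; rewrite inE negb_or => /andP[me me'].
  by rewrite !fsfun_dflt // addr0.
exists s; split=> [m ms|m|].
- have : m \in A by move: m ms; apply/fsubsetP; exact: finsupp_sub.
  by rewrite inE => /orP[]; [exact: e_std|exact: e'_std].
- by rewrite sE scalerDl rval_leD.
rewrite (@expandE A e) ?fsubsetUl // (@expandE A e') ?fsubsetUr //.
rewrite (@expandE A s) ?finsupp_sub // -big_split /=.
by apply: eq_bigr => m _; rewrite sE scalerDl.
Qed.

Lemma has_standard_sum l x (I : eqType) (s : seq I) (F : I -> {poly K}) :
  (forall i : I, i \in s -> has_standard l x (F i)) -> has_standard l x (\sum_(i <- s) F i).
Proof.
elim: s => [|i s IH] FP; first by rewrite big_nil; exact: has_standard0.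
rewrite big_cons; apply: has_standardD; first exact/FP/mem_head.
by apply: IH => j js; apply: FP; rewrite inE js orbT.
Qed.

Lemma has_standard_monomial l x (c : K) m : standard alpha l m -> m l = 0%N ->
  x%:E <=oo v (c *: monomial Q m) -> has_standard l x (c *: monomial Q m).
Proof.
move=> m_std ml xm; pose s : expansion K L := [fsfun k in [fset m]%fset => c].
have sE m' : s m' = if m' == m then c else 0 by rewrite fsfunE inE.
exists s; split=> [m'|m'|].
- by rewrite mem_finsupp sE; case: (m' =P m) => [->|_] //; rewrite eqxx.
- by rewrite sE; case: eqP => [->|_] //; rewrite scale0r rval0.
by rewrite (@expandE [fset m]%fset s) ?finsupp_sub // big_seq_fset1 sE eqxx.
Qed.

(** With the bound placed at v f, the ultrametric inequality yields the equality required by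
    [free_standard]. For f = 0, where [fine] is a default value, the empty expansion serves. *)
Lemma has_standard_free l f : has_standard l (fine (v f)) f ->
  exists2 e, free_standard nu alpha Q l e & f = Defs.expand Q e.
Proof.
have [->|/(rval_fin v)[y vf]] := eqVneq f 0.
  move=> _; exists [fsfun of _ => 0]; last by rewrite /Defs.expand finsupp0 big_seq_fset0.
  split=> [m|]; first by rewrite in_finsupp0.
  rewrite /Defs.expand finsupp0 big_seq_fset0 -[LHS]/(v 0) rval0 big_seq big_pred0 //.
rewrite vf => -[e [e_std ye fE]]; exists e => //; split=> //.
apply: ext_le_anti; last by rewrite /Defs.expand; exact: (rval_bigmin_le v).
by rewrite -fE -[X in X <=oo _]/(v f) vf; apply/ext_le_bigmin => m _; exact: ye.
Qed.

Lemma has_max (P : pred L) (s : seq L) : has P s ->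
  exists2 q, (q \in s) && P q & forall r, r \in s -> P r -> (r <= q)%O.
Proof.
elim: s => //= a s IH; have [/IH[q /andP[qs Pq] q_max] _|ns] := boolP (has P s).
  have [Pa|nPa] := boolP (P a); last first.
    exists q => [|r]; first by rewrite inE qs orbT.
    by rewrite inE => /predU1P[->|/q_max//]; rewrite (negPf nPa).
  have [qa|aq] := leP q a.
    exists a => [|r]; first by rewrite mem_head.
    by rewrite inE => /predU1P[->//|rs Pr]; exact: le_trans (q_max r rs Pr) qa.
  exists q => [|r]; first by rewrite inE qs orbT.
  by rewrite inE => /predU1P[->|/q_max//] _; exact: ltW.
rewrite orbF => Pa; exists a => [|r]; first by rewrite mem_head.
rewrite inE => /predU1P[->//|rs Pr]; case/hasP: ns; by exists r.
Qed.

Hypothesis L_wf : well_founded (fun k l : L => (k < l)%O).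

Section Degree.
Variable k : L.
Hypothesis Q_monic : forall q, Q q \is monic.
Hypothesis Q_gt1 : forall q, (q <= k)%O -> (1 < size (Q q))%N.
Hypothesis Q_mono : forall q r, (q <= r)%O -> (r <= k)%O -> (size (Q q) <= size (Q r))%N.
Hypothesis Q_next : forall q r, is_next alpha (upto k) q r ->
  (size (Q r)).-1 = (alpha r * (size (Q q)).-1)%N.

(** Positional notation with varying bases. For the largest q < l in the support, with next index r,
    the rest has degree < deg Q_q, so the whole has degree < (m q + 1) deg Q_q <= alpha r * deg Q_q
    = deg Q_r <= deg Q_l. *)
Lemma size_monomial_lt m l : standard alpha k m -> (l <= k)%O ->
    (forall q, (q < l)%O -> m q != 0%N -> exists2 r, (r <= l)%O & is_next alpha (upto k) q r) ->
  (size (\prod_(q <- finsupp m | (q < l)%O) Q q ^+ m q)%R < size (Q l))%N.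
Proof.
move=> [m_le m_lt m_uniq]; elim/(well_founded_ind L_wf): l => l IH lk l_next.
have [/has_max[q /andP[qm ql] q_max]|nm] := boolP (has (fun q => (q < l)%O) (finsupp m)).
  have mq : m q != 0%N by rewrite -mem_finsupp.
  have [r rl qr] := l_next q ql mq.
  have mqr := m_lt q r (lt_le_trans ql lk) qr.
  have -> : \prod_(i <- finsupp m | (i < l)%O) Q i ^+ m i =
      Q q ^+ m q * \prod_(i <- finsupp m | (i < q)%O) Q i ^+ m i.
    rewrite big_mkcond (bigD1_seq q) ?fset_uniq //= ql; congr (_ * _).
    rewrite big_mkcond [RHS]big_mkcond; apply: eq_big_seq => i im.
    case: (ltgtP i q) => //= [iq|qi]; first by rewrite (lt_trans iq ql).
    by case: ifP => // il; have := q_max i im il; rewrite leNgt qi.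
  set R := \prod_(i <- _ | _) _.
  have sR : (size R < size (Q q))%N.
    apply: IH => //; first exact: ltW (lt_le_trans ql lk).
    (* The next index u of i is at most q: otherwise i is inessential and q lies between i and i +
       omega = u, so both have the same next index, and a standard monomial cannot involve both. *)
    move=> i iq mi; have [u [uk iu]] := is_next_exists alpha L_wf (lt_trans iq (lt_le_trans ql lk)).
    exists u => //; rewrite leNgt; apply/negP => qu; case: iu => [[ie iuo]|[_ ius]].
      have [qe qu'] := is_next_omega_between ie iuo uk (ltW iq) qu.
      have iu : is_next alpha (upto k) i u by split=> //; left.
      by have := m_uniq i u ie iu i q iu qu' mi mq => iq'; rewrite iq' ltxx in iq.
    by have := (proj2 ius) q iq; rewrite leNgt qu.
  have R_monic : R \is monic by apply: rpred_prod => i _; exact: rpredX.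
  have lr : (size (Q r) <= size (Q l))%N by apply: Q_mono.
  apply: leq_trans lr; have := Q_next qr.
  have sX : size (Q q ^+ m q) = ((size (Q q)).-1 * m q).+1.
    by rewrite -size_exp prednK // size_poly_gt0 expf_neq0 ?monic_neq0.
  rewrite mulrC size_Mmonic ?monic_neq0 ?rpredX // sX addnS /=.
  have q1 := Q_gt1 (ltW (lt_le_trans ql lk)).
  have r1 := Q_gt1 (le_trans rl lk).
  move: (size (Q q)) (size (Q r)) (size R) (m q) (alpha r) sR mqr q1 r1.
  move=> sq sr sR' mq' ar ltR lt_ar q1 r1 E.
  have : ((sq.-1 * mq'.+1) <= ar * sq.-1)%N by rewrite mulnC leq_mul2r lt_ar orbT.
  by rewrite mulnS; lia.
rewrite big_seq_cond big_pred0 ?size_poly1 ?Q_gt1 // => q.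
apply/negP => /andP[qm ql]; case/hasP: nm; by exists q.
Qed.

Lemma size_standard_lt m : standard alpha k m -> m k = 0%N ->
  (size (monomial Q m) < size (Q k))%N.
Proof.
move=> m_std mk; have [m_le _ _] := m_std.
have m_lt q : m q != 0%N -> (q < k)%O.
  move=> mq; rewrite lt_neqAle m_le // andbT.
  by apply: contraNneq mq => ->; rewrite mk.
have := @size_monomial_lt m k m_std (lexx k); rewrite /monomial.
move=> H; rewrite big_seq (eq_bigl (fun q => (q \in finsupp m) && (q < k)%O)).
  rewrite -big_seq_cond; apply: H => q qk _.
  by have [r qr] := is_next_exists alpha L_wf qk; exists r => //; case: qr.
by move=> q; case: (finsuppP m q) => // qm; rewrite m_lt // -mem_finsupp.
Qed.

Lemma size_free_lt e : free_standard nu alpha Q k e ->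
  (size (Defs.expand Q e) < size (Q k))%N.
Proof.
move=> [e_std _]; rewrite /Defs.expand big_seq; elim/big_ind: _ => [|f g sf sg|m /e_std[]].
- by rewrite size_poly0 ltnW // Q_gt1.
- by rewrite (leq_ltn_trans (size_polyD _ _)) // gtn_max sf.
by move=> *; rewrite (leq_ltn_trans (size_scale_leq _ _)) // size_standard_lt.
Qed.

End Degree.
End StandardExpansions.

(** * Initial forms *)

Section GradedClasses.
Local Open Scope quotient_scope.
Context (F : fieldType) (V : orderedQModType) (nu : valuation F V).
Implicit Types (x y : F) (b : V) (z : gr nu).

(** The value of y may exceed the degree b, and then the class is zero. Unlike [initial], this
    relation is additive for fixed b. *)
Definition is_class b y z : Prop := exists le_b_y : b%:E <=oo nu y, z = gr_class le_b_y.

Lemma gr_comp1 b c y : gr_comp c [:: (b, y)] = if b == c then y else 0.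
Proof. by rewrite /gr_comp big_mkcond big_seq1. Qed.

Lemma is_class0 b : is_class b 0 0.
Proof.
have b0 : b%:E <=oo nu 0 by rewrite Defs.val0.
exists b0; have -> : 0 = \pi_(gr nu) (pre0 nu) by rewrite -gr_zeroE.
by apply: gr_eqW => c; rewrite comp0 gr_comp1 if_same.
Qed.

Lemma is_classD b x y z z' : is_class b x z -> is_class b y z' ->
  is_class b (x + y) (z + z').
Proof.
move=> [bx ->] [b_y ->]; have bxy := val_leD bx b_y; exists bxy.
rewrite -[LHS]pi_gr_add; apply: gr_eqW => c; rewrite comp_add !gr_comp1.
by case: eqP => // _; rewrite addr0.
Qed.

Lemma is_class_sum b (I : Type) (r : seq I) (P : pred I) (f : I -> F) (g : I -> gr nu) :
  (forall i, P i -> is_class b (f i) (g i)) ->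
  is_class b (\sum_(i <- r | P i) f i) (\sum_(i <- r | P i) g i).
Proof.
move=> fg; apply: (big_rec2 (is_class b)); first exact: is_class0.
by move=> i x z Pi; apply: is_classD; exact: fg.
Qed.

Lemma is_class_initial b y : nu y = b%:E -> is_class b y (initial nu y).
Proof.
move=> vy; have b_y : b%:E <=oo nu y by rewrite vy ext_lexx.
by exists b_y; apply: gr_eqW => c; rewrite !gr_comp1 vy.
Qed.

Lemma is_class_eq0 b y z : is_class b y z -> (z == 0) = (b%:E <oo nu y).
Proof.
case=> b_y ->; have -> : 0 = \pi_(gr nu) (pre0 nu) by rewrite -gr_zeroE.
apply/gr_eqP/idP => [/(_ b)|lt_b c].
  by rewrite comp0 subr0 gr_comp1 eqxx.
rewrite comp0 subr0 gr_comp1.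
by case: eqP => [<-//|_]; rewrite Defs.val0.
Qed.

Lemma is_class_unique b y z z' : is_class b y z -> is_class b y z' -> z = z'.
Proof.
by move=> [b_y ->] [b_y' ->]; apply: gr_eqW.
Qed.

Lemma initial1 : initial nu 1 = 1.
Proof.
apply/eqP; have := initialM nu 1 1; rewrite mulr1 => /eqP.
rewrite -subr_eq0 -{1}[initial nu 1]mulr1 -mulrBr mulf_eq0 initial_eq0 oner_eq0.
by rewrite subr_eq0 eq_sym.
Qed.

Lemma initialX x n : initial nu (x ^+ n) = initial nu x ^+ n.
Proof.
by elim: n => [|n IH]; rewrite ?expr0 ?initial1 // !exprS initialM IH.
Qed.

Lemma generated0 S : generated S (0 : gr nu).
Proof. by rewrite -(subrr 1); apply: gen_sub; exact: gen_one. Qed.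

Lemma generatedD S z z' : generated S z -> generated S z' -> generated S (z + z').
Proof.
move=> Sz Sz'; rewrite -[z']opprK; apply: gen_sub => //.
by rewrite -sub0r; apply: gen_sub => //; exact: generated0.
Qed.

Lemma generatedX S z n : generated S z -> generated S (z ^+ n).
Proof.
move=> Sz; elim: n => [|n IH]; first exact: gen_one.
by rewrite exprS; exact: gen_mul.
Qed.

End GradedClasses.

(** * What the minimal algebraic relation says about values *)

Section MinimalRelation.
Context (K : fieldType) (V : orderedQModType).
Context (nu : valuation {fraction {poly K}} V).
Context {d : Order.disp_t} (L : bOrderType d) (alpha : L -> nat) (Q : L -> {poly K}).
Implicit Types (k l q : L) (m : exponent L) (e : expansion K L).

Local Notation v := (poly_val nu).
Local Notation init f := (initial nu (f : {poly K})%:F).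

Lemma initM (f g : {poly K}) : init (f * g) = init f * init g.
Proof. by rewrite tofracM initialM. Qed.

Lemma initX (f : {poly K}) n : init (f ^+ n) = init f ^+ n.
Proof. by rewrite tofracXn initialX. Qed.

Lemma gr_below_monomial k (c : K) m : (forall q, m q != 0%N -> (q < k)%O) ->
  gr_below Q k (init (c *: monomial Q m)).
Proof.
move=> m_lt; rewrite -mul_polyC initM; apply: gen_mul.
  apply: gen_in; left; exists (initial (restr_const nu) c) => //.
  by rewrite gr_incl_initial.
rewrite /monomial big_seq; elim/big_ind: _ => [|f g|q].
- by rewrite tofrac1 initial1; exact: gen_one.
- by rewrite initM; exact: gen_mul.
rewrite mem_finsupp => /m_lt qk; rewrite initX; apply: generatedX.
by apply: gen_in; right; exists q.
Qed.

(** The value condition in [free_standard] excludes cancellation: the initial form is the sum of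
    those of the monomials of least value, the others having class zero in that degree. *)
Lemma gr_below_free k e : free_standard nu alpha Q k e ->
  gr_below Q k (init (Defs.expand Q e)).
Proof.
move=> e_free; have [-> |/(rval_fin v)[b vb]] := eqVneq (Defs.expand Q e) 0.
  by rewrite tofrac0 initial0; exact: generated0.
have [_ ve] := e_free; have b_le m : m \in finsupp e -> b%:E <=oo v (e m *: monomial Q m).
  by move: m; apply/ext_le_bigmin; rewrite -ve -vb; exact: ext_lexx.
pose t m : gr nu := if v (e m *: monomial Q m) == b%:E then init (e m *: monomial Q m) else 0.
have : is_class b (Defs.expand Q e)%:F (\sum_(m <- finsupp e) t m).
  rewrite /Defs.expand (raddf_sum (@tofrac _)) big_seq [X in is_class _ _ X]big_seq.
  apply: is_class_sum => m me; rewrite /t; case: eqP => [|vm].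
    exact: is_class_initial.
  have bm := b_le m me; have b_lt : b%:E <oo v (e m *: monomial Q m).
    by rewrite /ext_lt bm andbT eq_sym; apply/eqP.
  exists bm; apply/esym/eqP; rewrite (is_class_eq0 (b := b) (y := (e m *: monomial Q m)%:F)) //.
  by exists bm.
move/(is_class_unique (is_class_initial vb)) => ->.
rewrite big_seq; elim/big_ind: _ => [|z z'|m me]; first exact: generated0.
  exact: generatedD.
rewrite /t; case: eqP => _; last exact: generated0.
by apply: gr_below_monomial => q; exact: free_standard_lt e_free me.
Qed.

(** In degree b * alpha l the class of Q_l is the relation of (b) evaluated at the initial form of
    Q_k, which is zero. *)
Lemma succ_value_gt k l b : key_b nu alpha Q -> is_succ k l -> v (Q k) = b%:E ->
  (b *+ alpha l)%:E <oo v (Q l).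
Proof.
move=> hb kl vk; have [e [e_free QlE e_val [_ _ rel _]]] := hb k l kl.
set n := alpha l in e_free QlE e_val rel *; pose x := b *+ n.
have vkn : v (Q k ^+ n) = x%:E by exact: rvalX.
pose t := \sum_(j < n) \sum_(m <- finsupp (e j)) init (e j m *: monomial Q m * Q k ^+ j).
have t_class : is_class x (Q l)%:F (init (Q k) ^+ n + t).
  rewrite QlE tofracD -initX; apply: is_classD; first exact: is_class_initial.
  rewrite (raddf_sum (@tofrac _)); apply: is_class_sum => j _.
  rewrite /Defs.expand mulr_suml (raddf_sum (@tofrac _)) big_seq [X in is_class _ _ X]big_seq.
  apply: is_class_sum => m me; apply: is_class_initial.
  by rewrite (e_val j m) // -[LHS]/(v _) vkn.
rewrite -[X in _ <oo X]/(nu (Q l)%:F) -(is_class_eq0 t_class) -tofrac_eq0; apply/eqP.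
move: rel; rewrite hornerD hornerXn horner_sum => rel; rewrite -[RHS]rel.
rewrite tofracD tofracXn; congr (_ + _); rewrite (raddf_sum (@tofrac _)).
apply: eq_bigr => j _; rewrite hornerZ hornerXn -tofracXn -tofracM mulr_suml.
congr (_%:F); apply: eq_bigr => m _.
by rewrite initM initX -mul_polyC initM gr_incl_initial.
Qed.

(** In degree x only the terms of value x have a nonzero class. A sum of value above x would make
    their initial forms a nonzero relation of degree < alpha l for the initial form of Q_k. *)
Lemma succ_no_relation k l x (r : nat -> {poly K}) (j0 : nat) :
    key_b nu alpha Q -> is_succ k l ->
    (forall j, gr_below Q k (init (r j))) ->
    (forall j, (j < alpha l)%N -> x%:E <=oo v (r j * Q k ^+ j)) ->
    (j0 < alpha l)%N -> v (r j0 * Q k ^+ j0) = x%:E ->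
  v (\sum_(j < alpha l) r j * Q k ^+ j) = x%:E.
Proof.
move=> hb kl r_below xr j0_lt vj0; have [e [_ _ _ [_ _ _ P_min]]] := hb k l kl.
set n := alpha l in e P_min xr j0_lt *.
apply: ext_le_anti; last by apply: rval_le_sum => j _; exact: xr.
rewrite ext_leNgt; apply/negP => lt_x.
pose lead j := v (r j * Q k ^+ j) == x%:E.
pose c j : gr nu := if lead j then init (r j) else 0.
pose R := \poly_(j < n) (c j)%:F.
have R0 : R != 0.
  apply/eqP => /(congr1 (fun p : {poly _} => p`_j0)); rewrite coef_poly j0_lt coef0.
  move/eqP; rewrite tofrac_eq0 /c /lead vj0 eqxx initial_eq0 tofrac_eq0 => /eqP r0.
  by move: vj0; rewrite r0 mul0r rval0.
have R_coef j : gr_star (gr_below Q k) R`_j.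
  have homogeneous1 : homogeneous (1 : gr nu).
    have v1 : 0%:E <=oo nu 1 by rewrite Defs.val1 ext_lexx.
    by exists 0, 1, v1; rewrite -initial1; apply: gr_eqW => b; rewrite !gr_comp1 Defs.val1.
  exists (if (j < n)%N then c j else 0), 1; split=> //.
  - case: ifP => _; last exact: generated0.
    by rewrite /c; case: ifP => _; [exact: r_below|exact: generated0].
  - exact: gen_one.
  - exact: oner_neq0.
  by rewrite coef_poly tofrac1 divr1; case: ifP; rewrite ?tofrac0.
have R_root : R.[(init (Q k))%:F] = 0.
  rewrite /R horner_poly.
  have -> : \sum_(j < n) (c j)%:F * (init (Q k))%:F ^+ j =
      (\sum_(j < n) c j * init (Q k) ^+ j)%:F.
    rewrite (raddf_sum (@tofrac _)); apply: eq_bigr => j _.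
    by rewrite -tofracXn -tofracM.
  apply/eqP; rewrite tofrac_eq0.
  pose y := \sum_(j < n) if lead j then r j * Q k ^+ j else 0.
  have -> : \sum_(j < n) c j * init (Q k) ^+ j =
      \sum_(j < n) if lead j then init (r j * Q k ^+ j) else 0.
    apply: eq_bigr => j _; rewrite /c; case: ifP => _; last by rewrite mul0r.
    by rewrite initM initX.
  have y_class : is_class x y%:F (\sum_(j < n) if lead j then init (r j * Q k ^+ j) else 0).
    rewrite (raddf_sum (@tofrac _)); apply: is_class_sum => j _.
    rewrite /lead; case: eqP => vj; first exact: is_class_initial.
    by rewrite (raddf0 (@tofrac _)); exact: is_class0.
  rewrite (is_class_eq0 y_class) -[X in _ <oo X]/(v y).
  have -> : y = \sum_(j < n) r j * Q k ^+ j -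
      \sum_(j < n) if lead j then 0 else r j * Q k ^+ j.
    rewrite -sumrB; apply: eq_bigr => j _; case: ifP => _; by rewrite ?subr0 ?subrr.
  apply: rval_ltB => //; apply: rval_lt_sum => j _; rewrite /lead.
  by case: eqP => vj; rewrite ?rval0 // /ext_lt xr // andbT eq_sym; apply/eqP.
have := P_min R R0 R_coef R_root; rewrite leqNgt => /negP; apply.
rewrite size_polyDl ?size_polyXn ?ltnS ?size_poly //.
apply: leq_trans (size_sum _ _ _) _; apply/bigmax_leqP => j _.
by rewrite (leq_trans (size_scale_leq _ _)) // size_polyXn.
Qed.

End MinimalRelation.

(** * Induction on the index set *)

Section KeyInduction.
Context (K : fieldType) (V : orderedQModType).
Context (nu : valuation {fraction {poly K}} V).
Context {d : Order.disp_t} (L : bOrderType d) (alpha : L -> nat) (Q : L -> {poly K}).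
Hypothesis L_wf : well_founded (fun k l : L => (k < l)%O).
Hypotheses (hpre : pre_key alpha Q) (hb : key_b nu alpha Q) (hc : key_c nu alpha Q).
Implicit Types (i k l q r : L) (j : nat) (f g : {poly K}).

Local Notation v := (poly_val nu).
Local Notation upto l := [set q : L | (q <= l)%O]%classic.
Local Notation tr l := (trunc v (Q l)).

Let alpha_gt0 i : (0 < alpha i)%N. Proof. by case: hpre. Qed.
Let Q_monic i : Q i \is monic. Proof. by case: hpre. Qed.

Let vQ i : exists b, v (Q i) = b%:E.
Proof. by apply: rval_fin; exact: monic_neq0. Qed.

(** [inv_std] carries standard expansions through the induction. It leaves out the maximum because
    its step needs deg Q_l = alpha l * deg Q_k, which at a limit is imposed only for non-maximal
    l. *)
Record key_inv l : Prop := KeyInv {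
  inv_gt1 : (1 < size (Q l))%N;
  inv_key : is_key v (Q l);
  inv_lt : forall q, (q < l)%O -> tr q (Q l) <oo v (Q l);
  inv_mono : forall q f, (q < l)%O -> tr q f <=oo tr l f;
  inv_small : l != \bot%O -> forall f, (size f < size (Q l))%N ->
    exists2 q, (q < l)%O & tr q f = v f;
  inv_std : ~ is_max l -> forall f, (size f < size (Q l))%N ->
    exists2 e, free_standard nu alpha Q l e & f = Defs.expand Q e;
  inv_succ : forall k, is_succ k l -> (size (Q l)).-1 = (alpha l * (size (Q k)).-1)%N
}.

Lemma trunc_rval l : key_inv l -> exists w : rval {poly K} V, forall f, w f = tr l f.
Proof.
move=> inv; have [b vb] := vQ l.
by exists (trunc_val (Q_monic l) (inv_gt1 inv) vb (inv_key inv)).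
Qed.

Lemma inv_trunc_le l f : key_inv l -> tr l f <=oo v f.
Proof. by move=> inv; have [b vb] := vQ l; apply: (trunc_le _ _ vb) => //; case: inv. Qed.

Lemma inv_trunc_small l f : key_inv l -> (size f < size (Q l))%N -> tr l f = v f.
Proof. by move=> inv; have [b vb] := vQ l; apply: (trunc_small _ _ vb) => //; case: inv. Qed.

Lemma inv_mono_le q l f : key_inv l -> (q <= l)%O -> tr q f <=oo tr l f.
Proof.
move=> inv; rewrite le_eqVlt => /predU1P[->|]; [exact: ext_lexx|exact: inv_mono].
Qed.

Lemma trunc_eq_mono q l f : key_inv l -> (q <= l)%O -> tr q f = v f -> tr l f = v f.
Proof.
move=> inv ql qf; apply: ext_le_anti; first exact: inv_trunc_le.
by rewrite -qf; exact: inv_mono_le.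
Qed.

Lemma inv_size_le q l : key_inv q -> tr q (Q l) <oo v (Q l) -> (size (Q q) <= size (Q l))%N.
Proof.
move=> inv lt_l; rewrite leqNgt; apply/negP => /(inv_trunc_small inv) e_l.
by move: lt_l; rewrite e_l; apply/negP; exact: ext_ltxx.
Qed.

(** Only equal degrees need an argument. If then v (Q q) >= v (Q l), the difference Q_l - Q_q has
    small degree and value at least v (Q l), which would lift [tr q (Q l)] to v (Q l), against
    [inv_lt]. *)
Lemma inv_nearly_small q l : key_inv q -> key_inv l -> (q < l)%O ->
  nearly_small v (Q l) (Q q).
Proof.
move=> invq invl ql; have [b vl] := vQ l.
have lt_l := inv_lt invl ql.
have := inv_size_le invq lt_l; rewrite leq_eqVlt => /predU1P[sq|]; last first.
  exact: nearly_small_small.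
move=> x vq; apply: (dominated_same_size _ _ vl) => //; first by case: invl.
rewrite ltNge; apply/negP => bx.
have [w wE] := trunc_rval invq.
have vqb : b%:E <=oo v (Q q) by rewrite vq.
have : b%:E <=oo w (Q l); last first.
  by rewrite wE ext_leNgt -vl lt_l.
rewrite -[Q l](subrK (Q q)); apply: rval_leD; last first.
  by rewrite wE (trunc_q _ _ vq) //; case: invq.
rewrite wE inv_trunc_small //; first by rewrite rval_leB ?vl ?ext_lexx.
have := size_polyD (Q l) (- Q q); rewrite size_polyN sq maxnn leq_eqVlt => /predU1P[] // s_lq.
have : lead_coef (Q l - Q q) = 0.
  rewrite lead_coefE s_lq coefB -{2}sq -!lead_coefE.
  by rewrite (eqP (Q_monic l)) (eqP (Q_monic q)) subrr.
by move/eqP; rewrite lead_coef_eq0 => /eqP ->; rewrite size_poly0 -sq; case: invq => /ltnW.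
Qed.

Lemma trunc_min_value l s c f : (forall q, (q <= l)%O -> key_inv q) ->
  standard_expansion nu alpha Q l s c f -> tr l f = min_value nu Q l s c.
Proof.
move=> inv [c_std fE]; have [b vl] := vQ l; have invl := inv l (lexx l).
rewrite (trunc_standard (Q_monic l) (inv_gt1 invl) vl (inv_key invl) fE) // => j js.
have [e e_free ->] := c_std j js; apply: nearly_small_free e_free => //.
- by case: invl.
- by case: invl.
by move=> q ql; apply: inv_nearly_small => //; apply: inv; exact: ltW.
Qed.

Lemma standard_expansion_exists l f : key_inv l -> ~ is_max l ->
  exists s c, standard_expansion nu alpha Q l s c f.
Proof.
move=> inv lM; exists (size f), (dig (Q l) f); split=> [j _|].
  by apply: inv_std => //; exact: size_dig.
rewrite big_ord_recr /= size_dig_ge // ?mul0r ?addr0; last by case: inv.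
by apply: dig_expansion => //; case: inv.
Qed.

Lemma is_next_degree k q r : (forall l, (l <= k)%O -> key_inv l) -> ~ is_max k ->
  is_next alpha (upto k) q r -> (size (Q r)).-1 = (alpha r * (size (Q q)).-1)%N.
Proof.
move=> inv kM [rk [[qe qr]|[_ qr]]]; last exact: inv_succ (inv r rk) _ qr.
have q_r := plus_omega_lt qr.
case: hpre => _ _ _ _; apply.
- by move=> rM; apply: kM => l; exact: le_trans (rM l) rk.
- by rewrite -lt0x (le_lt_trans (le0x q) q_r).
- exact: q_r.
split=> //; left; split=> //; split; last by case: qe.
by exists r.
Qed.

Lemma size_free k e : (forall l, (l <= k)%O -> key_inv l) -> ~ is_max k ->
  free_standard nu alpha Q k e -> (size (Defs.expand Q e) < size (Q k))%N.
Proof.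
move=> inv kM; apply: size_free_lt => //.
- by move=> q /inv[].
- move=> q r qr rk; move: qr; rewrite le_eqVlt => /predU1P[->//|qr].
  by apply: inv_size_le; [exact/inv/ltW/(lt_le_trans qr rk)|exact: inv_lt (inv r rk) _ qr].
by move=> q r; exact: is_next_degree.
Qed.

Lemma lt_not_max k l : (k < l)%O -> ~ is_max k.
Proof. by move=> kl /(_ l); rewrite leNgt kl. Qed.

Lemma inv_le_lt k l : (forall q, (q < l)%O -> key_inv q) -> (k < l)%O ->
  forall q, (q <= k)%O -> key_inv q.
Proof. by move=> inv kl q qk; exact/inv/(le_lt_trans qk kl). Qed.

Lemma succ_expansion k l : (forall q, (q < l)%O -> key_inv q) -> is_succ k l ->
  exists c : nat -> {poly K},
    [/\ Q l = \sum_(j < (alpha l).+1) c j * Q k ^+ j,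
        c (alpha l) = 1 &
        forall j, (j < alpha l)%N ->
          exists2 e, free_standard nu alpha Q k e & c j = Defs.expand Q e].
Proof.
move=> inv kl; have [e [e_free QlE _ _]] := hb kl.
exists (fun j => if (j < alpha l)%N then Defs.expand Q (e j) else 1); split.
- rewrite big_ord_recr /= ltnn mul1r addrC QlE; congr (_ + _).
  by apply: eq_bigr => j _; rewrite ltn_ord.
- by rewrite ltnn.
by move=> j jl; rewrite jl; exists (e j) => //; exact: e_free.
Qed.

(** [pre_key] covers neither a maximal l nor the successor of an inessential k. In (b) the
    coefficients are free standard expansions at k, which is not maximal, so they have degree < deg
    Q_k and the power of Q_k gives the degree. *)
Lemma succ_degree k l : (forall q, (q < l)%O -> key_inv q) -> is_succ k l ->
  (size (Q l)).-1 = (alpha l * (size (Q k)).-1)%N.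
Proof.
move=> inv kl; have [c [QlE c1 cP]] := succ_expansion inv kl.
have kltl := proj1 kl; have k1 := inv_gt1 (inv k kltl).
have sX n : size (Q k ^+ n) = ((size (Q k)).-1 * n).+1.
  by rewrite -size_exp prednK // size_poly_gt0 expf_neq0 ?monic_neq0.
rewrite QlE big_ord_recr /= c1 mul1r addrC size_polyDl sX /= 1?mulnC //.
apply: leq_ltn_trans (size_sum _ _ _) _; rewrite ltnS; apply/bigmax_leqP => j _.
have [e e_free ->] := cP j (ltn_ord j).
have := size_free (inv_le_lt inv kltl) (lt_not_max kltl) e_free.
have := size_polyMleq (Defs.expand Q e) (Q k ^+ j); rewrite sX.
have := ltn_ord j; move: (val j) => {}j.
move: (size _) (size (Defs.expand Q e)) (size (Q k)) (alpha l) k1 => s1 s2 sk a k1 ja le1 lt2.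
apply: leq_trans le1 _; rewrite addnS /=.
have : (sk.-1 * j.+1 <= sk.-1 * a)%N by rewrite leq_mul2l ja orbT.
by rewrite mulnS; lia.
Qed.

Lemma succ_trunc_lt k l : (forall q, (q < l)%O -> key_inv q) -> is_succ k l ->
  tr k (Q l) <oo v (Q l).
Proof.
move=> inv kl; have [c [QlE c1 cP]] := succ_expansion inv kl.
have kltl := proj1 kl; have invk := inv k kltl; have [b vk] := vQ k.
apply: ext_le_lt_trans (succ_value_gt hb kl vk).
have c_small j : (j < (alpha l).+1)%N -> nearly_small v (Q k) (c j).
  rewrite ltnS leq_eqVlt => /predU1P[->|/cP[e e_free ->]].
    by rewrite c1; apply: nearly_small1; case: invk.
  apply: nearly_small_free e_free => //; [by case: invk|by case: invk|].
  by move=> q qk; apply: inv_nearly_small => //; exact/inv/(lt_trans qk).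
rewrite (trunc_standard (Q_monic k) (inv_gt1 invk) vk (inv_key invk) QlE c_small).
set M := bigop.body _ _ _; have : M <=oo M by exact: ext_lexx.
move/ext_le_bigmin/(_ (alpha l)); rewrite mem_iota /= add0n ltnSn => /(_ isT).
by rewrite c1 mul1r -[X in _ <=oo X -> _]/(v (Q k ^+ alpha l)) (rvalX _ vk).
Qed.

Lemma succ_trunc_eq k l f : (forall q, (q < l)%O -> key_inv q) -> is_succ k l ->
  (size f < size (Q l))%N -> tr k f = v f.
Proof.
move=> inv kl fl; have kltl := proj1 kl; have invk := inv k kltl.
have [b vk] := vQ k; have k1 := inv_gt1 invk.
have [->|f0] := eqVneq f 0; first by rewrite trunc0 rval0.
have [x fx] := trunc_fin (Q_monic k) k1 vk f0.
have /(trunc_ge (Q_monic k) k1 vk) xf : x%:E <=oo tr k f by rewrite fx ext_lexx.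
have fa : (size f < size (Q k ^+ alpha l))%N.
  apply: leq_trans fl _; rewrite -[X in (_ <= X)%N]prednK; last first.
    by rewrite size_poly_gt0 expf_neq0 ?monic_neq0.
  rewrite size_exp mulnC -(succ_degree inv kl) prednK // size_poly_gt0 monic_neq0 //.
have fE := dig_expansion_lt fa.
have dig_x j : x%:E <=oo v (dig (Q k) f j * Q k ^+ j).
  rewrite -[x](subrK (b *+ j)) rval_leM ?xf //.
  by rewrite (rvalX _ vk) ext_lexx.
have [j0 j0a vj0] : exists2 j0, (j0 < alpha l)%N & v (dig (Q k) f j0 * Q k ^+ j0) = x%:E.
  apply: contrapT => nj; have : x%:E <oo tr k f; last first.
    by rewrite fx; apply/negP; exact: ext_ltxx.
  apply/(trunc_gt (Q_monic k) k1 vk) => j; have [ja|aj] := ltnP j (alpha l); last first.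
    rewrite /dig divp_small ?mod0p ?rval0 //; apply: leq_trans fa _.
    by rewrite dvdp_leq ?expf_neq0 ?monic_neq0 ?dvdp_exp2l.
  have : x%:E <oo v (dig (Q k) f j * Q k ^+ j).
    by rewrite /ext_lt dig_x andbT eq_sym; apply/eqP => vj; apply: nj; exists j.
  rewrite rvalM (rvalX _ vk) !ext_ltE.
  by case: (v (dig _ _ _)) => [y||] //=; rewrite ltr_subl_translate.
(* By [inv_std] the digits are free standard expansions, so their initial forms are admissible
   coefficients for the minimality in (b). *)
rewrite fx [in RHS]fE; apply/esym/(succ_no_relation hb kl _ _ j0a vj0) => // j.
have [e e_free ->] := inv_std invk (lt_not_max kltl) (size_dig (Q_monic k) f j).
exact: gr_below_free e_free.
Qed.

(* The predecessors k of l from which Q_l is built, whether l is a successor or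
   a limit; any index in between is again one of them. *)
Definition is_pred k l := is_succ k l \/
  (forall q, ~ is_succ q l) /\ is_plus_omega k l /\ inessential alpha setT k.

Lemma is_pred_lt k l : is_pred k l -> (k < l)%O.
Proof. by case=> [[]//|[_ [/plus_omega_lt]]]. Qed.

Lemma is_pred_between k q l : is_pred k l -> (k <= q)%O -> (q < l)%O -> is_pred q l.
Proof.
case=> [kl|[nl [klo ke]]] kq ql.
  by left; suff -> : q = k by []; apply: le_anti; rewrite kq (succ_le kl ql).
right; split=> //; split; first exact: plus_omega_between_shift klo kq ql.
by have [] := is_next_omega_between ke klo I kq ql.
Qed.

Lemma is_next_pred k l : (forall q, ~ is_succ q l) -> is_next alpha setT k l <-> is_pred k l.
Proof.
move=> nl; split=> [[_ [[ke klo]|[_ /nl//]]]|[/nl//|[_ [klo ke]]]]; first by right.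
by split=> //; left.
Qed.

Lemma is_pred_exists l : l != \bot%O -> exists k, is_pred k l.
Proof.
move=> l0; have [[k kl]|nl] := pselect (exists k, is_succ k l); first by exists k; left.
have {}nl k : ~ is_succ k l by move=> kl; apply: nl; exists k.
by have [[k /(is_next_pred _ nl) kl] _ _ _] := hc l0 nl; exists k.
Qed.

Lemma pred_trunc_lt k l : (forall q, (q < l)%O -> key_inv q) -> is_pred k l ->
  tr k (Q l) <oo v (Q l).
Proof.
move=> inv kl; have kltl := is_pred_lt kl; case: (kl) => [kls|[nl _]].
  exact: succ_trunc_lt.
have l0 : l != \bot%O by rewrite -lt0x (le_lt_trans (le0x k) kltl).
have [_ /(_ k) hk _ _] := hc l0 nl.
have [|[c c_std] /(_ c c_std) lt_min] := hk; first exact/is_next_pred.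
by rewrite (trunc_min_value (inv_le_lt inv kltl) c_std).
Qed.

Lemma pred_trunc_eq l f : (forall q, (q < l)%O -> key_inv q) -> l != \bot%O ->
  (size f < size (Q l))%N -> exists2 k, is_pred k l & tr k f = v f.
Proof.
move=> inv l0 fl; have [[k kl]|nl] := pselect (exists k, is_succ k l).
  by exists k; [left|exact: succ_trunc_eq fl].
have {}nl k : ~ is_succ k l by move=> kl; apply: nl; exists k.
have [_ _ l_min _] := hc l0 nl.
have : ~ limit_increasing nu alpha Q l f by move=> /l_min; rewrite leqNgt fl.
(* If no predecessor computed v f, then f would be [limit_increasing]: standard expansions of f
   exist at each predecessor k, and the minimum of any of them is [tr k f], which would be below v
   f. *)
move=> nf; apply: contrapT => nk; apply: nf => k /(is_next_pred _ nl) kl.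
have kltl := is_pred_lt kl; have invk := inv k kltl; split.
  exact: standard_expansion_exists (lt_not_max kltl).
move=> s c c_std; rewrite -(trunc_min_value (inv_le_lt inv kltl) c_std).
rewrite /ext_lt [X in _ && X](inv_trunc_le f invk) andbT.
by apply/eqP => kf; apply: nk; exists k.
Qed.

Lemma pred_degree k l : (forall q, (q < l)%O -> key_inv q) -> is_pred k l -> ~ is_max l ->
  (size (Q l)).-1 = (alpha l * (size (Q k)).-1)%N.
Proof.
move=> inv kl lM; case: (kl) => [kls|[nl _]]; first exact: succ_degree.
have kltl := is_pred_lt kl; case: hpre => _ _ _ _; apply=> //.
  by rewrite -lt0x (le_lt_trans (le0x k) kltl).
exact/is_next_pred.
Qed.

(** [key_step] and [mono_step] ask for one truncation that computes several values at once. The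
    maximum of the predecessors found for single polynomials is again a predecessor and, by
    monotonicity, computes them all. *)
Lemma pred_trunc_eq_seq k0 l (s : seq {poly K}) : (forall q, (q < l)%O -> key_inv q) ->
    l != \bot%O -> (k0 < l)%O -> (forall f, f \in s -> (size f < size (Q l))%N) ->
  exists k, [/\ is_pred k l, (k0 <= k)%O & forall f, f \in s -> tr k f = v f].
Proof.
move=> inv l0 k0l; elim: s => [|f s IH] sP.
  have [k kl] := is_pred_exists l0; exists (Order.max k k0); split=> //.
    apply: (is_pred_between kl); first by rewrite le_max lexx.
    by rewrite gt_max k0l (is_pred_lt kl).
  by rewrite le_max lexx orbT.
have [g gs|k [kl k0k ks]] := IH; first by apply: sP; rewrite inE gs orbT.
have [k' k'l k'f] := pred_trunc_eq inv l0 (sP f (mem_head _ _)).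
exists (Order.max k k'); set m := Order.max k k'.
have ml : (m < l)%O by rewrite gt_max (is_pred_lt kl) (is_pred_lt k'l).
have km : (k <= m)%O by rewrite le_max lexx.
split=> [||g].
- exact: is_pred_between kl km ml.
- exact: le_trans k0k km.
rewrite inE => /predU1P[->|gs].
  by apply: trunc_eq_mono k'f; [exact: inv|rewrite le_max lexx orbT].
by apply: trunc_eq_mono (ks g gs); [exact: inv|].
Qed.

(** Fewer than alpha l + 1 digits in Q_k suffice by degree, and each is a Q_k-free standard
    expansion. Multiplying its monomials by Q_k^j with j < alpha l gives Q_l-free standard
    monomials, and [tr k f = v f] bounds their values. *)
Lemma has_standard_pred k l f : (forall q, (q < l)%O -> key_inv q) -> is_pred k l ->
    (size f < size (Q l))%N -> ~ is_max l -> tr k f = v f ->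
  has_standard nu alpha Q l (fine (v f)) f.
Proof.
move=> inv kl fl lM kf; have kltl := is_pred_lt kl; have invk := inv k kltl.
have [b vk] := vQ k; have k1 := inv_gt1 invk.
have [->|/(rval_fin v)[x vf]] := eqVneq f 0; first exact: has_standard0.
have fa : (size f < size (Q k ^+ alpha l))%N.
  apply: leq_trans fl _; rewrite -[X in (_ <= X)%N]prednK; last first.
    by rewrite size_poly_gt0 expf_neq0 ?monic_neq0.
  by rewrite size_exp mulnC -(pred_degree inv kl lM) prednK // size_poly_gt0 monic_neq0.
rewrite vf /= (dig_expansion_lt fa) -(big_mkord xpredT (fun j => dig (Q k) f j * Q k ^+ j)).
apply: has_standard_sum => j; rewrite mem_index_iota => /andP[_ ja].
have /(trunc_ge (Q_monic k) k1 vk)/(_ j) xj : x%:E <=oo tr k f by rewrite kf vf ext_lexx.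
have [e e_free e_dig] := inv_std invk (lt_not_max kltl) (size_dig (Q_monic k) f j).
rewrite e_dig in xj *; have [e_std ve] := e_free.
rewrite /Defs.expand mulr_suml; apply: has_standard_sum => m me.
have [m_std mk] := e_std m me.
have [] := @standard_raise _ _ _ L_wf k l m j alpha_gt0 _ m_std mk ja.
  by case: (kl) => [|[_]]; [left|right].
set m' := [fsfun m with k |-> j] => m'_std m'l.
have mE : monomial Q m * Q k ^+ j = monomial Q m'.
  have m'E q : m' q = if q == k then j else m q by exact: fsfun_withE.
  pose A := (k |` finsupp m)%fset.
  rewrite (@monomialE _ _ _ Q A m) ?fsubsetU1 // (@monomialE _ _ _ Q A m'); last first.
    apply/fsubsetP => q; rewrite mem_finsupp m'E !inE mem_finsupp.
    by case: (q == k).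
  rewrite !(@big_fsetD1 _ _ _ _ k A) ?fset1U1 //= m'E eqxx mk expr0 mul1r mulrC.
  congr (_ * _); rewrite big_seq [RHS]big_seq; apply: eq_bigr => q.
  by rewrite !inE m'E => /andP[/negPf->].
have mvE : e m *: monomial Q m * Q k ^+ j = e m *: monomial Q m' by rewrite -scalerAl mE.
rewrite mvE; apply: has_standard_monomial => //; rewrite -mvE -[x](subrK (b *+ j)).
rewrite rval_leM ?(rvalX _ vk) ?ext_lexx //.
by move: m me {m_std mk m' m'_std m'l mE mvE}; apply/ext_le_bigmin; rewrite -ve.
Qed.

Lemma key_inv_bot : key_inv \bot%O.
Proof.
have Q0 : Q \bot%O = 'X by case: hpre.
have no_lt q : (q < \bot%O)%O -> False by rewrite ltx0.
split=> [|f g||||_ f|k [/no_lt//]].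
- by rewrite Q0 size_polyX.
- rewrite Q0 size_polyX !ltnS => sf sg f0 g0.
  rewrite divp_small ?mul0r ?rval0; last first.
    rewrite size_polyX (leq_ltn_trans (size_polyMleq _ _)) //.
    by move: (size f) (size g) sf sg => [|[|a]] [|[|b]].
  by have [x ->] := rval_fin v (mulf_neq0 f0 g0).
- by move=> q /no_lt.
- by move=> q f /no_lt.
- by rewrite eqxx.
rewrite Q0 size_polyX ltnS => /size1_polyC ->; apply: has_standard_free.
have monomial0 : monomial Q [fsfun of _ => 0%N] = 1.
  by rewrite /monomial finsupp0 big_seq_fset0.
rewrite -[X in has_standard _ _ _ _ _ X]mulr1 mul_polyC -monomial0.
apply: has_standard_monomial; rewrite ?fsfun0E //.
  split=> [q|q r _ _|i r _ _ q q' _ _]; by rewrite ?fsfun0E ?eqxx.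
rewrite monomial0 -mul_polyC mulr1.
have [->|/(rval_fin v)[x ->]] := eqVneq (f`_0)%:P 0; first by rewrite rval0.
exact: ext_lexx.
Qed.

Lemma key_inv_step l : l != \bot%O -> (forall q, (q < l)%O -> key_inv q) -> key_inv l.
Proof.
move=> l0 inv; have [k0 k0l] := is_pred_exists l0; have k0lt := is_pred_lt k0l.
have l_gt1 : (1 < size (Q l))%N.
  apply: leq_trans (inv_gt1 (inv k0 k0lt)) _.
  by apply: inv_size_le (inv k0 k0lt) _; exact: pred_trunc_lt.
split=> // [f g sf sg f0 g0|q ql|q f ql|_ f fl|lM f fl|k kl].
- have size_quo : (size ((f * g) %/ Q l)%R < size (Q l))%N.
    rewrite size_divp ?monic_neq0 // size_mul //.
    by move: (size f) (size g) (size (Q l)) sf sg l_gt1 => sf sg sq *; lia.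
  have [|k [kl _ ks]] := @pred_trunc_eq_seq k0 l
     [:: f; g; (f * g) %/ Q l; (f * g) %% Q l] inv l0 k0lt.
    by move=> h; rewrite !inE => /or4P[] /eqP -> //; rewrite ltn_modp monic_neq0.
  have kltl := is_pred_lt kl; have [w wE] := trunc_rval (inv k kltl).
  have w_le h : w h <=oo v h by rewrite wE; exact/inv_trunc_le/inv.
  have w_lt : w (Q l) <oo v (Q l) by rewrite wE; exact: pred_trunc_lt.
  by apply: (key_step (Q_monic l) w_lt) => //; rewrite wE ks ?inE ?eqxx ?orbT.
(* The empty list merely asks for a predecessor k with q <= k. *)
- have [|k [kl qk _]] := @pred_trunc_eq_seq q l [::] inv l0 ql; first by [].
  have invk := inv k (is_pred_lt kl).
  exact: ext_le_lt_trans (inv_mono_le _ invk qk) (pred_trunc_lt inv kl).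
- have [|k [kl qk ks]] := @pred_trunc_eq_seq q l
      [seq dig (Q l) f j | j <- iota 0 (size f)] inv l0 ql.
    by move=> h /mapP[j _ ->]; exact: size_dig.
  have kltl := is_pred_lt kl; have invk := inv k kltl; have [w wE] := trunc_rval invk.
  have w_le h : w h <=oo v h by rewrite wE; exact: inv_trunc_le.
  have w_lt : w (Q l) <oo v (Q l) by rewrite wE; exact: pred_trunc_lt.
  apply: ext_le_trans (inv_mono_le f invk qk) _; rewrite -wE.
  apply: (mono_step (Q_monic l) l_gt1 w_le w_lt) => j.
  have [fj|jf] := leqP (size f) j; first by rewrite size_dig_ge // !rval0.
  by rewrite wE ks //; apply: map_f; rewrite mem_iota.
- by have [k /is_pred_lt kl kf] := pred_trunc_eq inv l0 fl; exists k.
- have [k kl kf] := pred_trunc_eq inv l0 fl.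
  exact/has_standard_free/(has_standard_pred inv kl fl lM kf).
exact: succ_degree.
Qed.

Lemma key_invP l : key_inv l.
Proof.
elim/(well_founded_ind L_wf): l => l IH.
by have [->|l0] := eqVneq l \bot%O; [exact: key_inv_bot|exact: key_inv_step].
Qed.

End KeyInduction.

(** * Comparison of slopes *)

Section SlopeInduction.
Context (K : fieldType) (V : orderedQModType).
Context (nu : valuation {fraction {poly K}} V).
Context {d : Order.disp_t} (L : bOrderType d) (alpha : L -> nat) (Q : L -> {poly K}).
Hypothesis L_wf : well_founded (fun k l : L => (k < l)%O).
Hypotheses (hpre : pre_key alpha Q) (hb : key_b nu alpha Q) (hc : key_c nu alpha Q).
Context (p : nat).
Hypothesis hp : residue_char_exponent nu p.
Implicit Types (k l q : L) (f h : {poly K}).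

Local Notation v := (poly_val nu).
Local Notation tr l := (trunc v (Q l)).

Let inv l : key_inv nu alpha Q l. Proof. exact: key_invP. Qed.
Let Q_monic l : Q l \is monic. Proof. by case: hpre. Qed.
Let Q_gt1 l : (1 < size (Q l))%N. Proof. by case: (inv l). Qed.
Let Q_key l : is_key v (Q l). Proof. by case: (inv l). Qed.

Lemma val_natr n : v n%:R = nu n%:R.
Proof. by rewrite -[LHS]/(nu _) rmorph_nat. Qed.

Lemma residue_char : p = 1%N \/ prime p /\ 0%:E <oo v p%:R.
Proof. by case: hp => [[pp pv]|[-> _]]; [right; rewrite val_natr|left]. Qed.

(** For prime p a relation a p - c m = 1 would give 1 a positive value if m had one. For p = 1 the
    quotient is n itself, and a positive value would descend to one of its prime factors. *)
Lemma residue_char_unit n : (0 < n)%N -> v (n %/ p ^ logn p n)%:R = 0%:E.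
Proof.
move=> n0; set m := (n %/ _)%N.
have m0 : (0 < m)%N.
  have pn : (0 < p ^ logn p n)%N.
    by rewrite expn_gt0; case: residue_char => [->|[/prime_gt0 ->]].
  by rewrite divn_gt0 //; exact: dvdn_leq n0 (pfactor_dvdnn p n).
apply: ext_le_anti; last exact: rval_natr.
rewrite ext_leNgt; apply/negP => v_gt0.
case: hp => [[p_pr p_gt0]|[_ no_prime]].
  have [m' pm' nE] := pfactor_coprime p_pr n0.
  have mE : m = m' by rewrite /m {1}nE mulnK // expn_gt0 prime_gt0.
  have [[a c] /= ac] := coprimeP _ (prime_gt0 p_pr) pm'.
  have : 0%:E <oo v 1; last by rewrite rval1 (negPf (ext_ltxx _)).
  have -> : 1 = a%:R * p%:R - c%:R * m%:R :> {poly K}.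
    by rewrite -!natrM -natrB ?mE ?ac //; move: ac; lia.
  rewrite -val_natr in p_gt0.
  apply: rval_ltB; rewrite -[0]addr0 mulrC; apply: rval_ltM => //; exact: rval_natr.
have [r r_pr] : exists2 r, prime r & 0%:E <oo v r%:R; last first.
  by rewrite val_natr => /(no_prime r r_pr).
elim/ltn_ind: m m0 v_gt0 => m IH m0 v_gt0.
have [m1|m1] := leqP m 1.
  have mE : m = 1%N by apply/eqP; rewrite eqn_leq m1.
  by move: v_gt0; rewrite mE rval1 (negPf (ext_ltxx _)).
have /dvdnP[m' mE] := pdiv_dvd m; have pdiv_pr := pdiv_prime m1.
have [r_gt0|r_le0] := boolP (0%:E <oo v (pdiv m)%:R); first by exists (pdiv m).
have r0 : v (pdiv m)%:R = 0%:E.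
  by apply: ext_le_anti; [rewrite ext_leNgt|exact: rval_natr].
have m'0 : (0 < m')%N by move: m0; rewrite mE muln_gt0 => /andP[].
apply: (IH m') => //.
  by rewrite [X in (_ < X)%N]mE ltn_Pmulr // prime_gt1.
move: v_gt0; rewrite mE natrM rvalM r0.
by case: (v _) => [y||] //; rewrite ext_ltE /adde /= addr0 => y0; rewrite ext_ltE.
Qed.

Lemma scale_natVK n (y : V) : (0 < n)%N -> (n%:R^-1 *: y : V) *+ n = y.
Proof.
move=> n0; rewrite -scaler_nat scalerA mulfV ?scale1r //.
by rewrite Num.Theory.pnatr_eq0 -lt0n.
Qed.

Lemma nderivn_size_neq0 f : f \is monic -> f^`N((size f).-1) != 0.
Proof.
move=> fm; apply/eqP => /(congr1 (fun g : {poly K} => g`_0)).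
rewrite coef_nderivn addn0 binn coef0 -lead_coefE (eqP fm).
by apply/eqP; exact: oner_neq0.
Qed.

Lemma nderivn_size_gt f n : (size f <= n)%N -> f^`N(n) = 0.
Proof. by move=> fn; exact: nderivn_poly0. Qed.

Lemma max_slope_exists l b : v (Q l) = b%:E -> exists eps n0, max_slope v (Q l) b eps n0.
Proof.
move=> vl; pose N := size (Q l).
(* At vanishing derivatives [F] has a meaningless default value; [P] excludes them. The order deg
   Q_l satisfies [P], as the derivative there is nonzero. *)
pose F (n : 'I_N) : V := (n%:R^-1 : rat) *: (b - fine (v (Q l)^`N(n))).
pose P (n : 'I_N) := (0 < n)%N && ((Q l)^`N(n) != 0).
have N1 : (N.-1 < N)%N by rewrite prednK // ltnW // Q_gt1.
have P0 : P (Ordinal N1).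
  rewrite /P /= nderivn_size_neq0 ?Q_monic // andbT.
  by have := Q_gt1 l; rewrite -/N; case: (N) => [|[]].
case: (@Order.TotalTheory.arg_maxP _ _ _ _ P F P0) => n1 /andP[n1_gt0 n1_neq0] n1_max.
pose eps := F n1.
have F_val (n : 'I_N) : P n -> v (Q l)^`N(n) = (b - F n *+ n)%:E.
  move=> /andP[n_gt0 n_neq0]; have [y vy] := rval_fin v n_neq0.
  by rewrite /F scale_natVK // vy /= subKr.
have le_eps n : (0 < n)%N -> (b - eps *+ n)%:E <=oo v (Q l)^`N(n).
  move=> n_gt0; have [n_eq0|n_neq0] := eqVneq (Q l)^`N(n) 0; first by rewrite n_eq0 rval0.
  have nN : (n < N)%N.
    by rewrite ltnNge; apply: contra_neqN n_neq0 => /nderivn_size_gt.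
  have Pn : P (Ordinal nN) by rewrite /P /= n_gt0.
  rewrite (F_val _ Pn) /= ler_translateE ler_oppE; apply: ler_mulrn; exact: n1_max.
pose A n := (0 < n)%N && (v (Q l)^`N(n) == (b - eps *+ n)%:E).
have exA : exists n, A n by exists n1; rewrite /A n1_gt0 F_val ?eqxx // /P n1_gt0.
case: (ex_minnP exA) => n0 /andP[n0_gt0 /eqP vn0] n0_min.
exists eps, n0; split=> // n /andP[n_gt0 n_lt].
rewrite /ext_lt le_eps // andbT eq_sym; apply: contraTN n_lt => vn.
by rewrite -leqNgt n0_min // /A n_gt0.
Qed.

Lemma nderiv_attained k b eps n0 h x : v (Q k) = b%:E -> max_slope v (Q k) b eps n0 ->
    small_slopes v (Q k) eps -> tr k h = x%:E ->
    (exists2 j, (0 < j)%N & v (dig (Q k) h j * Q k ^+ j) = x%:E) ->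
  exists2 n, (0 < n)%N & tr k h^`N(n) = (x - eps *+ n)%:E.
Proof.
move=> vk k_slope k_small hx [j1 j1_gt0 vj1].
pose r := dig (Q k) h; pose s := size h.
have j1s : (j1 < s)%N.
  rewrite ltnNge; apply/negP => sj; move: vj1.
  by rewrite size_dig_ge // mul0r rval0.
pose P (j : 'I_s) := (0 < j)%N && (v (r j * Q k ^+ j) == x%:E).
have P1 : P (Ordinal j1s) by apply/andP; split=> //; apply/eqP.
case: (@arg_minnP _ _ P (fun j => logn p j) P1) => j /andP[j_gt0 /eqP vj] j_min.
exists (n0 * p ^ logn p j)%N.
  rewrite muln_gt0; case: k_slope => -> _ _ _ /=.
  by rewrite expn_gt0; case: residue_char => [->|[/prime_gt0 ->]].
have := trunc_nderiv_eq (Q_monic k) (Q_gt1 k) vk (@Q_key k) k_slope k_small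
  residue_char residue_char_unit (s := s) (r := r) (x := x) (k0 := j).
rewrite -(dig_expansion (Q_monic k) (Q_gt1 k) h); apply=> //.
- by move=> i; exact: size_dig.
- move=> i _; have /(trunc_ge (Q_monic k) (Q_gt1 k) vk)/(_ i) : x%:E <=oo tr k h.
    by rewrite hx ext_lexx.
  rewrite rvalM (rvalX _ vk).
  by case: (v _) => [y||] //=; rewrite ler_subl_translate.
- by rewrite j_gt0 ltn_ord.
move=> i /andP[i_gt0 i_s] vi; apply: (j_min (Ordinal i_s)).
by apply/andP; split=> //; apply/eqP.
Qed.

Lemma small_slopesP l b eps n0 : v (Q l) = b%:E -> max_slope v (Q l) b eps n0 ->
  small_slopes v (Q l) eps.
Proof.
elim/(well_founded_ind L_wf): l b eps n0 => l IH b eps n0 vl l_slope f n x fl n_gt0 xf.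
have [->|f0] := eqVneq f 0.
  by rewrite nderivn_size_gt ?size_poly0 // rval0.
have [lbot|l0] := eqVneq l \bot%O.
  have Q0 : Q \bot%O = 'X by case: hpre.
  rewrite nderivn_size_gt ?rval0 //; move: fl; rewrite lbot Q0 size_polyX ltnS.
  by move/leq_trans; apply.
have [k0 /is_pred_lt k0l] := is_pred_exists hc l0.
(* Besides v f, the truncation at k has to compute the values of all derivatives of Q_l, so that a
   slope found for [tr k] is bounded by the slopes of Q_l under v. *)
have [|k [kl _ ks]] := @pred_trunc_eq_seq _ _ _ _ _ alpha _ L_wf hpre hb hc k0 l
    (f :: [seq (Q l)^`N(j.+1) | j <- iota 0 (size (Q l))]) (fun q _ => inv q) l0 k0l.
  move=> g; rewrite inE => /predU1P[->//|/mapP[j _ ->]].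
  apply: leq_ltn_trans (size_nderivn _ _) _.
  by have := Q_gt1 l; case: (size (Q l)) => // m _; rewrite subSS ltnS leq_subr.
have kltl := is_pred_lt kl; have [bk vk] := rval_fin v (monic_neq0 (Q_monic k)).
have [epsk [nk k_slope]] := max_slope_exists vk.
have k_small := IH k kltl _ _ _ vk k_slope.
have [y ly] := trunc_fin (Q_monic k) (Q_gt1 k) vk (monic_neq0 (Q_monic l)).
have y_lt : y < b by have := inv_lt (inv l) kltl; rewrite ly vl ext_ltE.
have [N N_gt0 vN] : exists2 N, (0 < N)%N & tr k (Q l)^`N(N) = (y - epsk *+ N)%:E.
  (* A digit of positive index must attain y. If none did, Q_l minus its digit of index 0 would lie
     above y, as does v (Q l) = b; then that digit too would lie above y, and no digit would attain
     [tr k (Q l)]. *)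
  apply: (nderiv_attained vk k_slope k_small ly); apply: contrapT => nj.
  have yl : y%:E <=oo tr k (Q l) by rewrite ly ext_lexx.
  have dig_gt j : (0 < j)%N -> (y - bk *+ j)%:E <oo v (dig (Q k) (Q l) j).
    move=> j_gt0; have := yl; move/(trunc_ge (Q_monic k) (Q_gt1 k) vk)/(_ j) => yj.
    rewrite /ext_lt yj andbT; apply/eqP => vj; apply: nj; exists j => //.
    by rewrite (rvalM_fin (esym vj) (rvalX j vk)) subrK.
  have dig_gt0 : y%:E <oo tr k (Q l - dig (Q k) (Q l) 0).
    apply/(trunc_gt (Q_monic k) (Q_gt1 k) vk) => j.
    rewrite digD digN (dig_small j (size_dig (Q_monic k) (Q l) 0)).
    case: j => [|j]; first by rewrite subrr rval0.
    by rewrite subr0 dig_gt.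
  have : y%:E <oo v (dig (Q k) (Q l) 0).
    rewrite -[dig _ _ _](subKr (Q l)); apply: rval_ltB; first by rewrite vl ext_ltE.
    exact: ext_lt_le_trans dig_gt0 (inv_trunc_le hpre _ (inv k)).
  move=> dig0_gt; have : y%:E <oo tr k (Q l); last by rewrite ly (negPf (ext_ltxx _)).
  apply/(trunc_gt (Q_monic k) (Q_gt1 k) vk) => -[|j]; last exact: dig_gt.
  by rewrite mulr0n subr0.
have eps_lt : epsk < eps.
  have NQ : (N < size (Q l))%N.
    rewrite ltnNge; apply/negP => /nderivn_size_gt N0.
    by move: vN; rewrite N0 trunc0.
  have vN' : v (Q l)^`N(N) = (y - epsk *+ N)%:E.
    rewrite -vN ks // inE; apply/orP; right; apply/mapP; exists N.-1; last by rewrite prednK.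
    by rewrite mem_iota /= (leq_ltn_trans (leq_pred _)).
  rewrite -(ltr_mulrnE _ _ N_gt0).
  have : b - eps *+ N <= y - epsk *+ N by case: l_slope => _ _ /(_ N N_gt0); rewrite vN'.
  move=> /le_lt_trans/(_ (_ : y - epsk *+ N < b - epsk *+ N)).
  rewrite ltr_translateE ltr_oppE; apply.
  by rewrite addrC [b - _]addrC ltr_translateE.
have kf : tr k f = v f by apply: ks; exact: mem_head.
have : (x - epsk *+ n)%:E <=oo v f^`N(n).
  apply: ext_le_trans (inv_trunc_le hpre _ (inv k)).
  by apply: (trunc_nderiv_ge (Q_monic k) (Q_gt1 k) vk (@Q_key k) k_slope k_small); rewrite kf.
apply: ext_lt_le_trans; rewrite ext_ltE ltr_translateE ltr_oppE.
exact: ltr_mulrn.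
Qed.

End SlopeInduction.

(** * From the divided slopes of [is_b] to [max_slope] *)

Section SlopeValues.
Context (K : fieldType) (V : orderedQModType).
Context (nu : valuation {fraction {poly K}} V).
Context {d : Order.disp_t} (L : bOrderType d) (Q : L -> {poly K}).

Local Notation v := (poly_val nu).

Lemma scale_natM (n b : nat) (y : V) :
  (b%:R / n%:R : rat) *: y = ((n%:R^-1 : rat) *: y : V) *+ b.
Proof. by rewrite -scaler_nat scalerA. Qed.

Lemma is_b_max_slope l n0 b : Q l \is monic -> (1 < size (Q l))%N -> v (Q l) = b%:E ->
  is_b nu Q l n0 -> exists2 eps, max_slope v (Q l) b eps n0 &
    forall n : nat, er_map (fun g : V => (n%:R / n0%:R : rat) *: g)
      (beta nu Q l - nu (Q l)^`N(n0)%:F)%E = (eps *+ n)%:E.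
Proof.
move=> l_monic l_gt1 vl [n0_gt0 n0_max n0_min].
have slopeE n y : v (Q l)^`N(n) = y%:E -> slope nu Q l n = ((n%:R^-1 : rat) *: (b - y))%:E.
  by move=> vy; rewrite /slope /beta -[nu (Q l)%:F]/(v _) -[nu _^`N(n)%:F]/(v _) vl vy.
have [n1_gt0 [y1 vy1]] : (0 < (size (Q l)).-1)%N /\
    exists y, v (Q l)^`N((size (Q l)).-1) = y%:E.
  split; last by apply: rval_fin; exact: nderivn_size_neq0.
  by case: (size _) l_gt1 => [|[]].
(* A vanishing derivative at n0 would have slope -oo, below the finite slope at order deg Q_l. *)
have [y0 vy0] : exists y, v (Q l)^`N(n0) = y%:E.
  apply: rval_fin; apply: contraTneq (n0_max _ n1_gt0) => n0_eq0.
  rewrite (slopeE _ _ vy1) /slope -[nu _^`N(n0)%:F]/(v _) n0_eq0 rval0.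
  by rewrite /beta -[nu _]/(v _) vl.
pose eps : V := (n0%:R^-1 : rat) *: (b - y0).
have epsE : slope nu Q l n0 = eps%:E by exact: slopeE.
have y0E : y0 = b - eps *+ n0 by rewrite scale_natVK // subKr.
exists eps; last first.
  move=> n; rewrite /beta -[nu (Q l)%:F]/(v _) -[nu _^`N(n0)%:F]/(v _) vl vy0 /=.
  by rewrite scale_natM.
have le_eps n : (0 < n)%N -> (b - eps *+ n)%:E <=oo v (Q l)^`N(n).
  move=> n_gt0; have [n_eq0|/(rval_fin v)[y vy]] := eqVneq (Q l)^`N(n) 0.
    by rewrite n_eq0 rval0.
  have := n0_max n n_gt0; rewrite (slopeE _ _ vy) epsE vy /= => le_y.
  have := ler_mulrn n le_y; rewrite scale_natVK // => {}le_y.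
  by rewrite ler_subl_translate addrC -ler_subl_translate.
split=> // [|n /andP[n_gt0 n_lt]]; first by rewrite vy0 y0E.
rewrite /ext_lt le_eps // andbT eq_sym; apply: contraTN n_lt => /eqP vn.
rewrite -leqNgt n0_min // (slopeE _ _ vn) epsE subKr -scaler_nat scalerA mulVf ?scale1r //.
by rewrite Num.Theory.pnatr_eq0 -lt0n.
Qed.

End SlopeValues.

Theorem proposition7p2 (K : fieldType) (V : orderedQModType)
  (nu : valuation {fraction {poly K}} V)
  (hV : divisible_hull (value_group nu) = setT)
  (hrank : rank_one (value_group (restr_const nu)))
  (hx : 0%:E <oo nu ('X)%:F)
  (p : nat) (hp : residue_char_exponent nu p)
  (d : Order.disp_t) (L : bOrderType d)
  (hwf : well_founded (fun k l : L => (k < l)%O))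
  (hcount : countable [set: L])
  (alpha : L -> nat) (Q : L -> {poly K})
  (hkey : key_polynomials nu alpha Q) (hcomplete : is_complete nu Q)
  (i : L) (h : {poly K}) (hh : h != 0)
  (bi : nat) (hbi : is_b nu Q i bi) :
  (forall b : nat,
     (nu_trunc nu Q i h - nu_trunc nu Q i h^`N(b))%E
     <=oo er_map (fun g : V => (b%:R / bi%:R : rat) *: g)
            (beta nu Q i - nu (Q i)^`N(bi)%:F)%E)
  /\
  (forall (s : nat) (c : nat -> {poly K}) (j : nat),
     standard_expansion nu alpha Q i s c h ->
     [set k : nat | (k <= s)%N /\ nu (c k * Q i ^+ k)%:F = nu_trunc nu Q i h]%classic
       <> [set 0%N]%classic ->
     (j <= s)%N ->
     (forall k : nat, (k <= s)%N ->
        lex_le (nu_trunc nu Q i (c j * Q i ^+ j), nu_p p j, j)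
               (nu_trunc nu Q i (c k * Q i ^+ k), nu_p p k, k)) ->
     exists e : nat, nu_p p j = e%:E /\
       (nu_trunc nu Q i h - nu_trunc nu Q i h^`N(bi * p ^ e))%E
       = er_map (fun g : V => ((bi * p ^ e)%N%:R / bi%:R : rat) *: g)
           (beta nu Q i - nu (Q i)^`N(bi)%:F)%E).
Proof.
case: hkey => hpre _ hb hc _; have inv := key_invP hwf hpre hb hc.
have Q_monic l : Q l \is monic by case: hpre.
have i_gt1 := inv_gt1 (inv i).
have [b vi] : exists b, poly_val nu (Q i) = b%:E by apply: rval_fin; exact: monic_neq0.
have [eps i_slope epsE] := is_b_max_slope (Q_monic i) i_gt1 vi hbi.
have i_small := small_slopesP hwf hpre hb hc hp vi i_slope.
have [x trh] := trunc_fin (Q_monic i) i_gt1 vi hh.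
have trE f : nu_trunc nu Q i f = trunc (poly_val nu) (Q i) f by [].
have deriv_ge := trunc_nderiv_ge (Q_monic i) i_gt1 vi (inv_key (inv i)) i_slope i_small.
have deriv_gt := trunc_nderiv_gt (Q_monic i) i_gt1 vi (inv_key (inv i)) i_slope i_small.
split=> [n|s c j c_std J_neq0 js j_min].
  rewrite epsE !trE trh; have := @deriv_ge h x n.
  rewrite trh ext_lexx => /(_ isT).
  by case: (trunc _ _ _) => [y||] //=; rewrite !ler_subl_translate addrC.
have [cP hE] := c_std.
have c_small k : (k < s.+1)%N -> nearly_small (poly_val nu) (Q i) (c k).
  move=> ks; have [e e_free ->] := cP k ks.
  apply: nearly_small_free e_free => //; first exact: inv_key.
  by move=> q qi; exact: (inv_nearly_small hpre (inv q) (inv i) qi).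
pose w := trunc_val (Q_monic i) i_gt1 vi (inv_key (inv i)).
(* The degree of c_k is not under control, so the term is not known to belong to the expansion in
   powers of Q_i; the value of c_k is preserved because c_k is nearly small, and multiplicativity
   does the rest. *)
have trc k : (k < s.+1)%N -> trunc (poly_val nu) (Q i) (c k * Q i ^+ k) = poly_val nu (c k * Q i ^+ k).
  move=> ks; rewrite -[LHS]/(w _) rvalM [RHS]rvalM (rvalX k vi).
  rewrite (rvalX (v := w) (g := b)); last exact: (etrans (trunc_q (Q_monic i) i_gt1 vi) vi).
  congr (_ + _)%E; apply: ext_le_anti; first exact: (trunc_le (Q_monic i) i_gt1 vi).
  have [->|/(rval_fin (poly_val nu))[y vy]] := eqVneq (c k) 0; first by rewrite (rval0 w) rval0.
  by rewrite vy; apply: dominated_ge; exact: c_small.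
have x_min : x%:E = min_value nu Q i s c.
  by rewrite -trh; apply: (trunc_min_value hpre _ c_std) => q _.
have x_le k : (k < s.+1)%N -> x%:E <=oo poly_val nu (c k * Q i ^+ k).
  move=> ks; have : x%:E <=oo min_value nu Q i s c by rewrite -x_min ext_lexx.
  by move/ext_le_bigmin; apply; rewrite mem_iota.
have lex_min k : (k <= s)%N ->
    poly_val nu (c j * Q i ^+ j) <oo poly_val nu (c k * Q i ^+ k) \/
    poly_val nu (c j * Q i ^+ j) = poly_val nu (c k * Q i ^+ k) /\ nu_p p j <=oo nu_p p k.
  move=> ks; rewrite -!trc //; case: (j_min k ks); first by left.
  case=> e; case=> [lt_p|[eq_p _]]; right; split=> //; first by case/andP: lt_p.
  by rewrite [nu_p p j]eq_p; case: (nu_p p k) => /=.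
have vj : poly_val nu (c j * Q i ^+ j) = x%:E.
  apply: ext_le_anti; last exact: x_le.
  rewrite x_min; apply/ext_le_bigmin => k; rewrite mem_iota => /andP[_ ks].
  by case: (lex_min k ks) => [/ext_lt_le|[-> _]] //; exact: ext_lexx.
have nu_p_le k : (k <= s)%N -> poly_val nu (c k * Q i ^+ k) = x%:E -> nu_p p j <=oo nu_p p k.
  move=> ks vk; case: (lex_min k ks) => [|[]] //.
  by rewrite vj vk (negPf (ext_ltxx _)).
(* Since [nu_p p 0] is infinite, j = 0 would mean that no positive index attains nu_i(h), and the
   set of attaining indices would be {0}. *)
have j_gt0 : (0 < j)%N.
  rewrite lt0n; apply/eqP => j0; apply: J_neq0.
  apply/seteqP; split=> k /=; rewrite trE trh -[nu _]/(poly_val nu _); last first.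
    by move=> ->; rewrite -j0 vj.
  case=> ks /(nu_p_le k ks); rewrite j0 /nu_p eqxx; case: eqP => // _.
  by case: ifP.
(* The sum with digits r_k differs from h only above x, so by [deriv_gt] the derivatives of order n
   differ only above x - eps * n. *)
have [r [r_size r_val r_near]] :=
  nearly_small_expansion (Q_monic i) i_gt1 vi (inv_key (inv i)) hE c_small.
have vr k : (k < s.+1)%N -> poly_val nu (r k * Q i ^+ k) = poly_val nu (c k * Q i ^+ k).
  by move=> ks; rewrite !rvalM r_val.
have p_char := residue_char hp.
pose n := (bi * p ^ logn p j)%N.
(* Index 0 is left out: [logn p 0] is 0, whereas [nu_p p 0] is infinite. *)
have logn_le k : (0 < k < s.+1)%N -> poly_val nu (r k * Q i ^+ k) = x%:E -> (logn p j <= logn p k)%N.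
  move=> /andP[k_gt0 ks]; rewrite vr // => /(nu_p_le k ks).
  by rewrite /nu_p !gtn_eqF //; case: p_char => [->|[/prime_gt1 -> _]].
have deriv_r : trunc (poly_val nu) (Q i) (\sum_(k < s.+1) r k * Q i ^+ k)^`N(n) = (x - eps *+ n)%:E.
  apply: (trunc_nderiv_eq (Q_monic i) i_gt1 vi (inv_key (inv i)) i_slope i_small p_char
    (residue_char_unit hp)) => //.
  - by move=> k ks; rewrite vr // x_le.
  - by rewrite j_gt0.
  by rewrite vr.
have deriv_h : trunc (poly_val nu) (Q i) h^`N(n) = (x - eps *+ n)%:E.
  rewrite -[h](subrKC (\sum_(k < s.+1) r k * Q i ^+ k)) nderivnD.
  apply: (rval_ltDr (v := w)); first exact: deriv_r.
  by apply: deriv_gt; apply: r_near => k ks; exact: x_le.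
(* For p = 1 the convention gives e = 1 while [logn 1 j] is 0; both powers of 1 agree. *)
have [e je ne] : exists2 e, nu_p p j = e%:E & (bi * p ^ e)%N = n.
  rewrite /nu_p gtn_eqF // /n; case: p_char => [->|[/prime_gt1 -> _]]; last by eexists.
  by exists 1%N; rewrite ?exp1n.
exists e; split=> //; rewrite ne epsE !trE trh deriv_h.
by rewrite -[LHS]/((x - (x - eps *+ n))%:E) subKr.
Qed.
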